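(* Let $\xi=(p:E\to B)$ and $\xi'=(p':E'\to B)$ be splitting fibrations with closed cleavages $\Sigma$ and $\Sigma'$, and let $f:E\to E'$ be a cleaved map over $B$. If the induced functor $f:E_b\to E'_b$ is a weak equivalence for every object $b$ of $B$, then the induced map of cleaved nerves $f_*:N_cE\to N_cE'$ is a weak equivalence of bisimplicial sets.
   Context: All categories are small. For a functor $p:E\to B$ and an object $b$ of $B$, the fiber $E_b$ is the subcategory of $E$ of arrows mapped to $\mathrm{id}_b$. An arrow $f:e\to e'$ of $E$ is cartesian if for every $g:e\to e''$ with $p(g)=p(f)$ there is a unique $h:e'\to e''$ with $p(h)=\mathrm{id}_{p(e')}$ and $hf=g$. The functor $p$ is a prefibration if for every object $e$ of $E$ and every arrow $\phi:p(e)\to b$ of $B$ there is a cartesian arrow with domain $e$ lying over $\phi$; it is a fibration if moreover cartesian arrows are closed under composition. A cleavage of $p$ is a set $\Sigma$ of cartesian arrows of $E$ such that for every object $e$ of $E$ and every $\phi:p(e)\to b$ there is a unique arrow $\Sigma_{e,\phi}$ in $\Sigma$ with domain $e$ over $\phi$. All cleavages are assumed normal, i.e. containing the identities. A cleavage is closed if it is closed under composition; a fibration admitting a closed cleavage is called splitting. A fibred map $(f,g):\xi\to\xi'$ between fibrations $p:E\to B$, $p':E'\to B'$ is a pair of functors $f:E\to E'$, $g:B\to B'$ with $p'f=gp$ and $f$ preserving cartesian arrows. If cleavages $\Sigma,\Sigma'$ are given, it is a cleaved map if moreover $f(\Sigma)\subset\Sigma'$; the set of cleaved maps is $\mathrm{Cliv}((\xi,\Sigma),(\xi',\Sigma'))$.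 A cleaved map over $B$ is a functor $f$ such that $B=B'$ and $(f,\mathrm{id}_B)$ is a cleaved map. Let $\underline n=\{0<\dots<n\}$, viewed as a category, and let $\square_{m,n}$ be the fibration $\mathrm{pr}_2:\underline m\times\underline n\to\underline n$ with its unique cleavage $\{(\mathrm{id},\alpha)\}$; this is functorial in $(m,n)\in\Delta\times\Delta$. The cleaved nerve of $(\xi,\Sigma)$ is the bisimplicial set $N_cE=N_c(\xi,\Sigma)$ with $N_c(\xi,\Sigma)_{m,n}=\mathrm{Cliv}(\square_{m,n},(\xi,\Sigma))$, structure maps given by precomposition; it is functorial in cleaved maps by postcomposition. A functor between small categories is a weak equivalence if it induces a homotopy equivalence on classifying spaces. A map of bisimplicial sets is a weak equivalence if it induces a homotopy equivalence between the geometric realizations of the diagonals. *)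

(* Defs.v *)
From HB Require Import structures.
From mathcomp Require Import all_boot all_order all_algebra generic_quotient.
From mathcomp Require Import all_classical reals topology.
From mathcomp Require Import normedtype.
From Stdlib Require Import Relation_Operators.

Set Implicit Arguments.
Unset Strict Implicit.
Unset Printing Implicit Defensive.

Import Order.TTheory GRing.Theory Num.Theory.
Import numFieldNormedType.Exports.
Local Open Scope classical_set_scope.
Local Open Scope quotient_scope.

Local Obligation Tactic := try by [].

(* A category is given by one type of arrows with source and target maps, so
   that equations between images of arrows under functors, as in the notion of
   an arrow lying over another, are plain equations.  [comp g f c] is the
   composite "g after f"; composability is the proof argument [c]. *)
Record category := Category {
  Ob : Type;
  Ar : Type;
  src : Ar -> Ob;
  tgt : Ar -> Ob;
  idm : Ob -> Ar;
  comp : forall g f : Ar, src g = tgt f -> Ar;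
  src_idm : forall x, src (idm x) = x;
  tgt_idm : forall x, tgt (idm x) = x;
  src_comp : forall g f (c : src g = tgt f), src (comp c) = src f;
  tgt_comp : forall g f (c : src g = tgt f), tgt (comp c) = tgt g;
  comp_idl : forall f (c : src (idm (tgt f)) = tgt f), comp c = f;
  comp_idr : forall f (c : src f = tgt (idm (src f))), comp c = f;
  comp_assoc : forall h g f (cgf : src g = tgt f) (chg : src h = tgt g)
    (c1 : src h = tgt (comp cgf)) (c2 : src (comp chg) = tgt f),
    comp c1 = comp c2 }.

Arguments comp {_} g f c.

Lemma comp_congr (C : category) (g g' f f' : Ar C) c c' :
  g = g' -> f = f' -> comp g f c = comp g' f' c'.
Proof. by move=> gg' ff'; subst g' f'; congr (comp g f _). Qed.

Record functor (C D : category) := Functor {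
  fob : Ob C -> Ob D;
  far : Ar C -> Ar D;
  src_far : forall a, src (far a) = fob (src a);
  tgt_far : forall a, tgt (far a) = fob (tgt a);
  far_idm : forall x, far (idm x) = idm (fob x);
  far_comp : forall g f (c : src g = tgt f) (c' : src (far g) = tgt (far f)),
    far (comp g f c) = comp (far g) (far f) c' }.

Arguments far_comp {C D} f {g f0} c c' : rename.

Lemma functor_ext (C D : category) (F G : functor C D) :
  (forall x, fob F x = fob G x) -> (forall a, far F a = far G a) -> F = G.
Proof.
case: F G => [o a p1 p2 p3 p4] [o' a' q1 q2 q3 q4] /= /funext oE /funext aE.
by subst o' a'; congr Functor; exact: Prop_irrelevance.
Qed.

Program Definition functor_id (C : category) : functor C C :=
  @Functor C C id id _ _ _ _.
Next Obligation. by move=> C g f c c'; exact: comp_congr. Qed.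

Program Definition functor_comp (C D E : category)
    (G : functor D E) (F : functor C D) : functor C E :=
  @Functor C E (fob G \o fob F) (far G \o far F) _ _ _ _.
Next Obligation. by move=> C D E G F a /=; rewrite !src_far. Qed.
Next Obligation. by move=> C D E G F a /=; rewrite !tgt_far. Qed.
Next Obligation. by move=> C D E G F a /=; rewrite !far_idm. Qed.
Next Obligation.
move=> C D E G F g f c c' /=.
have c1 : src (far F g) = tgt (far F f) by rewrite src_far tgt_far c.
by rewrite (far_comp F c c1) (far_comp G c1 c').
Qed.

Program Definition prod_cat (C D : category) : category :=
  @Category (Ob C * Ob D) (Ar C * Ar D)
    (fun a => (src a.1, src a.2)) (fun a => (tgt a.1, tgt a.2))
    (fun x => (idm x.1, idm x.2))
    (fun g f c => (comp g.1 f.1 (congr1 fst c), comp g.2 f.2 (congr1 snd c)))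
    _ _ _ _ _ _ _.
Next Obligation. by move=> C D [x y]; rewrite /= !src_idm. Qed.
Next Obligation. by move=> C D [x y]; rewrite /= !tgt_idm. Qed.
Next Obligation. by move=> C D [x y] [x' y'] c; rewrite /= !src_comp. Qed.
Next Obligation. by move=> C D [x y] [x' y'] c; rewrite /= !tgt_comp. Qed.
Next Obligation. by move=> C D [x y] c /=; rewrite !comp_idl. Qed.
Next Obligation. by move=> C D [x y] c /=; rewrite !comp_idr. Qed.
Next Obligation.
by move=> C D h g f cgf chg c1 c2 /=; congr pair; exact: comp_assoc.
Qed.

Program Definition functor_prod (C C' D D' : category)
    (F : functor C C') (G : functor D D') :
    functor (prod_cat C D) (prod_cat C' D') :=
  @Functor (prod_cat C D) (prod_cat C' D')
    (fun x => (fob F x.1, fob G x.2)) (fun a => (far F a.1, far G a.2))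
    _ _ _ _.
Next Obligation. by move=> C C' D D' F G a; rewrite /= !src_far. Qed.
Next Obligation. by move=> C C' D D' F G a; rewrite /= !tgt_far. Qed.
Next Obligation. by move=> C C' D D' F G a; rewrite /= !far_idm. Qed.
Next Obligation.
by move=> C C' D D' F G g f c c'; congr pair; exact: far_comp.
Qed.

Program Definition functor_snd (C D : category) : functor (prod_cat C D) D :=
  @Functor (prod_cat C D) D snd snd _ _ _ _.
Next Obligation. by move=> C D g f c c'; exact: comp_congr. Qed.

Section poset_category.
Context {d : Order.disp_t} (T : porderType d).

Definition poset_ar := {a : T * T | (a.1 <= a.2)%O}.

Definition poset_comp (g f : poset_ar)
    (c : (val g).1 = (val f).2) : poset_ar.
Proof.
exists ((val f).1, (val g).2) => /=.
by apply: le_trans (valP f) _; rewrite -c; exact: (valP g).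
Defined.

Program Definition poset_cat : category :=
  @Category T poset_ar (fun a => (val a).1) (fun a => (val a).2)
    (fun x => exist _ (x, x) (lexx x)) poset_comp _ _ _ _ _ _ _.
Next Obligation. by move=> [[x y] le_xy] c; exact: val_inj. Qed.
Next Obligation. by move=> [[x y] le_xy] c; exact: val_inj. Qed.
Next Obligation. by move=> h g f cgf chg c1 c2; exact: val_inj. Qed.

End poset_category.

Section poset_functor.
Context {d d' : Order.disp_t} {T : porderType d} {T' : porderType d'}.
Variable f : {omorphism T -> T'}.

Definition poset_far (a : poset_ar T) : poset_ar T' :=
  exist _ (f (val a).1, f (val a).2) (omorph_le f (valP a)).

Program Definition poset_functor : functor (poset_cat T) (poset_cat T') :=
  @Functor (poset_cat T) (poset_cat T') f poset_far _ _ _ _.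
Next Obligation. by move=> x; exact: val_inj. Qed.
Next Obligation. by move=> g h c c'; exact: val_inj. Qed.

End poset_functor.

Definition delta (m n : nat) : Type := {omorphism 'I_m.+1 -> 'I_n.+1}.

Definition delta_id (n : nat) : delta n n := idfun.

Definition delta_comp (l m n : nat) (g : delta m n) (f : delta l m) :
  delta l n := g \o f.

Definition ord_cat (n : nat) : category := poset_cat 'I_n.+1.

Definition ord_functor (m n : nat) (t : delta m n) :
  functor (ord_cat m) (ord_cat n) := poset_functor t.

Lemma ord_functor_id (n : nat) :
  ord_functor (delta_id n) = functor_id (ord_cat n).
Proof. by apply: functor_ext => // -[[i j] le_ij]; exact: val_inj. Qed.

Lemma ord_functor_comp (l m n : nat) (g : delta m n) (f : delta l m) :
  ord_functor (delta_comp g f) = functor_comp (ord_functor g) (ord_functor f).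
Proof. by apply: functor_ext => // a; exact: val_inj. Qed.

Record sset := SSet {
  simp : nat -> Type;
  sact : forall m n, delta m n -> simp n -> simp m;
  sact_id : forall n (x : simp n), sact (delta_id n) x = x;
  sact_comp : forall l m n (g : delta m n) (f : delta l m) (x : simp n),
    sact (delta_comp g f) x = sact f (sact g x) }.

Record smap (X Y : sset) := SMap {
  smapf : forall n, simp X n -> simp Y n;
  smap_act : forall m n (t : delta m n) (x : simp X n),
    smapf (sact t x) = sact t (smapf x) }.

Record bisset := BiSSet {
  bsimp : nat -> nat -> Type;
  bact : forall m' m n' n,
    delta m' m -> delta n' n -> bsimp m n -> bsimp m' n';
  bact_id : forall m n (x : bsimp m n), bact (delta_id m) (delta_id n) x = x;
  bact_comp : forall m'' m' m n'' n' n
    (s : delta m' m) (s' : delta m'' m') (t : delta n' n) (t' : delta n'' n')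
    (x : bsimp m n),
    bact (delta_comp s s') (delta_comp t t') x = bact s' t' (bact s t x) }.

Record bimap (X Y : bisset) := BiMap {
  bimapf : forall m n, bsimp X m n -> bsimp Y m n;
  bimap_act : forall m' m n' n (s : delta m' m) (t : delta n' n)
    (x : bsimp X m n), bimapf (bact s t x) = bact s t (bimapf x) }.

Definition diagonal_sset (X : bisset) : sset :=
  @SSet (fun n => bsimp X n n) (fun m n t => bact t t)
    (fun n x => bact_id x) (fun l m n g f x => bact_comp g f g f x).

Definition diagonal_map (X Y : bisset) (f : bimap X Y) :
    smap (diagonal_sset X) (diagonal_sset Y) :=
  @SMap (diagonal_sset X) (diagonal_sset Y) (fun n => @bimapf X Y f n n)
    (fun m n t x => bimap_act f t t x).

Section realization.
Context (R : realType).
Local Open Scope ring_scope.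

Definition std_simplex (n : nat) : set 'rV[R]_n.+1 :=
  [set t | (forall i, 0 <= t ord0 i) /\ \sum_i t ord0 i = 1].

Arguments std_simplex n : clear implicits.

Definition simplex_push_fun (m n : nat) (f : delta m n) (t : 'rV[R]_m.+1) :
  'rV[R]_n.+1 := \row_j \sum_(i | f i == j) t ord0 i.

Lemma simplex_push_subproof (m n : nat) (f : delta m n) (t : std_simplex m) :
  simplex_push_fun f (val t) \in std_simplex n.
Proof.
have [t_ge0 t_sum1] := set_mem (valP t).
apply/mem_set; split=> [j|]; first by rewrite mxE; exact: sumr_ge0.
rewrite -t_sum1 (partition_big f xpredT)//=.
by apply: eq_bigr => j _; rewrite mxE.
Qed.

Definition simplex_push (m n : nat) (f : delta m n) (t : std_simplex m) :
  std_simplex n :=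
  exist (fun u => u \in std_simplex n) _ (simplex_push_subproof f t).

Definition cell_index (X : sset) : Type := {n : nat & simp X n}.

Definition cell_space (X : sset) (nx : {classic cell_index X}) :
  topologicalType := set_type (std_simplex (projT1 nx)).

(* The disjoint union of one copy of the standard n-simplex for each
   n-simplex of [X], that is, of the products of the discrete spaces X_n with
   the standard n-simplices. *)
Definition cells (X : sset) : topologicalType :=
  {nx : {classic cell_index X} & cell_space nx}.

Definition cell (X : sset) (n : nat) (x : simp X n) (t : std_simplex n) :
  cells X := existT (@cell_space X) (existT _ n x) t.

Inductive glue (X : sset) : cells X -> cells X -> Prop :=
  Glue m n (f : delta m n) (x : simp X n) (t : std_simplex m) :
    glue (cell (sact f x) t) (cell x (simplex_push f t)).

Definition glue_rel (X : sset) : rel (cells X) :=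
  fun a b => `[< clos_refl_sym_trans _ (@glue X) a b >].

Lemma glue_rel_equiv (X : sset) : equiv_class_of (@glue_rel X).
Proof.
split=> [a|a b|b a c].
- by apply/asboolP; exact: rst_refl.
- by apply/asboolP/asboolP; exact: rst_sym.
- by move=> /asboolP ab /asboolP bc; apply/asboolP; exact: rst_trans ab bc.
Qed.

Canonical glue_equiv (X : sset) :=
  EquivRelPack (glue_rel_equiv X).

Definition realization (X : sset) : topologicalType :=
  quotient_topology {eq_quot (glue_equiv X)}.

Definition cells_map (X Y : sset) (f : smap X Y) (c : cells X) : cells Y :=
  cell (smapf f (projT2 (projT1 c))) (projT2 c).

Definition realization_map (X Y : sset) (f : smap X Y)
  (c : realization X) : realization Y :=
  \pi_(realization Y) (cells_map f (repr c)).

(* [realization_map] does not depend on the representatives chosen by [repr]. *)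
Lemma realization_map_pi (X Y : sset) (f : smap X Y) (c : cells X) :
  realization_map f (\pi_(realization X) c) =
  \pi_(realization Y) (cells_map f c).
Proof.
apply/eqmodP/asboolP; move: (repr _) (reprK (\pi_(realization X) c)).
move=> c' /eqmodP/asboolP; elim=> {c c'} [_ _ [m n t x u]|a|a b _|a b d _ ab _].
- rewrite /cells_map /= smap_act; exact/rst_step/Glue.
- exact: rst_refl.
- exact: rst_sym.
- exact: rst_trans.
Qed.

End realization.

Section homotopy.
Context (R : realType).
Local Open Scope ring_scope.

(* [H] matters only on X x [0, 1]; a homotopy defined there extends to X x R
   by clamping the second coordinate. *)
Definition homotopic (X Y : topologicalType) (f g : X -> Y) : Prop :=
  exists H : X * R -> Y,
    [/\ {within [set: X] `*` `[0, 1], continuous H},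
        forall x, H (x, 0) = f x & forall x, H (x, 1) = g x].

Definition homotopy_equivalence (X Y : topologicalType) (f : X -> Y) : Prop :=
  continuous f /\
  exists g : Y -> X,
    [/\ continuous g, homotopic (g \o f) idfun & homotopic (f \o g) idfun].

End homotopy.

Program Definition nerve (C : category) : sset :=
  @SSet (fun n => functor (ord_cat n) C)
    (fun m n t x => functor_comp x (ord_functor t)) _ _.
Next Obligation.
by move=> C n x /=; rewrite ord_functor_id; exact: functor_ext.
Qed.
Next Obligation.
by move=> C l m n g f x /=; rewrite ord_functor_comp; exact: functor_ext.
Qed.

Program Definition nerve_map (C D : category) (F : functor C D) :
    smap (nerve C) (nerve D) :=
  @SMap (nerve C) (nerve D) (fun n x => functor_comp F x) _.
Next Obligation. by move=> C D F m n t x; exact: functor_ext. Qed.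

Definition weak_equivalence (R : realType) (C D : category)
    (F : functor C D) : Prop :=
  homotopy_equivalence R (@realization_map R _ _ (nerve_map F)).

Definition bisset_weak_equivalence (R : realType) (X Y : bisset)
    (f : bimap X Y) : Prop :=
  homotopy_equivalence R (@realization_map R _ _ (diagonal_map f)).

Lemma sig_ext (T : Type) (P : T -> Prop) (u v : {x | P x}) :
  proj1_sig u = proj1_sig v -> u = v.
Proof.
by case: u v => [x px] [y py] /= xy; subst y; congr exist; exact: Prop_irrelevance.
Qed.

Section fiber.
Context (E B : category) (p : functor E B) (b : Ob B).

Definition fiber_ob := {e : Ob E | fob p e = b}.
Definition fiber_ar := {a : Ar E | far p a = idm b}.

Lemma fiber_src_subproof (a : fiber_ar) : fob p (src (proj1_sig a)) = b.
Proof. by rewrite -src_far (proj2_sig a) src_idm. Qed.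

Lemma fiber_tgt_subproof (a : fiber_ar) : fob p (tgt (proj1_sig a)) = b.
Proof. by rewrite -tgt_far (proj2_sig a) tgt_idm. Qed.

Lemma fiber_idm_subproof (e : fiber_ob) :
  far p (idm (proj1_sig e)) = idm b.
Proof. by rewrite far_idm (proj2_sig e). Qed.

Definition fiber_src (a : fiber_ar) : fiber_ob :=
  exist _ (src (proj1_sig a)) (fiber_src_subproof a).

Definition fiber_tgt (a : fiber_ar) : fiber_ob :=
  exist _ (tgt (proj1_sig a)) (fiber_tgt_subproof a).

Definition fiber_composable (g f : fiber_ar) (c : fiber_src g = fiber_tgt f) :
  src (proj1_sig g) = tgt (proj1_sig f) := congr1 (@proj1_sig _ _) c.

Lemma fiber_comp_subproof (g f : fiber_ar) (c : fiber_src g = fiber_tgt f) :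
  far p (comp _ _ (fiber_composable c)) = idm b.
Proof.
have c' : src (far p (proj1_sig g)) = tgt (far p (proj1_sig f)).
  by rewrite (proj2_sig g) (proj2_sig f) src_idm tgt_idm.
have c1 : src (idm b) = tgt (idm b) by rewrite src_idm tgt_idm.
rewrite (far_comp p _ c') (comp_congr c' c1 (proj2_sig g) (proj2_sig f)).
have c2 : src (idm b) = tgt (idm (src (idm b))) by rewrite tgt_idm.
by rewrite -[RHS](comp_idr c2); apply: comp_congr; rewrite ?src_idm.
Qed.

Program Definition fiber : category :=
  @Category fiber_ob fiber_ar fiber_src fiber_tgt
    (fun e => exist _ (idm (proj1_sig e)) (fiber_idm_subproof e))
    (fun g f c => exist _ _ (fiber_comp_subproof c)) _ _ _ _ _ _ _.
Next Obligation. by move=> e; apply: sig_ext; rewrite /= src_idm. Qed.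
Next Obligation. by move=> e; apply: sig_ext; rewrite /= tgt_idm. Qed.
Next Obligation. by move=> g f c; apply: sig_ext; rewrite /= src_comp. Qed.
Next Obligation. by move=> g f c; apply: sig_ext; rewrite /= tgt_comp. Qed.
Next Obligation.
by move=> f c; apply: sig_ext; rewrite /= comp_idl.
Qed.
Next Obligation.
by move=> f c; apply: sig_ext; rewrite /= comp_idr.
Qed.
Next Obligation.
by move=> h g f cgf chg c1 c2; apply: sig_ext; exact: comp_assoc.
Qed.

End fiber.

Section fibration.
Context (E B : category) (p : functor E B).

(* Lifts are taken at the source of an arrow of the base: in another
   common terminology these are precocartesian arrows and opfibrations. *)
Definition cartesian (f : Ar E) : Prop :=
  forall g : Ar E, src g = src f -> far p g = far p f ->
  exists! h : Ar E, far p h = idm (fob p (tgt f)) /\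
    exists c : src h = tgt f, comp h f c = g.

Definition prefibration : Prop :=
  forall (e : Ob E) (phi : Ar B), src phi = fob p e ->
  exists a : Ar E, [/\ cartesian a, src a = e & far p a = phi].

Definition is_fibration : Prop :=
  prefibration /\
  forall (g f : Ar E) (c : src g = tgt f),
    cartesian g -> cartesian f -> cartesian (comp g f c).

Definition normal_cleavage (S : set (Ar E)) : Prop :=
  [/\ forall a, S a -> cartesian a,
      forall (e : Ob E) (phi : Ar B), src phi = fob p e ->
        exists! a, [/\ S a, src a = e & far p a = phi]
    & forall e : Ob E, S (idm e)].

Definition closed_cleavage (S : set (Ar E)) : Prop :=
  forall (g f : Ar E) (c : src g = tgt f), S g -> S f -> S (comp g f c).

End fibration.

Record cleaved_fibration (B : category) := CleavedFibration {
  total : category;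
  proj : functor total B;
  cleavage : set (Ar total);
  proj_fibration : is_fibration proj;
  cleavageP : normal_cleavage proj cleavage }.

Arguments cleavage {B} c _.

Definition split_cleaved (B : category) (xi : cleaved_fibration B) : Prop :=
  closed_cleavage (cleavage xi).

Definition is_fibred_map (B B' : category) (xi : cleaved_fibration B)
    (xi' : cleaved_fibration B') (f : functor (total xi) (total xi'))
    (g : functor B B') : Prop :=
  functor_comp (proj xi') f = functor_comp g (proj xi) /\
  forall a, cartesian (proj xi) a -> cartesian (proj xi') (far f a).

Definition is_cleaved_map (B B' : category) (xi : cleaved_fibration B)
    (xi' : cleaved_fibration B') (f : functor (total xi) (total xi'))
    (g : functor B B') : Prop :=
  is_fibred_map f g /\ forall a, cleavage xi a -> cleavage xi' (far f a).

Record cliv (B B' : category) (xi : cleaved_fibration B)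
    (xi' : cleaved_fibration B') := Cliv {
  cliv_total : functor (total xi) (total xi');
  cliv_base : functor B B';
  clivP : is_cleaved_map cliv_total cliv_base }.

Lemma cliv_ext (B B' : category) (xi : cleaved_fibration B)
    (xi' : cleaved_fibration B') (u v : cliv xi xi') :
  cliv_total u = cliv_total v -> cliv_base u = cliv_base v -> u = v.
Proof.
case: u v => [f g up] [f' g' vp] /= ff' gg'; subst f' g'.
by congr Cliv; exact: Prop_irrelevance.
Qed.

Lemma cliv_comp_subproof (B B' B'' : category) (xi : cleaved_fibration B)
    (xi' : cleaved_fibration B') (xi'' : cleaved_fibration B'')
    (v : cliv xi' xi'') (u : cliv xi xi') :
  @is_cleaved_map _ _ xi xi'' (functor_comp (cliv_total v) (cliv_total u))
    (functor_comp (cliv_base v) (cliv_base u)).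
Proof.
case: u v => [f g [[pf fc] fS]] [f' g' [[pf' fc'] fS']] /=.
split=> [|a Sa]; last exact/fS'/fS.
split=> [|a ca]; last exact/fc'/fc.
transitivity (functor_comp (functor_comp (proj xi'') f') f).
  exact: functor_ext.
rewrite pf'; transitivity (functor_comp g' (functor_comp (proj xi') f)).
  exact: functor_ext.
by rewrite pf; exact: functor_ext.
Qed.

Definition cliv_comp (B B' B'' : category) (xi : cleaved_fibration B)
    (xi' : cleaved_fibration B') (xi'' : cleaved_fibration B'')
    (v : cliv xi' xi'') (u : cliv xi xi') : cliv xi xi'' :=
  Cliv (cliv_comp_subproof v u).

Section fiber_functor.
Context (B : category) (xi xi' : cleaved_fibration B).
Context (f : functor (total xi) (total xi')).
Hypothesis hf : is_cleaved_map f (functor_id B).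
Variable b : Ob B.

Lemma over_fob e : fob (proj xi') (fob f e) = fob (proj xi) e.
Proof. by case: hf => -[/(congr1 (@fob _ _)) /(congr1 (@^~ e))]. Qed.

Lemma over_far a : far (proj xi') (far f a) = far (proj xi) a.
Proof. by case: hf => -[/(congr1 (@far _ _)) /(congr1 (@^~ a))]. Qed.

Lemma fiber_fob_subproof (e : fiber_ob (proj xi) b) :
  fob (proj xi') (fob f (proj1_sig e)) = b.
Proof. by rewrite over_fob (proj2_sig e). Qed.

Lemma fiber_far_subproof (a : fiber_ar (proj xi) b) :
  far (proj xi') (far f (proj1_sig a)) = idm b.
Proof. by rewrite over_far (proj2_sig a). Qed.

Program Definition fiber_functor :
    functor (fiber (proj xi) b) (fiber (proj xi') b) :=
  @Functor (fiber (proj xi) b) (fiber (proj xi') b)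
    (fun e => exist _ (fob f (proj1_sig e)) (fiber_fob_subproof e))
    (fun a => exist _ (far f (proj1_sig a)) (fiber_far_subproof a)) _ _ _ _.
Next Obligation. by move=> a; apply: sig_ext; rewrite /= src_far. Qed.
Next Obligation. by move=> a; apply: sig_ext; rewrite /= tgt_far. Qed.
Next Obligation. by move=> e; apply: sig_ext; rewrite /= far_idm. Qed.
Next Obligation. by move=> g h c c'; apply: sig_ext; exact: far_comp. Qed.

End fiber_functor.

Section box.
Variables m n : nat.

Definition box_proj : functor (prod_cat (ord_cat m) (ord_cat n)) (ord_cat n) :=
  functor_snd (ord_cat m) (ord_cat n).

Definition box_cleavage : set (Ar (prod_cat (ord_cat m) (ord_cat n))) :=
  [set a | exists i : 'I_m.+1, a.1 = idm (i : Ob (ord_cat m))].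

Lemma box_ar_ext (a b : Ar (prod_cat (ord_cat m) (ord_cat n))) :
  src a = src b -> tgt a = tgt b -> a = b.
Proof.
case: a b => [[[i j] ij] [[k l] kl]] [[[i' j'] ij'] [[k' l'] kl']] /=.
by move=> [ii kk] [jj ll]; subst; congr pair; exact: val_inj.
Qed.

Lemma box_cartesianP a : cartesian box_proj a <-> box_cleavage a.
Proof.
split=> [ca|[i ai] g sg pg].
  pose g : Ar (prod_cat (ord_cat m) (ord_cat n)) := (idm (src a.1), a.2).
  have [h [[_ [c hag]] _]] := ca g erefl erefl.
  exists (src a.1); apply: val_inj; rewrite [LHS]surjective_pairing /=.
  congr pair; apply/eqP.
  have /(congr1 (fun b => (val b.1).2)) /= hE := hag.
  have /(congr1 fst) /= cE := c.
  rewrite eq_le; apply/andP; split; last exact: (valP a.1).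
  by rewrite -cE -[leRHS]hE; exact: (valP h.1).
case: a ai sg pg => [_ k] /= -> [sg1 sg2] gk.
have c : src ((g.1, idm (tgt k)) : Ar (prod_cat (ord_cat m) (ord_cat n))) =
    tgt ((idm (i : Ob (ord_cat m)), k) :
      Ar (prod_cat (ord_cat m) (ord_cat n))).
  by rewrite /= sg1.
exists (g.1, idm (tgt k)); split=> [|h [pk [c' hg]]].
  split=> //; exists c; apply: box_ar_ext.
    by apply: etrans (src_comp c) _; rewrite /= sg1 sg2.
  by apply: etrans (tgt_comp c) _; rewrite /= -gk.
apply: box_ar_ext; first exact: etrans c (esym c').
by rewrite /= -hg /= (congr1 (fun b => (val b).2) pk).
Qed.

Lemma box_fibration : is_fibration box_proj.
Proof.
split=> [[i j] k /= kj|g f c /box_cartesianP[i gi] /box_cartesianP[j fj]].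
  exists (idm (i : Ob (ord_cat m)), k); split=> //=; last by rewrite kj.
  by apply/box_cartesianP; exists i.
apply/box_cartesianP; exists i => /=.
have ij : i = j by have /(congr1 fst) := c; rewrite /= gi fj.
by subst j; apply: val_inj; rewrite /= (congr1 val gi) (congr1 val fj).
Qed.

Lemma box_cleavageP : normal_cleavage box_proj box_cleavage.
Proof.
split=> [a /box_cartesianP//|[i j] k /= kj|[i j]]; last by exists i.
exists (idm (i : Ob (ord_cat m)), k); split=> [|a].
  by split=> //=; [exists i|rewrite kj].
case: a => a1 a2 [[i' /= ->] [/= -> _] ->] //.
Qed.

Definition box : cleaved_fibration (ord_cat n) :=
  CleavedFibration box_fibration box_cleavageP.

End box.

Lemma box_map_subproof (m' m n' n : nat) (s : delta m' m) (t : delta n' n) :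
  @is_cleaved_map _ _ (box m' n') (box m n)
    (functor_prod (ord_functor s) (ord_functor t)) (ord_functor t).
Proof.
have S a : box_cleavage a ->
    box_cleavage (far (functor_prod (ord_functor s) (ord_functor t)) a).
  by move=> [i /= ai]; exists (s i); rewrite /= ai; exact: val_inj.
split=> //; split; first exact: functor_ext.
by move=> a /box_cartesianP ?; exact/box_cartesianP/S.
Qed.

Definition box_map (m' m n' n : nat) (s : delta m' m) (t : delta n' n) :
  cliv (box m' n') (box m n) := Cliv (box_map_subproof s t).

Program Definition cleaved_nerve (B : category) (xi : cleaved_fibration B) :
    bisset :=
  @BiSSet (fun m n => cliv (box m n) xi)
    (fun m' m n' n s t x => cliv_comp x (box_map s t)) _ _.
Next Obligation.
move=> B xi m n x; apply: cliv_ext => /=.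
  by rewrite !ord_functor_id; apply: functor_ext => -[].
by rewrite ord_functor_id; exact: functor_ext.
Qed.
Next Obligation.
move=> B xi m'' m' m n'' n' n s s' t t' x; apply: cliv_ext => /=.
  by rewrite !ord_functor_comp; exact: functor_ext.
by rewrite ord_functor_comp; exact: functor_ext.
Qed.

Program Definition cleaved_nerve_map (B B' : category)
    (xi : cleaved_fibration B) (xi' : cleaved_fibration B') (u : cliv xi xi') :
    bimap (cleaved_nerve xi) (cleaved_nerve xi') :=
  @BiMap (cleaved_nerve xi) (cleaved_nerve xi')
    (fun m n x => cliv_comp u x) _.
Next Obligation.
by move=> B B' xi xi' u m' m n' n s t x; apply: cliv_ext; exact: functor_ext.
Qed.

(* Main.v *)
From HB Require Import structures.
From mathcomp Require Import all_boot all_order all_algebra generic_quotient.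
From mathcomp Require Import all_classical reals topology normedtype.
From mathcomp Require Import ring lra zify.
From Stdlib Require Import Relation_Operators.
Require Import Defs.

(** A cleaved map from a rectangle [m x n] to a split fibration is the same as an
    [n]-simplex [sg] of the nerve of [B] together with an [m]-simplex of the
    nerve of the fiber over the first vertex of [sg]: the remaining values are
    pushed forward along the cleavage ([bottom_inj], [bottom_ext]).  So the
    cleaved nerve is fibred over the nerve of [B], seen as constant in the first
    direction, with the nerves of the fibers as fibres, and [f] is an equivalence
    on each fibre.  As a degeneracy does not change the first vertex, a simplex
    over a degenerate simplex of the nerve of [B] is degenerate in one way, and
    the diagonal is built by attaching, for each nondegenerate [sg], the product
    of a simplex with the whole fibre over [sg].  The claim then says that a
    fibrewise equivalence is an equivalence on diagonals
    ([fibrewise_equivalence_diagonal]).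

    To compare the attachments, [f] is replaced by the inclusion [i] of its
    domain in a mapping cylinder, and equivalences by a property of inclusions
    [i : A -> X] that survives attachments, [pushout_extension]: for each pair
    [(K, L)], maps on the union of [K x A] and [L x X] extend to [K x X].  An
    inclusion that is an equivalence is a strong deformation retract, by the
    homotopy extension property, and has this property
    ([equivalence_strong_retract], [strong_retract_extension]).  Conversely the
    property yields a retraction and a deformation, hence an equivalence
    ([pushout_extension_equivalence]).  It passes from the fibres to the diagonal
    because extending over the cell of [sg] is an instance of the property of
    the fibre, for the pair obtained from [(K, L)] by taking the product with a
    simplex and its boundary ([diagonal_pushout_extension]).

    All cell by cell constructions go through [section_principle], which builds
    a section over a simplicial set from fillers of boundaries.  It yields the
    homotopy extension property for realizations ([homotopy_extension]).  The
    passage between maps on the realization of a product and maps of two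
    variables rests on [product_map]: a point of a product of two simplices is
    a weighting of a monotone path in the grid of vertices, and it is unique up
    to the identifications of the realization, because the mass of a lower-left
    rectangle is the smaller of its two marginals. *)

Set Implicit Arguments.
Unset Strict Implicit.
Unset Printing Implicit Defensive.

Import Order.TTheory GRing.Theory Num.Theory.
Import numFieldNormedType.Exports.
Local Open Scope classical_set_scope.
Local Open Scope quotient_scope.

(** * Monotone maps between finite ordinals *)

Lemma delta_ext (m n : nat) (f g : delta m n) : f =1 g -> f = g.
Proof.
case: f g => f [[fP]] [g [[gP]]] /= /funext fg; subst g.
by rewrite (Prop_irrelevance fP gP).
Qed.

Definition mkdelta (m n : nat) (f : 'I_m.+1 -> 'I_n.+1)
    (f_homo : {homo f : i j / (i <= j)%O}) : delta m n :=
  HB.pack f (Order.isOrderMorphism.Build _ _ _ _ f f_homo).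

Lemma delta_compA k l m n (h : delta m n) (g : delta l m) (f : delta k l) :
  delta_comp h (delta_comp g f) = delta_comp (delta_comp h g) f.
Proof. exact: delta_ext. Qed.

Lemma delta_compE l m n (g : delta m n) (f : delta l m) i :
  delta_comp g f i = g (f i).
Proof. by []. Qed.

Lemma delta_comp1 m n (f : delta m n) : delta_comp f (delta_id m) = f.
Proof. exact: delta_ext. Qed.

Lemma delta_1comp m n (f : delta m n) : delta_comp (delta_id n) f = f.
Proof. exact: delta_ext. Qed.

Definition onto (m n : nat) (f : delta m n) : Prop := forall j, exists i, f i = j.

Lemma onto_comp l m n (g : delta m n) (f : delta l m) :
  onto (delta_comp g f) -> onto g.
Proof. by move=> gf j; have [i <-] := gf j; exists (f i). Qed.

Lemma onto_id n : onto (delta_id n).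
Proof. by move=> j; exists j. Qed.

Lemma const_homo m n (j : 'I_n.+1) : {homo (fun _ : 'I_m.+1 => j) : i k / (i <= k)%O}.
Proof. by []. Qed.

Definition delta_const (m n : nat) (j : 'I_n.+1) : delta m n :=
  mkdelta (const_homo j).

Lemma onto_section m n (t : delta m n) (i : 'I_m.+1) : onto t ->
  exists s : delta n m, s (t i) = i /\ delta_comp t s = delta_id n.
Proof.
move=> /choice[s0 s0K]; pose s j := if j == t i then i else s0 j.
have sK j : t (s j) = j by rewrite /s; case: eqP => // ->.
have s_homo : {homo s : j k / (j <= k)%O}.
  move=> j k jk; rewrite leNgt; apply/negP => skj.
  have := omorph_le t (ltW skj); rewrite !sK => kj.
  have jk' : j = k by apply/le_anti/andP.
  by move: skj; rewrite jk' ltxx.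
exists (mkdelta s_homo); split; first by rewrite /= /s eqxx.
by apply: delta_ext => j; exact: sK.
Qed.

Lemma delta_inj_ge n (u : delta n n) (k : 'I_n.+1) : injective u -> (k <= u k)%N.
Proof.
move=> u_inj; case: k => k; elim: k => [//|k IH] kn /=.
have kn' : (k < n.+1)%N by exact: ltnW.
apply: leq_ltn_trans (IH kn') _.
have : (u (Ordinal kn') < u (Ordinal kn))%O.
  rewrite lt_neqAle omorph_le ?andbT; last by rewrite leEord /=.
  by apply/eqP => /u_inj /(congr1 val) /= /eqP; rewrite ltn_eqF.
by rewrite ltEord.
Qed.

Lemma onto_endo n (u : delta n n) : onto u -> u = delta_id n.
Proof.
move=> u_onto; have [s [_ us]] := onto_section ord0 u_onto.
have usE j : u (s j) = j by exact: (congr1 (fun f : delta n n => f j) us).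
have s_inj : injective s by move=> j k jk; rewrite -(usE j) jk usE.
have su j : s (u j) = j.
  by have [g _ sg] := injF_bij s_inj; rewrite -{1}(sg j) usE sg.
have u_inj : injective u by exact: can_inj su.
apply: delta_ext => k; apply/le_anti/andP; split; last exact: delta_inj_ge.
have /(omorph_le u) := delta_inj_ge k s_inj.
by rewrite usE.
Qed.

(** Each element of the source is the value of a section of [t]. *)
Lemma onto_eq m n (t t' : delta m n) : onto t ->
  (forall s : delta n m, delta_comp t s = delta_id n ->
     delta_comp t' s = delta_id n) -> t = t'.
Proof.
move=> t_onto tt'; apply: delta_ext => i.
have [s [si /tt' t's]] := onto_section i t_onto.
by have := congr1 (fun f : delta n n => f (t i)) t's; rewrite /= si.
Qed.

Lemma lift_homo n (i : 'I_n.+2) : {homo lift i : j k / (j <= k)%O}.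
Proof. by move=> j k; rewrite !leEord /= leq_bump2. Qed.

Definition coface n (i : 'I_n.+2) : delta n n.+1 := mkdelta (@lift_homo n i).

Definition codeg_fun n (i : 'I_n.+2) (k : 'I_n.+2) : 'I_n.+1 :=
  inord (minn n (unbump i k)).

Lemma codeg_homo n (i : 'I_n.+2) : {homo codeg_fun i : j k / (j <= k)%O}.
Proof.
by move=> j k; rewrite !leEord /codeg_fun !inordK ?ltnS ?geq_minl// /unbump; lia.
Qed.

(** A degeneracy which is a left inverse of the face opposite to [i]. *)
Definition codeg n (i : 'I_n.+2) : delta n.+1 n := mkdelta (@codeg_homo n i).

Lemma codegK n (i : 'I_n.+2) : delta_comp (codeg i) (coface i) = delta_id n.
Proof.
apply: delta_ext => j; apply: val_inj => /=; rewrite /codeg_fun /= bumpK inordK.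
  by apply/minn_idPr; rewrite -ltnS.
by rewrite ltnS geq_minl.
Qed.

Lemma coface_codeg n (i k : 'I_n.+2) : k != i -> coface i (codeg i k) = k.
Proof.
move=> ki; apply: val_inj => /=; rewrite /codeg_fun inordK ?ltnS ?geq_minl//.
have := ltn_ord k; have := ltn_ord i; move: ki; rewrite -val_eqE /= /bump /unbump.
lia.
Qed.

Lemma coface_nonto n (i : 'I_n.+2) : ~ onto (coface i).
Proof. by move=> /(_ i)[j /= ij]; have := neq_lift i j; rewrite ij eqxx. Qed.

Lemma nonto_factor m n (d : delta m n.+1) : ~ onto d ->
  exists i, d = delta_comp (coface i) (delta_comp (codeg i) d).
Proof.
move=> /existsNP[i /forallNP di]; exists i; apply: delta_ext => k.
by rewrite !delta_compE coface_codeg//; exact/eqP/di.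
Qed.

Lemma onto0 m (d : delta m 0) : onto d.
Proof. by move=> j; exists ord0; rewrite !ord1. Qed.

Lemma onto_ord0 m n (d : delta m n) : onto d -> d ord0 = ord0.
Proof.
move=> /(_ ord0)[i di]; apply/le_anti/andP; split; last by rewrite leEord.
by rewrite -[leRHS]di; apply: omorph_le; rewrite leEord.
Qed.

(** * Sections over simplicial sets *)

Definition std_sset (n : nat) : sset :=
  @SSet (fun m => delta m n) (fun m m' t x => delta_comp x t)
    (fun m x => delta_comp1 x) (fun l m m' g f x => delta_compA x g f).

Definition prod_act (X Y : sset) m n (t : delta m n) (x : simp X n * simp Y n) :=
  (sact t x.1, sact t x.2).

Lemma prod_act_id (X Y : sset) n (x : simp X n * simp Y n) :
  prod_act (delta_id n) x = x.
Proof. by case: x => x y; rewrite /prod_act !sact_id. Qed.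

Lemma prod_act_comp (X Y : sset) l m n (g : delta m n) (f : delta l m)
    (x : simp X n * simp Y n) :
  prod_act (delta_comp g f) x = prod_act f (prod_act g x).
Proof. by rewrite /prod_act !sact_comp. Qed.

Definition prod_sset (X Y : sset) : sset :=
  SSet (@prod_act_id X Y) (@prod_act_comp X Y).

Definition closed_pred (X : sset) (C : forall n, simp X n -> Prop) :=
  forall m n (t : delta m n) (x : simp X n), C n x -> C m (sact t x).

Section sub_sset.
Variables (X : sset) (C : forall n, simp X n -> Prop) (hC : closed_pred C).

Definition sub_act m n (t : delta m n) (x : {x : simp X n | C x}) :
  {x : simp X m | C x} := exist _ (sact t (proj1_sig x)) (hC t (proj2_sig x)).

Lemma sub_act_id n (x : {x : simp X n | C x}) : sub_act (delta_id n) x = x.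
Proof. by apply: sig_ext; exact: sact_id. Qed.

Lemma sub_act_comp l m n (g : delta m n) (f : delta l m)
    (x : {x : simp X n | C x}) :
  sub_act (delta_comp g f) x = sub_act f (sub_act g x).
Proof. by apply: sig_ext; exact: sact_comp. Qed.

Definition sub_sset : sset := SSet sub_act_id sub_act_comp.

End sub_sset.

Lemma nonto_closed n : @closed_pred (std_sset n) (fun m d => ~ onto (d : delta m n)).
Proof. by move=> l m e d nd /onto_comp. Qed.

Definition boundary (n : nat) : sset := sub_sset (@nonto_closed n).

Definition nonto_face m n (d : delta m n) (nd : ~ onto d) :
  simp (boundary n) m := exist _ d nd.

(** A section can be built one simplex at a time: in a maximal partial section,
    a missing simplex [x] of least dimension has all its proper faces in the
    domain, so [t^*x] and [t'^*x] differ for distinct monotone surjections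
    [t] and [t'], and a filler over [x] extends the section to all of the
    [t^*x] without conflict. *)
Theorem section_principle (X T : sset)
    (Phi : forall n, simp X n -> simp T n -> Prop) :
  (forall m n (d : delta m n) x tau, onto d -> Phi n x tau ->
    Phi m (sact d x) (sact d tau)) ->
  (forall n (x : simp X n) (b : smap (boundary n) T),
    (forall m (d : simp (boundary n) m),
      Phi m (sact (proj1_sig d : delta m n) x) (smapf b d)) ->
    exists tau, Phi n x tau /\ forall m (d : simp (boundary n) m),
      sact (proj1_sig d : delta m n) tau = smapf b d) ->
  exists s : smap X T, forall n (x : simp X n), Phi n x (smapf s x).
Proof.
move=> Phi_onto fill.
pose rl := forall n, simp X n -> simp T n -> Prop.
pose good (r : rl) := [/\ forall n x y y', r n x y -> r n x y' -> y = y',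
  forall m n (d : delta m n) x y, r n x y -> r m (sact d x) (sact d y) &
  forall n x y, r n x y -> Phi n x y].
pose R (r r' : {r : rl | good r}) :=
  `[< forall n x y, proj1_sig r n x y -> proj1_sig r' n x y >].
have good0 : good (fun _ _ _ => False) by split.
have [||A totA|[r rgood] rmax] := @ZL_preorder _ (exist _ _ good0) R.
- by move=> t; apply/asboolP.
- by move=> a b c /asboolP ab /asboolP bc; apply/asboolP => n x y /ab /bc.
- have gU : good (fun n x y => exists2 s, A s & proj1_sig s n x y).
    split=> [n x y y' [s As sxy] [s' As' sxy']|m n d x y [s As sxy]|n x y [s As sxy]].
    + have [/asboolP ss|/asboolP ss] := totA _ _ As As'.
        by have [fs' _ _] := proj2_sig s'; exact: fs' (ss _ _ _ sxy) sxy'.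
      by have [fs _ _] := proj2_sig s; exact: fs sxy (ss _ _ _ sxy').
    + by exists s => //; have [_ ? _] := proj2_sig s; auto.
    + by have [_ _ ?] := proj2_sig s; auto.
  by exists (exist _ _ gU) => s As; apply/asboolP => n x y sxy; exists s.
have [rf rc rP] := rgood.
have dom : forall n (x : simp X n), exists y, r n x y.
  elim/ltn_ind => n IH x; apply: contrapT => ndom.
  have face m (d : simp (boundary n) m) :
      exists y, r m (sact (proj1_sig d : delta m n) x) y.
    case: d => /= d nd; case: n => [|n] in x d nd IH {ndom} *.
      by case: nd; exact: onto0.
    have [i dE] := nonto_factor nd.
    have [y ry] := IH n (ltnSn n) (sact (coface i) x).
    exists (sact (delta_comp (codeg i) d) y).
    by rewrite {1}dE sact_comp; exact: rc.
  pose b0 m (d : simp (boundary n) m) := projT1 (cid (face m d)).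
  have b0P m (d : simp (boundary n) m) :
      r m (sact (proj1_sig d : delta m n) x) (b0 m d).
    exact: (projT2 (cid (face m d))).
  have b_act m m' (t : delta m m') (d : simp (boundary n) m') :
      b0 m (sact t d) = sact t (b0 m' d).
    apply: rf (b0P m (sact t d)) _ => /=.
    by rewrite sact_comp; exact: rc (b0P m' d).
  pose b : smap (boundary n) T := @SMap (boundary n) T b0 b_act.
  have [tau [xtau btau]] : exists tau, Phi n x tau /\
      forall m (d : simp (boundary n) m),
        sact (proj1_sig d : delta m n) tau = smapf b d.
    by apply: fill => m d; exact: rP (b0P m d).
  pose r' : rl := fun m y z => r m y z \/
    exists d : delta m n, [/\ onto d, y = sact d x & z = sact d tau].
  have nr m (d : delta m n) : onto d -> forall y, ~ r m (sact d x) y.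
    move=> d_onto y ry; have [s [_ ds]] := onto_section ord0 d_onto.
    apply: ndom; exists (sact s y).
    by have := rc _ _ s _ _ ry; rewrite -sact_comp ds sact_id.
  have uniq_d m (d d' : delta m n) : onto d -> onto d' ->
      sact d x = sact d' x -> d = d'.
    move=> d_onto d'_onto dd'; apply: onto_eq => // s ds.
    have xE : sact (delta_comp d' s) x = x.
      by rewrite sact_comp -dd' -sact_comp ds sact_id.
    have [/onto_endo //|nd] := pselect (onto (delta_comp d' s)).
    by case: ndom; have := face _ (nonto_face nd); rewrite /= xE.
  have gr' : good r'.
    split=> [m y z z' [rz|[d [ds -> ->]]] [rz'|[d' [ds' yE ->]]]
            |l m e y z [rz|[d [ds -> ->]]]|m y z [/rP//|[d [ds -> ->]]]].
    - exact: rf rz rz'.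
    - by case: (nr _ _ ds' z); rewrite -yE.
    - by case: (nr _ _ ds _ rz').
    - by rewrite (uniq_d _ _ _ ds ds' yE).
    - by left; exact: rc.
    - have [de|nde] := pselect (onto (delta_comp d e)).
        by right; exists (delta_comp d e); rewrite !sact_comp.
      left; have := btau _ (nonto_face nde); rewrite /= sact_comp => ->.
      by have := b0P l (nonto_face nde); rewrite /= sact_comp.
    - exact: Phi_onto.
  have /asboolP r'r := rmax (exist _ r' gr') (asboolT (fun n x y rz => or_introl rz)).
  apply: ndom; exists tau; apply: r'r; right.
  by exists (delta_id n); rewrite !sact_id; split=> //; exact: onto_id.
pose s0 n x := projT1 (cid (dom n x)).
have s0P n x : r n x (s0 n x) by exact: (projT2 (cid (dom n x))).
have s_act m n (t : delta m n) (x : simp X n) :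
    s0 m (sact t x) = sact t (s0 n x).
  by apply: rf (s0P m (sact t x)) (rc _ _ t _ _ (s0P n x)).
by exists (@SMap X T s0 s_act) => n x; exact: rP (s0P n x).
Qed.

(** * Continuity of real functions and gluing *)

Lemma cont_pair (X Y Z : topologicalType) (f : X -> Y) (g : X -> Z) :
  continuous f -> continuous g -> continuous (fun x => (f x, g x)).
Proof. by move=> cf cg x; apply: cvg_pair; [exact: cf|exact: cg]. Qed.

Lemma cont_comp (X Y Z : topologicalType) (f : X -> Y) (g : Y -> Z) :
  continuous f -> continuous g -> continuous (fun x => g (f x)).
Proof.
by move=> cf cg x; apply: continuous_comp; [exact: cf|exact: cg].
Qed.

Lemma cont_fst (X Y : topologicalType) : continuous (fun x : X * Y => x.1).
Proof. by move=> x; exact: cvg_fst. Qed.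

Lemma cont_snd (X Y : topologicalType) : continuous (fun x : X * Y => x.2).
Proof. by move=> x; exact: cvg_snd. Qed.

Lemma cont_cst (X Y : topologicalType) (y : Y) : continuous (fun _ : X => y).
Proof. by move=> x; exact: cvg_cst. Qed.

Lemma cont_id (X : topologicalType) : continuous (fun x : X => x).
Proof. by move=> x; exact: cvg_id. Qed.

Section real_continuity.
Context (R : realType) (X : topologicalType).
Local Open Scope ring_scope.
Implicit Types f g : X -> R.

Lemma rcontD f g : continuous f -> continuous g ->
  continuous (fun x => f x + g x).
Proof. by move=> cf cg x; apply: cvgD; [exact: cf|exact: cg]. Qed.

Lemma rcontN f : continuous f -> continuous (fun x => - f x).
Proof. by move=> cf x; apply: cvgN; exact: cf. Qed.

Lemma rcontM f g : continuous f -> continuous g ->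
  continuous (fun x => f x * g x).
Proof. by move=> cf cg x; apply: cvgM; [exact: cf|exact: cg]. Qed.

Lemma rcontV f : (forall x, f x != 0) -> continuous f ->
  continuous (fun x => (f x)^-1).
Proof. by move=> f0 cf x; apply: cvgV; [exact: f0|exact: cf]. Qed.

Lemma rcont_norm f : continuous f -> continuous (fun x => `|f x|).
Proof. by move=> cf x; apply: cvg_norm; exact: cf. Qed.

Lemma rcont_max f g : continuous f -> continuous g ->
  continuous (fun x => Num.max (f x) (g x)).
Proof.
by move=> cf cg; exact: (cont_comp (cont_pair cf cg) (@max_continuous _ R)).
Qed.

Lemma rcont_min f g : continuous f -> continuous g ->
  continuous (fun x => Num.min (f x) (g x)).
Proof.
by move=> cf cg; exact: (cont_comp (cont_pair cf cg) (@min_continuous _ R)).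
Qed.

Lemma rcont_sum (I : finType) (P : pred I) (F : I -> X -> R) :
  (forall i, continuous (F i)) -> continuous (fun x => \sum_(i | P i) F i x).
Proof.
move=> cF x; apply: cvg_big; first exact: add_continuous.
by move=> i _; exact: cF.
Qed.

Lemma rcont_bigmin (I : finType) (a : R) (F : I -> X -> R) :
  (forall i, continuous (F i)) ->
  continuous (fun x => \big[Num.min/a]_i F i x).
Proof.
move=> cF x; apply: cvg_big; first exact: min_continuous.
by move=> i _; exact: cF.
Qed.

Lemma closed_lef f g : continuous f -> continuous g ->
  closed [set x | f x <= g x].
Proof.
move=> cf cg; rewrite (_ : [set _ | _] = (fun x => g x - f x) @^-1` [set y | 0 <= y]).
  apply: preimage_closed; last exact: closed_ge.
  by move=> x _; apply: rcontD => //; exact: rcontN.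
by apply/seteqP; split=> x /=; rewrite subr_ge0.
Qed.

Lemma closed_eqf f g : continuous f -> continuous g ->
  closed [set x | f x = g x].
Proof.
move=> cf cg; rewrite (_ : [set _ | _] = [set x | f x <= g x] `&` [set x | g x <= f x]).
  by apply: closedI; exact: closed_lef.
by apply/seteqP; split=> x /= => [->|[fg gf]]; [split=> /=|apply/le_anti/andP].
Qed.

End real_continuity.

Lemma closed_pasting (X Y : topologicalType) (I : finType) (D : I -> set X)
    (F : I -> X -> Y) (f : X -> Y) :
  (forall i, closed (D i)) -> (forall i, continuous (F i)) ->
  (forall x, exists i, D i x) -> (forall i x, D i x -> f x = F i x) ->
  continuous f.
Proof.
move=> clD cF cov agree; apply/continuous_closedP => A clA.
rewrite (_ : _ @^-1` _ = \big[setU/set0]_(i <- enum I) (D i `&` F i @^-1` A)).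
  apply: closed_bigsetU => i _; apply: closedI => //.
  by apply: preimage_closed => // x _; exact: cF.
rewrite -bigcup_seq; apply/seteqP; split=> x /=.
  move=> Afx; have [i Dix] := cov x; exists i; first by rewrite /= mem_enum.
  by split=> //=; rewrite -agree.
by move=> [i _ [Dix]] /=; rewrite -agree.
Qed.

(** * Standard simplices and realizations *)

Section simplices.
Context (R : realType).
Local Open Scope ring_scope.
Local Notation spx n := (set_type (@std_simplex R n)).

Definition wt n (t : spx n) (i : 'I_n.+1) : R := (val t) ord0 i.

Lemma wt_ge0 n (t : spx n) i : 0 <= wt t i.
Proof. by have [t0 _] := set_mem (valP t); exact: t0. Qed.

Lemma wt_sum n (t : spx n) : \sum_i wt t i = 1.
Proof. by have [_ t1] := set_mem (valP t). Qed.

Lemma spx_ext n (t u : spx n) : (forall i, wt t i = wt u i) -> t = u.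
Proof. by move=> tu; apply/val_inj/matrixP => i j; rewrite !ord1; exact: tu. Qed.

Lemma mkspx_subproof n (w : 'I_n.+1 -> R) :
  (forall i, 0 <= w i) -> \sum_i w i = 1 ->
  (\row_i w i) \in @std_simplex R n.
Proof.
move=> w0 w1; apply/mem_set; split=> [i|]; first by rewrite mxE.
by rewrite -w1; apply: eq_bigr => i _; rewrite mxE.
Qed.

Definition mkspx n (w : 'I_n.+1 -> R) (w0 : forall i, 0 <= w i)
  (w1 : \sum_i w i = 1) : spx n :=
  exist (fun v => v \in @std_simplex R n) _ (mkspx_subproof w0 w1).

Lemma wt_mkspx n (w : 'I_n.+1 -> R) w0 w1 i : wt (@mkspx n w w0 w1) i = w i.
Proof. by rewrite /wt /= mxE. Qed.

Lemma wt_push m n (f : delta m n) (t : spx m) j :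
  wt (simplex_push f t) j = \sum_(i | f i == j) wt t i.
Proof. by rewrite /wt /= mxE. Qed.

Lemma push_id n (t : spx n) : simplex_push (delta_id n) t = t.
Proof. by apply: spx_ext => i; rewrite wt_push big_pred1_eq. Qed.

Lemma push_comp l m n (g : delta m n) (f : delta l m) (t : spx l) :
  simplex_push (delta_comp g f) t = simplex_push g (simplex_push f t).
Proof.
apply: spx_ext => i; rewrite !wt_push [LHS](partition_big f (fun j => g j == i))//=.
apply: eq_bigr => j /eqP gj; rewrite wt_push; apply: eq_bigl => k.
by apply/andP/idP => [[_ ->//]|/eqP fk]; rewrite fk gj eqxx.
Qed.

Lemma continuous_into_spx (X : topologicalType) n (f : X -> spx n) :
  (forall i, continuous (fun x => wt (f x) i)) -> continuous f.
Proof.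
move=> fc; apply/continuousP => _ [A oA <-].
rewrite -comp_preimage; move: A oA; apply/continuousP => x A [P MP PA].
rewrite nbhs_filterE /=.
apply: (filterS (P := fun y => forall i j, P i j ((val (f y)) i j))).
  by move=> y Py; exact: PA.
apply: filter_forall => i; apply: filter_forall => j; rewrite !ord1.
by apply: (fc j x); move: (MP ord0 j).
Qed.

Lemma wt_continuous n i : continuous (fun t : spx n => wt t i).
Proof.
move=> t; rewrite /wt.
have := @continuous_comp (spx n) _ _ set_val (fun v : 'rV[R]_n.+1 => v ord0 i) t.
apply; first exact: initial_continuous.
exact: coord_continuous.
Qed.

Lemma push_continuous m n (f : delta m n) : continuous (@simplex_push R m n f).
Proof.
apply: continuous_into_spx => i.
rewrite (_ : (fun _ => _) = fun t => \sum_(j | f j == i) wt t j); last first.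
  by apply/funext => t; rewrite wt_push.
by apply: rcont_sum => j; exact: wt_continuous.
Qed.

Lemma spx_hausdorff n : hausdorff_space (spx n).
Proof.
move=> t u tu; apply: spx_ext => i; apply: (@Rhausdorff R) => A B At Bu.
have [v [/= Av Bv]] := tu _ _ (wt_continuous At) (wt_continuous Bu).
by exists (wt v i).
Qed.

Lemma wt_le1 n (t : spx n) i : wt t i <= 1.
Proof.
rewrite -(wt_sum t) (bigD1 i)//= lerDl; apply: sumr_ge0 => j _; exact: wt_ge0.
Qed.

Lemma spx_compact n : compact [set: spx n].
Proof.
have cS : compact (@std_simplex R n).
  apply: bounded_closed_compact.
    exists 1; split=> [//|M M1 v [v0 v1]] /=.
    rewrite /Num.norm /= mx_normrE; apply: bigmax_le => [|[i j] _ /=]; first by lra.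
    rewrite ord1 ger0_norm//; apply: le_trans (ltW M1).
    by rewrite -v1 (bigD1 j)//= lerDl; apply: sumr_ge0.
  rewrite (_ : @std_simplex R n = \bigcap_i [set v : 'rV[R]_n.+1 | 0 <= v ord0 i] `&`
      [set v | \sum_i v ord0 i = 1]); last first.
    by apply/seteqP; split=> v [v0 v1]; split=> // i; [move=> _|]; exact: v0.
  apply: closedI.
    apply: closed_bigI => i _; apply: closed_lef; first exact: cont_cst.
    exact: coord_continuous.
  apply: closed_eqf; last exact: cont_cst.
  by apply: rcont_sum => i; exact: coord_continuous.
move=> F FF _; have [|v [Sv Fv]] := cS (val @ F) _.
  by rewrite /nbhs /=; apply: filterS filterT => u _; exact: set_mem (valP u).
exists (exist (fun v => v \in @std_simplex R n) v (mem_set Sv)).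
split=> // A B FA [_ [[U oU <-] /= Uv UB]].
have [||w [[u Au <-] Uw]] := Fv (val @` A) U.
- by rewrite /nbhs /=; apply: filterS FA => u Au; exists u.
- exact: open_nbhs_nbhs.
- by exists u; split=> //; exact: UB.
Qed.

Lemma compact_space_locally_compact (T : topologicalType) :
  compact [set: T] -> locally_compact [set: T].
Proof.
move=> cT x _; rewrite withinET; exists [set: T]; first exact: filterT.
by split=> //; exact: closedT.
Qed.

End simplices.

Arguments wt {R n}.

Section realization_maps.
Context (R : realType).
Local Open Scope ring_scope.
Local Notation spx n := (set_type (@std_simplex R n)).

Definition rcell (X : sset) n (x : simp X n) (t : spx n) : realization R X :=
  \pi_(realization R X) (cell x t).

Lemma rcell_act (X : sset) m n (f : delta m n) (x : simp X n) (t : spx m) :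
  rcell (sact f x) t = rcell x (simplex_push f t).
Proof. by apply/eqmodP/asboolP/rst_step/Glue. Qed.

Lemma rcell_onto (X : sset) (c : realization R X) :
  exists n (x : simp X n) (t : spx n), c = rcell x t.
Proof.
rewrite -(reprK c); case: (repr c) => -[n x] t.
by exists n, x, t.
Qed.

Lemma rcell_continuous (X : sset) n (x : simp X n) : continuous (@rcell X n x).
Proof.
move=> t; apply: (continuous_comp (f := cell x)); last exact: pi_continuous.
exact: (@existT_continuous _ (@cell_space R X) (existT _ n x)).
Qed.

Lemma realization_continuous (X : sset) (Z : topologicalType)
    (f : realization R X -> Z) :
  (forall n (x : simp X n), continuous (f \o rcell x)) -> continuous f.
Proof.
move=> fc; apply/quotient_continuous/continuousP => A oA.
apply/sigT_openP => -[n x]; have /continuousP := fc n x.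
exact.
Qed.

Lemma realization_mapE (X Y : sset) (f : smap X Y) n (x : simp X n) (t : spx n) :
  realization_map f (rcell x t) = rcell (smapf f x) t.
Proof. by rewrite /rcell realization_map_pi. Qed.

Lemma realization_map_continuous (X Y : sset) (f : smap X Y) :
  continuous (@realization_map R X Y f).
Proof.
apply: realization_continuous => n x.
rewrite (_ : _ \o _ = rcell (smapf f x)); first exact: rcell_continuous.
by apply/funext => t; exact: realization_mapE.
Qed.

Section sing.
Variables (Q Y : topologicalType).

(** With the line as parameter space [Q], a homotopy of singular simplices is
    itself a simplex. *)
Definition sing_simp n := {g : spx n * Q -> Y | continuous g}.

Lemma sing_act_subproof m n (t : delta m n) (g : sing_simp n) :
  continuous (fun zq : spx m * Q => proj1_sig g (simplex_push t zq.1, zq.2)).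
Proof.
apply: cont_comp (proj2_sig g); apply: cont_pair; last exact: cont_snd.
exact: cont_comp (@cont_fst _ _) (push_continuous (f := t)).
Qed.

Definition sing_act m n (t : delta m n) (g : sing_simp n) : sing_simp m :=
  exist _ _ (@sing_act_subproof m n t g).

Lemma sing_act_id n (g : sing_simp n) : sing_act (delta_id n) g = g.
Proof. by apply/sig_ext/funext => -[z q]; rewrite /= push_id. Qed.

Lemma sing_act_comp l m n (g : delta m n) (f : delta l m) (x : sing_simp n) :
  sing_act (delta_comp g f) x = sing_act f (sing_act g x).
Proof. by apply/sig_ext/funext => -[z q]; rewrite /= push_comp. Qed.

Definition sing : sset := SSet sing_act_id sing_act_comp.

End sing.

End realization_maps.

(** * Maps out of a realization *)

Section families.
Context (R : realType).
Local Open Scope ring_scope.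
Local Notation spx n := (set_type (@std_simplex R n)).
Variables (Q Y : topologicalType).

Definition ev (X : sset) (g : smap X (sing R Q Y)) n (x : simp X n) (t : spx n)
  (q : Q) : Y := proj1_sig (smapf g x) (t, q).

Lemma ev_act (X : sset) (g : smap X (sing R Q Y)) m n (d : delta m n)
    (x : simp X n) t q : ev g (sact d x) t q = ev g x (simplex_push d t) q.
Proof. by rewrite /ev smap_act. Qed.

Lemma ev_continuous (X : sset) (g : smap X (sing R Q Y)) n (x : simp X n) :
  continuous (fun tq : spx n * Q => ev g x tq.1 tq.2).
Proof.
rewrite (_ : (fun _ => _) = proj1_sig (smapf g x)); last by apply/funext => -[].
exact: (proj2_sig (smapf g x)).
Qed.

Lemma mk_family_subproof (X : sset) (g : forall n, simp X n -> spx n -> Q -> Y)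
    (g_cont : forall n (x : simp X n),
      continuous (fun tq : spx n * Q => g n x tq.1 tq.2))
    (g_act : forall m n (d : delta m n) (x : simp X n) t q,
      g m (sact d x) t q = g n x (simplex_push d t) q) :
  forall m n (d : delta m n) (x : simp X n),
    (exist _ _ (g_cont m (sact d x)) : simp (sing R Q Y) m) =
    sact d (exist _ _ (g_cont n x) : simp (sing R Q Y) n).
Proof. by move=> *; apply/sig_ext/funext => -[t q] /=. Qed.

Definition mk_family (X : sset) (g : forall n, simp X n -> spx n -> Q -> Y)
    (g_cont : forall n (x : simp X n),
      continuous (fun tq : spx n * Q => g n x tq.1 tq.2))
    (g_act : forall m n (d : delta m n) (x : simp X n) t q,
      g m (sact d x) t q = g n x (simplex_push d t) q) : smap X (sing R Q Y) :=
  @SMap X (sing R Q Y) _ (mk_family_subproof g_cont g_act).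

Definition rlift (X : sset) (g : smap X (sing R Q Y))
    (cq : realization R X * Q) : Y :=
  ev g (projT2 (projT1 (repr cq.1))) (projT2 (repr cq.1)) cq.2.

Lemma rliftE (X : sset) (g : smap X (sing R Q Y)) n (x : simp X n) t q :
  rlift g (rcell x t, q) = ev g x t q.
Proof.
rewrite /rlift /=.
move: (reprK (rcell x t : realization R X)); move: (repr _) => c.
rewrite [ev g x t q](_ : _ = ev g (projT2 (projT1 (@cell R X n x t)))
  (projT2 (@cell R X n x t)) q)// => /eqmodP/asboolP.
elim=> {c} [_ _ [m k d y u]|a //|a b _ ab//|a b c _ ab _ bc].
- by rewrite /= ev_act.
- by rewrite ab.
Qed.

(** For locally compact Hausdorff [Q], the product of the realization with [Q]
    has the topology coherent with the cells: curry, descend to the quotient,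
    uncurry. *)
Lemma rlift_continuous (X : sset) (g : smap X (sing R Q Y)) :
  locally_compact [set: Q] -> hausdorff_space Q -> continuous (rlift g).
Proof.
move=> lcQ hQ.
pose f (c : realization R X) : {compact-open, Q -> Y} := fun q => rlift g (c, q).
rewrite (_ : rlift g = uncurry f); last by apply/funext => -[].
apply: continuous_uncurry => // [|c].
  apply: (@realization_continuous R X {compact-open, Q -> Y} f) => n x.
  rewrite (_ : _ \o _ = curry (fun tq : spx n * Q => ev g x tq.1 tq.2)).
    exact/continuous_curry_fun/ev_continuous.
  by apply/funext => t; apply/funext => q; rewrite /f /= rliftE.
have [n [x [t ->]]] := rcell_onto c.
rewrite (_ : f _ = fun q => ev g x t q); last first.
  by apply/funext => q; rewrite /f rliftE.
apply: (cont_comp (f := fun q => (t, q)) (g := fun tq : spx n * Q => ev g x tq.1 tq.2)).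
  by apply: cont_pair; [exact: cont_cst|exact: cont_id].
exact: ev_continuous.
Qed.

End families.

Section support.
Context (R : realType).
Local Open Scope ring_scope.
Local Notation spx n := (set_type (@std_simplex R n)).

Lemma push_fix n (A : delta n n) (z : spx n) :
  (forall k, wt z k != 0 -> A k = k) -> simplex_push A z = z.
Proof.
move=> Afix; apply: spx_ext => j; rewrite wt_push.
have [zj|zj] := eqVneq (wt z j) 0.
  rewrite zj big1// => k /eqP Ak; apply/eqP; apply: contraT => zk.
  by have := zk; rewrite -{1}(Afix _ zk) Ak zj eqxx.
rewrite (bigD1 j) ?Afix//= big1 ?addr0// => k /andP[/eqP Ak kj].
by apply/eqP; apply: contraNT kj => zk; rewrite -Ak Afix.
Qed.

Lemma push_coface_codeg n (i : 'I_n.+2) (z : spx n.+1) : wt z i = 0 ->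
  simplex_push (coface i) (simplex_push (codeg i) z) = z.
Proof.
move=> zi; rewrite -push_comp; apply: push_fix => k zk; rewrite delta_compE.
by apply: coface_codeg; apply: contraNneq zk => ->; rewrite zi.
Qed.

Lemma spx0_wt (z : spx 0) i : wt z i = 1.
Proof. by rewrite -(wt_sum z) big_ord_recl big_ord0 addr0 ord1. Qed.

Lemma wt_push_ge m n (D : delta m n) (y : spx m) k :
  wt y k <= wt (simplex_push D y) (D k).
Proof.
rewrite wt_push (bigD1 k)//= lerDl; apply: sumr_ge0 => j _; exact: wt_ge0.
Qed.

Lemma spx_support n (z : spx n) : exists m (D : delta m n) (y : spx m),
  [/\ z = simplex_push D y, injective D & forall k, 0 < wt y k].
Proof.
elim: n => [|n IH] in z *.
  exists 0%N, (delta_id 0), z; rewrite push_id; split=> // k.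
  by rewrite spx0_wt.
have [/existsP[i /eqP zi]|/existsPn z0] := boolP [exists i, wt z i == 0].
  have [m [D [y [zy Dinj y0]]]] := IH (simplex_push (codeg i) z).
  exists m, (delta_comp (coface i) D), y; split=> //.
    by rewrite push_comp -zy push_coface_codeg.
  by move=> j k; rewrite !delta_compE => /lift_inj /Dinj.
exists n.+1, (delta_id n.+1), z; rewrite push_id; split=> // k.
by rewrite lt_def z0 wt_ge0.
Qed.

Section boundary_values.
Variables (Y : topologicalType) (Q : topologicalType) (n : nat).
Variable b : smap (boundary n.+1) (sing R Q Y).

Definition face_simp (i : 'I_n.+2) : simp (boundary n.+1) n :=
  nonto_face (@coface_nonto n i).

(** The value at [z] read off on the face opposite to [i], for [z] on that
    face. *)
Definition face_val (i : 'I_n.+2) (z : spx n.+1) (q : Q) : Y :=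
  ev b (face_simp i) (simplex_push (codeg i) z) q.

(** Both sides are the value on the face spanned by the support of [z]. *)
Lemma face_val_eq i j z q : wt z i = 0 -> wt z j = 0 ->
  face_val i z q = face_val j z q.
Proof.
move=> zi zj; have [m [D [y [zy Dinj y0]]]] := spx_support z.
suff fE k : wt z k = 0 -> exists nD : ~ onto D,
    face_val k z q = ev b (nonto_face nD) y q.
  have [nD ->] := fE i zi; have [nD' ->] := fE j zj.
  by rewrite (Prop_irrelevance nD nD').
move=> zk; have Dk l : D l != k.
  apply/eqP => Dlk; have := wt_push_ge D y l; rewrite -zy Dlk zk.
  by rewrite leNgt y0.
have nD : ~ onto D by move=> /(_ k)[l /eqP]; exact/negP/Dk.
exists nD; rewrite /face_val zy -push_comp -ev_act; congr (ev b _ y q).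
by apply/sig_ext/delta_ext => l; exact: coface_codeg.
Qed.

Lemma face_valE m (d : simp (boundary n.+1) m) (t : spx m) q i :
  wt (simplex_push (proj1_sig d) t) i = 0 ->
  face_val i (simplex_push (proj1_sig d) t) q = ev b d t q.
Proof.
case: d => /= d nd zi; have [j dE] := nonto_factor nd.
rewrite (@face_val_eq i j)//.
  rewrite /face_val -push_comp -ev_act; congr (ev b _ t q).
  by apply: sig_ext; rewrite /= -dE.
rewrite wt_push dE big_pred0// => k.
by apply/negbTE; rewrite eq_sym; exact: neq_lift.
Qed.

End boundary_values.

End support.

(** * The homotopy extension property *)

Section radial.
Context (R : realType) (N : nat).
Local Open Scope ring_scope.
Local Notation spx n := (set_type (@std_simplex R n)).
Implicit Types (z : spx N) (s : R).

Definition bary : R := N.+1%:R^-1.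

Lemma bary_gt0 : 0 < bary.
Proof. by rewrite invr_gt0 ltr0n. Qed.

(** A point at height [s] moves away from the barycentre along the line through
    the point of height [s + 1] over it, mirrored for negative [s], until it meets
    the floor or a wall.  Distances from the barycentre are thereby multiplied by
    the inverse of [shrink z s]: the floor is met at [1 + |s|], and the walls at
    the inverse of [1 - depth z], where [depth] is 1 at the barycentre and 0 on
    the walls. *)
Definition depth z : R := N.+1%:R * \big[Num.min/1]_i wt z i.

Definition shrink z s : R := Num.max (1 + `|s|)^-1 (1 - depth z).

Definition rad_wt z s i : R :=
  bary + (wt z i - bary) / shrink z s.

Definition rad_time z s : R :=
  Num.max 0 (s - ((shrink z s)^-1 - 1)) + Num.min 0 (s + ((shrink z s)^-1 - 1)).

Lemma depth_ge0 z : 0 <= depth z.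
Proof. rewrite mulr_ge0//; apply/bigmin_geP; split=> [|i _]; first exact: ler01.
exact: wt_ge0. Qed.

Lemma depth_le z i : bary * depth z <= wt z i.
Proof.
by rewrite /depth mulrA mulVf ?pnatr_eq0// mul1r; exact: bigmin_le_cond.
Qed.

Lemma depth_attained z : exists i, depth z = N.+1%:R * wt z i.
Proof.
have [i _ iP] := @arg_minP _ R 'I_N.+1 ord0 xpredT (wt z) isT.
exists i; congr (_ * _); apply/le_anti; rewrite bigmin_le_cond//=.
by apply/bigmin_geP; split; [exact: wt_le1|move=> j _; exact: iP].
Qed.

Lemma opens_gt0 s : 0 < 1 + `|s|.
Proof. by rewrite ltr_pwDl. Qed.

Lemma shrink_gt0 z s : 0 < shrink z s.
Proof. by rewrite lt_max invr_gt0 opens_gt0. Qed.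

Lemma shrink_le1 z s : shrink z s <= 1.
Proof.
rewrite ge_max invf_le1 ?opens_gt0// lerDl normr_ge0/= gerBl.
exact: depth_ge0.
Qed.

Lemma rad_wt_ge0 z s i : 0 <= rad_wt z s i.
Proof.
have D0 := shrink_gt0 z s; have c0 := bary_gt0.
rewrite -(pmulr_lge0 _ D0) mulrDl divfK ?gt_eqF//.
have : 1 - depth z <= shrink z s by rewrite le_max lexx orbT.
have := depth_le z i; nra.
Qed.

Lemma rad_wt_sum z s : \sum_i rad_wt z s i = 1.
Proof.
have cN : \sum_(i < N.+1) bary = 1.
  by rewrite sumr_const card_ord -mulr_natl mulfV ?pnatr_eq0.
by rewrite big_split/= -mulr_suml big_split/= sumrN wt_sum cN subrr mul0r addr0.
Qed.

Definition rad z s : spx N := mkspx (rad_wt_ge0 z s) (rad_wt_sum z s).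

Lemma depth_continuous : continuous depth.
Proof.
apply: rcontM; first exact: cont_cst.
by apply: rcont_bigmin => i; exact: wt_continuous.
Qed.

Lemma shrink_continuous : continuous (fun zs : spx N * R => shrink zs.1 zs.2).
Proof.
apply: rcont_max.
  apply: rcontV => [zs|]; first by rewrite gt_eqF ?opens_gt0.
  apply: rcontD; first exact: cont_cst.
  by apply: rcont_norm; exact: cont_snd.
apply: rcontD; first exact: cont_cst.
by apply: rcontN; exact: cont_comp (@cont_fst _ _) depth_continuous.
Qed.

Lemma shrinkV_continuous :
  continuous (fun zs : spx N * R => (shrink zs.1 zs.2)^-1).
Proof.
by apply: rcontV => [zs|]; [rewrite gt_eqF ?shrink_gt0|exact: shrink_continuous].
Qed.

Lemma rad_continuous : continuous (fun zs : spx N * R => rad zs.1 zs.2).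
Proof.
apply: continuous_into_spx => i.
rewrite (_ : (fun _ => _) = fun zs : spx N * R => rad_wt zs.1 zs.2 i); last first.
  by apply/funext => zs; rewrite wt_mkspx.
apply: rcontD; first exact: cont_cst.
apply: rcontM; last exact: shrinkV_continuous.
apply: rcontD; last exact: cont_cst.
exact: (cont_comp (@cont_fst _ _) (@wt_continuous R N i)).
Qed.

Lemma rad_time_continuous : continuous (fun zs : spx N * R => rad_time zs.1 zs.2).
Proof.
have cD : continuous (fun zs : spx N * R => (shrink zs.1 zs.2)^-1 - 1).
  by apply: rcontD; [exact: shrinkV_continuous|exact: cont_cst].
apply: rcontD.
- apply: rcont_max; first exact: cont_cst.
  by apply: rcontD; [exact: cont_snd|exact: rcontN].
- apply: rcont_min; first exact: cont_cst.
  by apply: rcontD; [exact: cont_snd|].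
Qed.

Lemma rad_fixed z s : shrink z s = 1 -> rad z s = z /\ rad_time z s = s.
Proof.
move=> D1; split.
  by apply: spx_ext => i; rewrite wt_mkspx /rad_wt D1 divr1 addrC subrK.
rewrite /rad_time D1 invr1 subrr subr0 addr0.
by case: (leP 0 s) => s0; [rewrite addr0|rewrite add0r].
Qed.

Lemma rad_floor z : rad z 0 = z /\ rad_time z 0 = 0.
Proof.
apply: rad_fixed; apply/le_anti; rewrite shrink_le1 /shrink le_max.
by rewrite normr0 addr0 invr1 lexx.
Qed.

Lemma rad_wall z s i : wt z i = 0 -> rad z s = z /\ rad_time z s = s.
Proof.
move=> zi; apply: rad_fixed; apply/le_anti; rewrite shrink_le1 /shrink le_max.
have d0 : depth z = 0.
  have := depth_le z i; rewrite zi pmulr_rle0 ?bary_gt0// => d0.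
  by apply/le_anti; rewrite d0 depth_ge0.
by rewrite d0 subr0 lexx orbT.
Qed.

Lemma rad_time0 z s : 1 - depth z <= (1 + `|s|)^-1 -> rad_time z s = 0.
Proof.
move=> /max_idPl sE; rewrite /rad_time /shrink sE invrK addrAC subrr add0r.
have h := ler_norm s.
have h' : - s <= `|s| by rewrite -normrN ler_norm.
rewrite max_l ?min_l ?addr0//; lra.
Qed.

Lemma rad_boundary z s : (1 + `|s|)^-1 <= 1 - depth z ->
  exists i, wt (rad z s) i = 0.
Proof.
move=> sE; have D0 := shrink_gt0 z s.
have [i iE] := depth_attained z; exists i; rewrite wt_mkspx.
have shE : shrink z s = 1 - depth z by rewrite /shrink; exact: max_r.
rewrite /rad_wt; have -> : wt z i = bary * depth z.
  by rewrite iE mulrA mulVf ?pnatr_eq0// mul1r.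
by have := D0; rewrite shE => d0; field; rewrite gt_eqF.
Qed.

End radial.

Section homotopy_extension.
Context (R : realType).
Local Open Scope ring_scope.
Local Notation spx n := (set_type (@std_simplex R n)).
Variable Y : topologicalType.

(** The cylinder over a simplex retracts onto its floor and walls, by [rad]. *)
Lemma cell_extension n (g : spx n -> Y) (b : smap (boundary n) (sing R R Y)) :
  continuous g ->
  (forall m (d : simp (boundary n) m) t,
    ev b d t 0 = g (simplex_push (proj1_sig d) t)) ->
  exists tau : simp (sing R R Y) n, (forall t, proj1_sig tau (t, 0) = g t) /\
    forall m (d : simp (boundary n) m),
      sact (proj1_sig d : delta m n) tau = smapf b d.
Proof.
case: n => [|n] in g b * => gc bg.
  have c0 : continuous (fun zs : spx 0 * R => g zs.1).
    exact: (cont_comp (@cont_fst _ _) gc).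
  by exists (exist _ _ c0); split=> // m [d nd]; case: nd; exact: onto0.
pose flr (zs : spx n.+1 * R) := 1 - depth zs.1 <= (1 + `|zs.2|)^-1.
pose zr (zs : spx n.+1 * R) := rad zs.1 zs.2.
pose tr (zs : spx n.+1 * R) := rad_time zs.1 zs.2.
pose f (zs : spx n.+1 * R) := if flr zs then g (zr zs) else
  if [pick i | wt (zr zs) i == 0] is Some i then face_val b i (zr zs) (tr zs)
  else g (zr zs).
have fwall zs i : wt (zr zs) i = 0 -> f zs = face_val b i (zr zs) (tr zs).
  move=> zi; rewrite /f; case: ifPn => [fl|nfl].
    rewrite /tr rad_time0// /face_val bg /= push_coface_codeg//.
  case: pickP => [j /eqP zj|/(_ i)]; last by rewrite zi eqxx.
  exact: face_val_eq.
have zc : continuous zr by exact: rad_continuous.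
have tc : continuous tr by exact: rad_time_continuous.
have fc : continuous f.
  apply: (@closed_pasting _ _ (option 'I_n.+2)
    (fun o => if o is Some i then [set zs | wt (zr zs) i = 0] else [set zs | flr zs])
    (fun o zs => if o is Some i then face_val b i (zr zs) (tr zs) else g (zr zs))).
  - case=> [i|].
      apply: closed_eqf; last exact: cont_cst.
      exact: (cont_comp zc (@wt_continuous R _ i)).
    apply: (@closed_lef R _ (fun zs : spx n.+1 * R => 1 - depth zs.1)).
      apply: rcontD; first exact: cont_cst.
      by apply: rcontN; exact: (cont_comp (@cont_fst _ _) (@depth_continuous R _)).
    apply: rcontV => [zs|]; first by rewrite gt_eqF ?opens_gt0.
    by apply: rcontD; [exact: cont_cst|apply: rcont_norm; exact: cont_snd].
  - case=> [i|]; last exact: (cont_comp zc gc).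
    exact: (cont_comp (cont_pair (cont_comp zc (@push_continuous R _ _ (codeg i)))
      tc) (@ev_continuous R R Y _ b _ (face_simp i))).
  - move=> zs; have [fl|nfl] := boolP (flr zs); first by exists None.
    have [|i zi] := @rad_boundary _ _ zs.1 zs.2; last by exists (Some i).
    by apply: ltW; rewrite ltNge.
  - case=> [i|] zs /=; first exact: fwall.
    by rewrite /f => ->.
exists (exist _ _ fc); split=> [t|m d] /=.
  have [zt t0] := rad_floor t.
  rewrite /f /flr /zr /= zt normr0 addr0 invr1 gerBl.
  by rewrite depth_ge0.
apply/sig_ext/funext => -[t s] /=.
rewrite [RHS](_ : _ = ev b d t s)//.
have [i zi] : exists i, wt (simplex_push (proj1_sig d) t) i = 0.
  case: d => /= d nd; have [i dE] := nonto_factor nd; exists i.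
  rewrite wt_push dE big_pred0// => k.
  by apply/negbTE; rewrite eq_sym; exact: neq_lift.
have [zE tE] := rad_wall s zi.
by rewrite (fwall _ i) /zr /tr /= ?zE// tE face_valE.
Qed.

(** A partial homotopy is a functional relation between simplices of [X] and
    their tracks; the simplices related to some track form the subcomplex on
    which the homotopy is prescribed. *)
Theorem homotopy_extension (X : sset) (g : realization R X -> Y)
    (psi : forall n, simp X n -> simp (sing R R Y) n -> Prop) :
  continuous g ->
  (forall n (x : simp X n) h h', psi n x h -> psi n x h' -> h = h') ->
  (forall m n (d : delta m n) (x : simp X n) h,
    psi n x h -> psi m (sact d x) (sact d h)) ->
  (forall n (x : simp X n) h t, psi n x h -> proj1_sig h (t, 0) = g (rcell x t)) ->
  exists H : realization R X * R -> Y, [/\ continuous H,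
    forall c, H (c, 0) = g c &
    forall n (x : simp X n) h t s, psi n x h ->
      H (rcell x t, s) = proj1_sig h (t, s)].
Proof.
move=> gc psi_fun psi_act psi0.
pose Phi n (x : simp X n) (h : simp (sing R R Y) n) :=
  (forall t, proj1_sig h (t, 0) = g (rcell x t)) /\
  forall h', psi n x h' -> h = h'.
have [||H HP] := @section_principle X (sing R R Y) Phi.
- move=> m n d x h d_onto [h0 hpsi]; split=> [t|h' ph'].
    by rewrite /= h0 rcell_act.
  have [s [_ ds]] := onto_section ord0 d_onto.
  have ph : psi n x (sact s h').
    by rewrite -[x]sact_id -ds sact_comp; exact: psi_act.
  rewrite (hpsi _ ph); apply: psi_fun ph'.
  exact: psi_act.
- move=> n x b bP.
  have [[h ph]|nh] := pselect (exists h, psi n x h).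
    exists h; split.
      by split=> [t|h' ph']; [exact: psi0|exact: psi_fun ph'].
    by move=> m d; apply/esym; apply: (bP m d).2; exact: psi_act.
  have [|m d t|h [h0 hb]] := @cell_extension n (g \o rcell x) b.
  + by apply: cont_comp gc; exact: rcell_continuous.
  + by have [b0 _] := bP m d; rewrite /ev b0 rcell_act.
  exists h; split=> //; split=> // h' ph'.
  by case: nh; exists h'.
exists (rlift H); split.
- by apply: rlift_continuous; [exact: locally_compactR|exact: Rhausdorff].
- move=> c; have [n [x [t ->]]] := rcell_onto c.
  by rewrite rliftE /ev (HP n x).1.
- by move=> n x h t s ph; rewrite rliftE /ev; rewrite ((HP n x).2 h).
Qed.

Lemma realization_familyQ (Q : topologicalType) (X : sset)
    (g : forall n, simp X n -> spx n -> Q -> Y) :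
  locally_compact [set: Q] -> hausdorff_space Q ->
  (forall n (x : simp X n), continuous (fun tq : spx n * Q => g n x tq.1 tq.2)) ->
  (forall m n (d : delta m n) (x : simp X n) t q,
    g m (sact d x) t q = g n x (simplex_push d t) q) ->
  exists G : realization R X * Q -> Y, continuous G /\
    forall n (x : simp X n) t q, G (rcell x t, q) = g n x t q.
Proof.
move=> lcQ hQ gc ga; exists (rlift (mk_family gc ga)); split.
  exact: rlift_continuous.
by move=> n x t q; rewrite rliftE.
Qed.

Lemma realization_family (X : sset) (g : forall n, simp X n -> spx n -> Y) :
  (forall n (x : simp X n), continuous (g n x)) ->
  (forall m n (d : delta m n) (x : simp X n) t,
    g m (sact d x) t = g n x (simplex_push d t)) ->
  exists G : realization R X -> Y, continuous G /\
    forall n (x : simp X n) t, G (rcell x t) = g n x t.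
Proof.
move=> gc ga.
have [||n x|m n d x t q|G [Gc GE]] := @realization_familyQ R X (fun n x t _ => g n x t).
- exact: locally_compactR.
- exact: Rhausdorff.
- exact: (cont_comp (@cont_fst _ _) (gc n x)).
- exact: ga.
exists (fun c => G (c, 0)); split=> [|n x t]; last exact: GE.
by apply: (cont_comp _ Gc); apply: cont_pair; [exact: cont_id|exact: cont_cst].
Qed.

End homotopy_extension.

(** * Realization of products *)

Section coupling.
Context (R : realType).
Local Open Scope ring_scope.

(** [u] is a weighting of a monotone path [(a, b)] in the rectangle of sides [p]
    and [q], with marginals [z] and [w]. *)
Record coupling (p q : nat) (z w : nat -> R) (N : nat) (a b : nat -> nat)
    (u : nat -> R) : Prop := Coupling {
  coup_mono1 : forall k, (a k <= a k.+1)%N;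
  coup_mono2 : forall k, (b k <= b k.+1)%N;
  coup_le1 : forall k, (k <= N)%N -> (a k <= p)%N;
  coup_le2 : forall k, (k <= N)%N -> (b k <= q)%N;
  coup_ge0 : forall k, 0 <= u k;
  coup_sum1 : forall i, (i <= p)%N -> \sum_(k < N.+1 | a k == i) u k = z i;
  coup_sum2 : forall j, (j <= q)%N -> \sum_(k < N.+1 | b k == j) u k = w j }.

Lemma coupling_sym p q z w N a b u :
  coupling p q z w N a b u -> coupling q p w z N b a u.
Proof. by case. Qed.

Lemma coupling_step p q (z w : nat -> R) N a b u : 0 <= z 0%N ->
  coupling p q (fun i => z i.+1) (fun j => if j is 0 then w 0%N - z 0%N else w j)
    N a b u ->
  coupling p.+1 q z w N.+1 (fun k => if k is k'.+1 then (a k').+1 else 0%N)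
    (fun k => if k is k'.+1 then b k' else 0%N)
    (fun k => if k is k'.+1 then u k' else z 0%N).
Proof.
move=> z0 [a1 b1 ap bq u0 az bw]; split=> [[|k]|[|k]|[|k]|[|k]|[|k]|i ip|j jq] //.
- by rewrite !ltnS.
- by rewrite !ltnS => /ap.
- by rewrite ltnS => /bq.
- rewrite big_mkcond big_ord_recl /=; case: i ip => [|i] ip.
    by rewrite big1 ?addr0.
  by rewrite add0r -az// [RHS]big_mkcond.
- rewrite big_mkcond big_ord_recl /=.
  rewrite (eq_bigr (fun k : 'I_N.+1 => if b k == j then u k else 0))//.
  rewrite -big_mkcond /= bw//.
  by case: j jq => [|j] _; rewrite ?add0r//= addrC subrK.
Qed.

(** The north-west corner rule: spend the smaller of the two current masses and
    advance on its side. *)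
Lemma coupling_exists p q (z w : nat -> R) :
  (forall i, 0 <= z i) -> (forall j, 0 <= w j) ->
  \sum_(i < p.+1) z i = \sum_(j < q.+1) w j ->
  exists a b u, coupling p q z w (p + q) a b u.
Proof.
move: {2}(p + q)%N (erefl (p + q)%N) => n.
elim: n p q z w => [|n IH] p q z w pq z0 w0 zw.
  move: pq zw => /eqP; rewrite addn_eq0 => /andP[/eqP -> /eqP ->].
  rewrite !big_ord_recl !big_ord0 !addr0 => zw.
  exists (fun _ => 0%N), (fun _ => 0%N), (fun _ => z 0%N); split=> // i.
    by rewrite leqn0 => /eqP ->; rewrite big_ord_recl big_ord0 addr0.
  by rewrite leqn0 => /eqP ->; rewrite big_ord_recl big_ord0 addr0.
have step p' q' (x y : nat -> R) : (p'.+1 + q' = n.+1)%N ->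
    (forall i, 0 <= x i) -> (forall j, 0 <= y j) -> x 0%N <= y 0%N ->
    \sum_(i < p'.+2) x i = \sum_(j < q'.+1) y j ->
    exists a b u, coupling p'.+1 q' x y (p'.+1 + q') a b u.
  move=> [pq'] x0 y0 xy xys.
  have [|i|[|j]||a [b [u abu]]] := IH p' q' (fun i => x i.+1)
      (fun j => if j is 0 then y 0%N - x 0%N else y j) => //.
  - by rewrite subr_ge0.
  - move: xys; rewrite big_ord_recl [in RHS]big_ord_recl => xys.
    rewrite [in RHS]big_ord_recl /= -[LHS](addKr (x 0%N)) /=.
    move: xys; rewrite /bump /= => ->.
    by rewrite addrA [- _ + _]addrC.
  - by do 3 eexists; exact: coupling_step abu.
have [zw0|wz0] := leP (z 0%N) (w 0%N).
  case: p => [|p] in pq zw *; last exact: step.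
  case: q => [//|q] in pq zw *.
  have [a [b [u abu]]] :
      exists a b u, coupling q.+1 0%N w z (q.+1 + 0) a b u.
    apply: step => //; first by rewrite addn0 -pq.
    move: zw; rewrite big_ord_recl big_ord0 addr0 big_ord_recl => ->.
    by rewrite lerDl; apply: sumr_ge0.
  by exists b, a, u; move: abu => /coupling_sym; rewrite addn0.
case: q => [|q] in pq zw *.
  move: zw; rewrite [RHS]big_ord_recl big_ord0 addr0 big_ord_recl => zw.
  by move: wz0; rewrite -zw ltNge lerDl sumr_ge0.
have [a [b [u abu]]] : exists a b u, coupling q.+1 p w z (q.+1 + p) a b u.
  by apply: step => //; [rewrite addnC|exact: ltW].
by exists b, a, u; move: abu => /coupling_sym; rewrite addnC.
Qed.

End coupling.

Section product_points.
Context (R : realType).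
Local Open Scope ring_scope.
Local Notation spx n := (set_type (@std_simplex R n)).

Lemma spx_coupling p q (z : spx p) (w : spx q) :
  exists (a : delta (p + q) p) (b : delta (p + q) q) (u : spx (p + q)),
    simplex_push a u = z /\ simplex_push b u = w.
Proof.
pose z' i := if insub i is Some k then wt z k else 0.
pose w' i := if insub i is Some k then wt w k else 0.
have z'E (k : 'I_p.+1) : z' k = wt z k by rewrite /z' valK.
have w'E (k : 'I_q.+1) : w' k = wt w k by rewrite /w' valK.
have [i|j||a [b [u [a1 b1 ap bq u0 az bw]]]] := @coupling_exists R p q z' w'.
- by rewrite /z'; case: insubP => // *; exact: wt_ge0.
- by rewrite /w'; case: insubP => // *; exact: wt_ge0.
- rewrite (eq_bigr (wt z)) ?wt_sum; last by move=> i _.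
  by rewrite (eq_bigr (wt w)) ?wt_sum.
have ak (k : 'I_(p + q).+1) : (a k < p.+1)%N by rewrite ltnS ap// -ltnS.
have bk (k : 'I_(p + q).+1) : (b k < q.+1)%N by rewrite ltnS bq// -ltnS.
have a_homo : {homo (fun k => Ordinal (ak k)) : i j / (i <= j)%O}.
  by move=> i j ij; exact: (homo_leq (@leqnn) leq_trans a1 ij).
have b_homo : {homo (fun k => Ordinal (bk k)) : i j / (i <= j)%O}.
  by move=> i j ij; exact: (homo_leq (@leqnn) leq_trans b1 ij).
have az' (i : 'I_p.+1) :
    \sum_(k < (p + q).+1 | mkdelta a_homo k == i) u k = wt z i.
  by rewrite -z'E -az// -ltnS.
have bw' (j : 'I_q.+1) :
    \sum_(k < (p + q).+1 | mkdelta b_homo k == j) u k = wt w j.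
  by rewrite -w'E -bw// -ltnS.
have u1 : \sum_(k < (p + q).+1) u k = 1.
  rewrite -(wt_sum z) (partition_big (mkdelta a_homo) xpredT)//=.
  by apply: eq_bigr => i _; rewrite az'.
exists (mkdelta a_homo), (mkdelta b_homo), (mkspx (fun k => u0 k) u1).
split; apply: spx_ext => i; rewrite wt_push; under eq_bigr do rewrite wt_mkspx.
  exact: az'.
exact: bw'.
Qed.

(** Statements about two points reduce to points with the same barycentric
    coordinates. *)
Lemma common_cell (K M : sset) (c : realization R K) (c' : realization R M) :
  exists n (x : simp K n) (y : simp M n) (t : spx n),
    c = rcell x t /\ c' = rcell y t.
Proof.
have [p [x [z ->]]] := rcell_onto c; have [q [y [w ->]]] := rcell_onto c'.
have [a [b [u [<- <-]]]] := spx_coupling z w.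
by exists (p + q)%N, (sact a x), (sact b y), u; rewrite !rcell_act.
Qed.

End product_points.

Section path_points.
Context (R : realType).
Local Open Scope ring_scope.
Local Notation spx n := (set_type (@std_simplex R n)).

Definition path_mass p q N (a : delta N p) (b : delta N q) (u : spx N)
  (x y : nat) : R := \sum_(k | (a k < x)%N && (b k < y)%N) wt u k.

(** Lower sets of a chain are nested: the two half planes cut out by the corner
    meet the path in lower sets. *)
Lemma path_massE p q N (a : delta N p) (b : delta N q) (u : spx N) x y :
  path_mass a b u x y =
  Num.min (\sum_(i < p.+1 | (i < x)%N) wt (simplex_push a u) i)
          (\sum_(j < q.+1 | (j < y)%N) wt (simplex_push b u) j).
Proof.
have marg r (c : delta N r) n : \sum_(i < r.+1 | (i < n)%N) wt (simplex_push c u) i =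
    \sum_(k | (c k < n)%N) wt u k.
  rewrite [RHS](partition_big c (fun i => (i < n)%N))//=.
  apply: eq_bigr => i ix; rewrite wt_push; apply: eq_bigl => k.
  by apply/idP/andP => [/eqP ->//|[]].
rewrite !marg /path_mass.
have sub (P P' : pred 'I_N.+1) : (forall k, P k -> P' k) ->
    \sum_(k | P k) wt u k <= \sum_(k | P' k) wt u k.
  move=> PP'; rewrite [leRHS](bigID P)/= (eq_bigl P); last first.
    by move=> k; apply/andP/idP => [[]//|Pk]; split=> //; exact: PP'.
  by rewrite lerDl; apply: sumr_ge0 => k _; exact: wt_ge0.
have [ab|] := pselect (forall k, (a k < x)%N -> (b k < y)%N).
  rewrite min_l; last exact: sub.
  by apply: eq_bigl => k; apply/andP/idP => [[]//|ax]; split=> //; exact: ab.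
move=> /existsNP[k /not_implyP[ak bk]].
have ba l : (b l < y)%N -> (a l < x)%N.
  move=> bl; apply: leq_ltn_trans ak; apply: (omorph_le a).
  rewrite leEord leqNgt; apply/negP => /ltnW kl; apply: bk.
  by apply: leq_ltn_trans bl; exact: (omorph_le b).
rewrite min_r; last exact: sub.
by apply: eq_bigl => l; apply/andP/idP => [[]//|bl]; split=> //; exact: ba.
Qed.

Lemma path_mass_point p q N (a : delta N p) (b : delta N q) (u : spx N) x y :
  \sum_(k | (a k == x :> nat) && (b k == y :> nat)) wt u k =
  path_mass a b u x.+1 y.+1 - path_mass a b u x y.+1 -
  (path_mass a b u x.+1 y - path_mass a b u x y).
Proof.
rewrite /path_mass !(big_mkcond (fun k => _ && _)) -!sumrB; apply: eq_bigr => k _.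
rewrite !ltnS !(leq_eqVlt (a k)) !(leq_eqVlt (b k)).
by case: (ltngtP (a k) x) => //=; case: (ltngtP (b k) y) => //= *;
  rewrite ?subrr ?subr0.
Qed.

Definition strict_path p q N (a : delta N p) (b : delta N q) : Prop :=
  forall k l : 'I_N.+1, (k < l)%N -> (a k < a l)%N || (b k < b l)%N.

Lemma strict_path_inj p q N (a : delta N p) (b : delta N q) k l :
  strict_path a b -> a k = a l -> b k = b l -> k = l.
Proof.
move=> sab ak bk; apply/val_inj; case: (ltngtP k l) => // /sab.
  by rewrite ak bk !ltnn.
by rewrite ak bk !ltnn.
Qed.

Lemma strict_path_mass p q N (a : delta N p) (b : delta N q) (u : spx N) k :
  strict_path a b ->
  \sum_(l | (a l == a k :> nat) && (b l == b k :> nat)) wt u l = wt u k.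
Proof.
move=> sab; apply: big_pred1 => l; apply/andP/eqP => [[/eqP al /eqP bl]|-> //].
by apply: (strict_path_inj sab); exact: val_inj.
Qed.

Definition path_seq p q N (a : delta N p) (b : delta N q) : seq (nat * nat) :=
  [seq (nat_of_ord (a k), nat_of_ord (b k)) | k <- enum 'I_N.+1].

Definition path_lt (x y : nat * nat) : bool :=
  [&& (x.1 <= y.1)%N, (x.2 <= y.2)%N & x != y].

Lemma path_lt_trans : transitive path_lt.
Proof.
move=> y x z /and3P[xy1 xy2 xy] /and3P[yz1 yz2 yz]; apply/and3P; split.
- exact: leq_trans yz1.
- exact: leq_trans yz2.
- apply: contra xy => /eqP xz; subst z.
  rewrite [x]surjective_pairing [y]surjective_pairing xpair_eqE !eqn_leq.
  by rewrite xy1 xy2 yz1 yz2.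
Qed.

Lemma path_lt_irr : irreflexive path_lt.
Proof. by move=> x; rewrite /path_lt eqxx !andbF. Qed.

Lemma path_seq_sorted p q N (a : delta N p) (b : delta N q) :
  strict_path a b -> sorted path_lt (path_seq a b).
Proof.
move=> sab; rewrite sorted_pairwise; last exact: path_lt_trans.
rewrite pairwise_map.
have : pairwise (relpre val ltn) (enum 'I_N.+1).
  rewrite -pairwise_map val_enum_ord -sorted_pairwise ?iota_ltn_sorted//.
  exact: ltn_trans.
apply: sub_pairwise => k l kl; apply/and3P => /=; split.
- exact: (omorph_le a (ltnW kl)).
- exact: (omorph_le b (ltnW kl)).
- by apply/eqP => -[ak bk]; have := sab _ _ kl; rewrite ak bk !ltnn.
Qed.

Lemma mem_path_seq p q N (a : delta N p) (b : delta N q) (u : spx N) xy :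
  (forall k, 0 < wt u k) ->
  (xy \in path_seq a b) =
  (\sum_(k | (a k == xy.1 :> nat) && (b k == xy.2 :> nat)) wt u k != 0).
Proof.
move=> u0; apply/mapP/idP => [[k _ ->] /=|].
  rewrite gt_eqF// (bigD1 k) ?eqxx//= ltr_pwDl//.
  by apply: sumr_ge0 => l _; exact: wt_ge0.
apply: contraNP => nxy; rewrite big_pred0// => k.
apply/negP => /andP[/eqP ak /eqP bk]; apply: nxy; exists k; rewrite ?mem_enum//.
by rewrite ak bk -surjective_pairing.
Qed.

(** The marginals determine the masses of rectangles, hence the mass of each
    vertex, hence the set of vertices of the path. *)
Lemma strict_path_unique p q N (a : delta N p) (b : delta N q) (u : spx N)
    N' (a' : delta N' p) (b' : delta N' q) (u' : spx N') :
  strict_path a b -> strict_path a' b' ->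
  (forall k, 0 < wt u k) -> (forall k, 0 < wt u' k) ->
  simplex_push a u = simplex_push a' u' ->
  simplex_push b u = simplex_push b' u' ->
  exists e : N' = N, [/\ a' = ecast n (delta n p) (esym e) a,
    b' = ecast n (delta n q) (esym e) b &
    u' = ecast n (spx n) (esym e) u].
Proof.
move=> sab sab' u0 u'0 au bu.
have mass x y : \sum_(k | (a k == x :> nat) && (b k == y :> nat)) wt u k =
    \sum_(k | (a' k == x :> nat) && (b' k == y :> nat)) wt u' k.
  by rewrite !path_mass_point !path_massE au bu.
have seqE : path_seq a b = path_seq a' b'.
  apply: (irr_sorted_eq path_lt_trans path_lt_irr); try exact: path_seq_sorted.
  by move=> xy; rewrite (mem_path_seq _ _ _ u0) (mem_path_seq _ _ _ u'0) mass.
have /(congr1 size) := seqE; rewrite !size_map -!enumT !size_enum_ord => -[NN'].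
subst N'; exists erefl => /=.
have abE k : (nat_of_ord (a k), nat_of_ord (b k)) =
    (nat_of_ord (a' k), nat_of_ord (b' k)).
  have := congr1 (fun s => nth (0%N, 0%N) s k) seqE.
  by rewrite /path_seq !(nth_map k) -?enumT ?size_enum_ord// !nth_ord_enum.
have aE : a' = a by apply: delta_ext => k; apply/val_inj/esym; case: (abE k).
have bE : b' = b by apply: delta_ext => k; apply/val_inj/esym; case: (abE k).
split=> //; apply: spx_ext => k.
by rewrite -(strict_path_mass u k sab) mass aE bE strict_path_mass.
Qed.

Section product_cells.
Variables (K M : sset) (p q : nat) (x : simp K p) (y : simp M q).

Definition path_cell N (a : delta N p) (b : delta N q) (u : spx N) :
  realization R (prod_sset K M) :=
  rcell ((sact a x, sact b y) : simp (prod_sset K M) N) u.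

Lemma path_cell_act N N' (a : delta N p) (b : delta N q) (d : delta N' N) u :
  path_cell (delta_comp a d) (delta_comp b d) u =
  path_cell a b (simplex_push d u).
Proof. by rewrite /path_cell -rcell_act /= /prod_act /= !sact_comp. Qed.

(** Discard vertices of weight zero, then merge equal consecutive vertices. *)
Lemma strict_path_exists N (a : delta N p) (b : delta N q) (u : spx N) :
  exists N' (a' : delta N' p) (b' : delta N' q) (u' : spx N'),
    [/\ path_cell a b u = path_cell a' b' u',
        simplex_push a u = simplex_push a' u',
        simplex_push b u = simplex_push b' u',
        forall k, 0 < wt u' k & strict_path a' b'].
Proof.
have [m [D [v [-> _ v0]]]] := spx_support u.
rewrite -path_cell_act -!push_comp.
move: (delta_comp a D) (delta_comp b D) => {N D u}a {}b.
elim: m => [|m IH] in a b v v0 *.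
  exists 0%N, a, b, v; split=> // k l; rewrite [k]ord1 [l]ord1 ltnn//.
have [[k [ak bk]]|nab] := pselect (exists k : 'I_m.+1,
    a (widen_ord (leqnSn _) k) = a (lift ord0 k) /\
    b (widen_ord (leqnSn _) k) = b (lift ord0 k)).
  pose i : 'I_m.+2 := widen_ord (leqnSn _) k.
  have iE : coface i (codeg i i) = lift ord0 k.
    apply/val_inj => /=; rewrite /codeg_fun inordK ?ltnS ?geq_minl//=.
    by have := ltn_ord k; rewrite /bump /unbump /=; lia.
  have merge r (c : delta m.+1 r) : c i = c (lift ord0 k) ->
      c = delta_comp (delta_comp c (coface i)) (codeg i).
    move=> ci; apply: delta_ext => j; rewrite !delta_compE.
    have [->|ji] := eqVneq j i; first by rewrite iE.
    by rewrite coface_codeg.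
  have vk j : 0 < wt (simplex_push (codeg i) v) j.
    apply: lt_le_trans (v0 (coface i j)) _.
    have {2}-> : j = codeg i (coface i j).
      by have := congr1 (fun f : delta m m => f j) (codegK i).
    exact: wt_push_ge.
  rewrite (merge _ a ak) (merge _ b bk) path_cell_act.
  rewrite (push_comp (delta_comp a _)) (push_comp (delta_comp b _)).
  exact: IH.
exists m.+1, a, b, v; split=> // k l kl.
have km : (k < m.+1)%N by apply: leq_trans kl _; rewrite -ltnS ltn_ord.
have kE : k = widen_ord (leqnSn _) (Ordinal km) by exact: val_inj.
have le_kl : (lift ord0 (Ordinal km) <= l)%O by rewrite leEord.
have al : (a (lift ord0 (Ordinal km)) <= a l)%N := omorph_le a le_kl.
have bl : (b (lift ord0 (Ordinal km)) <= b l)%N := omorph_le b le_kl.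
have le_k : (k <= lift ord0 (Ordinal km))%O by rewrite leEord /= /bump /=; lia.
have ak : (a k <= a (lift ord0 (Ordinal km)))%N := omorph_le a le_k.
have bk : (b k <= b (lift ord0 (Ordinal km)))%N := omorph_le b le_k.
apply/negP => /negP; rewrite negb_or -!leqNgt => /andP[lk lk'].
apply: nab; exists (Ordinal km); rewrite -kE.
by split; apply/val_inj => /=; lia.
Qed.

(** Over the pair of cells [x] and [y], a point of the realization of the product
    is determined by its coordinates in the two cells. *)
Lemma path_cell_eq N (a : delta N p) (b : delta N q) (u : spx N)
    N' (a' : delta N' p) (b' : delta N' q) (u' : spx N') :
  simplex_push a u = simplex_push a' u' ->
  simplex_push b u = simplex_push b' u' ->
  path_cell a b u = path_cell a' b' u'.
Proof.
have [m [c [d [v [-> -> -> v0 scd]]]]] := strict_path_exists a b u.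
have [m' [c' [d' [v' [-> -> -> v'0 scd']]]]] := strict_path_exists a' b' u'.
move=> cv dv; have [e [-> -> ->]] := strict_path_unique scd scd' v0 v'0 cv dv.
by subst m'.
Qed.

End product_cells.

End path_points.

Section product_map.
Context (R : realType).
Local Notation spx n := (set_type (@std_simplex R n)).
Variables K M : sset.
Local Notation KM := (realization R (prod_sset K M)).

Lemma prod_cell_subproof p q (x : simp K p) (y : simp M q) (zw : spx p * spx q) :
  exists c : KM, forall N (a : delta N p) (b : delta N q) (u : spx N),
    simplex_push a u = zw.1 -> simplex_push b u = zw.2 ->
    c = path_cell x y a b u.
Proof.
have [a [b [u [<- <-]]]] := spx_coupling zw.1 zw.2.
by exists (path_cell x y a b u) => N a' b' u' au bu; exact: path_cell_eq.
Qed.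

Definition prod_cell p q (x : simp K p) (y : simp M q) (zw : spx p * spx q) : KM :=
  projT1 (cid (prod_cell_subproof x y zw)).

Lemma prod_cellE p q (x : simp K p) (y : simp M q) N (a : delta N p)
    (b : delta N q) (u : spx N) :
  prod_cell x y (simplex_push a u, simplex_push b u) = path_cell x y a b u.
Proof. by rewrite /prod_cell; case: cid => c /= cE; exact: cE. Qed.

Lemma prod_cell_actl p' p q (d : delta p' p) (x : simp K p) (y : simp M q) z w :
  prod_cell (sact d x) y (z, w) = prod_cell x y (simplex_push d z, w).
Proof.
have [a [b [u [<- <-]]]] := spx_coupling z w.
by rewrite -push_comp !prod_cellE /path_cell sact_comp.
Qed.

Lemma prod_cell_actr p q' q (d : delta q' q) (x : simp K p) (y : simp M q) z w :
  prod_cell x (sact d y) (z, w) = prod_cell x y (z, simplex_push d w).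
Proof.
have [a [b [u [<- <-]]]] := spx_coupling z w.
by rewrite -push_comp !prod_cellE /path_cell sact_comp.
Qed.

Lemma prod_cell_diag n (x : simp K n) (y : simp M n) t :
  prod_cell x y (t, t) = rcell ((x, y) : simp (prod_sset K M) n) t.
Proof.
have := prod_cellE x y (delta_id n) (delta_id n) t.
by rewrite !push_id /path_cell !sact_id.
Qed.

Lemma spx_pair_hausdorff p q : hausdorff_space (spx p * spx q)%type.
Proof.
move=> [z w] [z' w'] zw; congr pair.
  apply: spx_hausdorff => A B Az Bz.
  have [] := zw (A `*` setT) (B `*` setT); last by move=> [a b] [[? _] [? _]]; exists a.
    by exists (A, setT); [split=> //; exact: filterT|].
  by exists (B, setT); [split=> //; exact: filterT|].
apply: spx_hausdorff => A B Aw Bw.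
have [] := zw (setT `*` A) (setT `*` B); last by move=> [a b] [[_ ?] [_ ?]]; exists b.
  by exists (setT, A); [split=> //; exact: filterT|].
by exists (setT, B); [split=> //; exact: filterT|].
Qed.

(** The product of two simplices is a finite union of images of simplices under
    the closed maps given by monotone paths. *)
Lemma prod_cell_continuous p q (x : simp K p) (y : simp M q) :
  continuous (prod_cell x y).
Proof.
pose N := (p + q)%N.
pose I : finType := ({ffun 'I_N.+1 -> 'I_p.+1} * {ffun 'I_N.+1 -> 'I_q.+1})%type.
apply/continuous_closedP => V clV.
pose D (i : I) := [set zw : spx p * spx q |
  exists (a : delta N p) (b : delta N q) (u : spx N),
    [/\ a =1 i.1, b =1 i.2, zw = (simplex_push a u, simplex_push b u) &
        V (path_cell x y a b u)]].
rewrite (_ : _ @^-1` _ = \big[setU/set0]_(i <- enum I) D i).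
  apply: closed_bigsetU => i _.
  have [[a [b [ai bi]]]|nab] := pselect (exists (a : delta N p) (b : delta N q),
      a =1 i.1 /\ b =1 i.2); last first.
    rewrite (_ : D i = set0); first exact: closed0.
    by apply/seteqP; split=> // zw [a [b [u [ai bi _ _]]]]; case: nab; exists a, b.
  pose psi (u : spx N) := (simplex_push a u, simplex_push b u).
  have psic : continuous psi by apply: cont_pair; exact: push_continuous.
  rewrite (_ : D i = psi @` (path_cell x y a b @^-1` V)).
    apply: compact_closed; first exact: spx_pair_hausdorff.
    apply: continuous_compact; first exact: continuous_subspaceT.
    apply: (subclosed_compact _ (@spx_compact R N)); last by [].
    by apply: preimage_closed => // u _; exact: rcell_continuous.
  apply/seteqP; split=> [zw [a' [b' [u [ai' bi' -> Vu]]]]|_ [u Vu <-]].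
    have aE : a = a' by apply: delta_ext => k; rewrite ai ai'.
    have bE : b = b' by apply: delta_ext => k; rewrite bi bi'.
    by exists u; rewrite /psi ?aE ?bE.
  by exists a, b, u.
rewrite -bigcup_seq; apply/seteqP; split=> [[z w] /= Vzw|zw [i _]].
  have [a [b [u [az bw]]]] := spx_coupling z w.
  exists (finfun a, finfun b) => /=; first by rewrite mem_enum.
  exists a, b, u; split=> [k|k||]; rewrite ?ffunE//= -?prod_cellE ?az ?bw//.
by move=> [a [b [u [_ _ -> Vu]]]] /=; rewrite prod_cellE.
Qed.

(** The inverse of the comparison map from the realization of a product to the
    product of the realizations.  It need not be continuous for the product
    topology, but it is on each cell of the first factor. *)
Theorem product_map : exists e : realization R K -> realization R M -> KM,
  (forall n (x : simp K n) (y : simp M n) t,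
    e (rcell x t) (rcell y t) = rcell ((x, y) : simp (prod_sset K M) n) t) /\
  forall p (x : simp K p),
    continuous (fun zc : spx p * realization R M => e (rcell x zc.1) zc.2).
Proof.
have ex1 q (y : simp M q) w : exists G : realization R K -> KM,
    forall p (x : simp K p) z, G (rcell x z) = prod_cell x y (z, w).
  have [p x|p' p d x z|G [_ GE]] := @realization_family R KM K
      (fun p x z => prod_cell x y (z, w)).
  - apply: (cont_comp _ (@prod_cell_continuous _ _ x y)).
    by apply: cont_pair; [exact: cont_id|exact: cont_cst].
  - exact: prod_cell_actl.
  - by exists G.
pose G1 q (y : simp M q) w := projT1 (cid (ex1 q y w)).
have G1E q (y : simp M q) w p (x : simp K p) z :
  G1 q y w (rcell x z) = prod_cell x y (z, w).
  exact: (projT2 (cid (ex1 q y w))).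
have ex2 c : exists G : realization R M -> KM,
    forall q (y : simp M q) w, G (rcell y w) = G1 q y w c.
  have [p [x [z ->]]] := rcell_onto c.
  have [q y|q' q d y w|G [_ GE]] := @realization_family R KM M
      (fun q y w => prod_cell x y (z, w)).
  - apply: (cont_comp _ (@prod_cell_continuous _ _ x y)).
    by apply: cont_pair; [exact: cont_cst|exact: cont_id].
  - exact: prod_cell_actr.
  - by exists G => q y w; rewrite GE G1E.
pose e c := projT1 (cid (ex2 c)).
have eE p (x : simp K p) z q (y : simp M q) w :
    e (rcell x z) (rcell y w) = prod_cell x y (z, w).
  rewrite -(G1E _ y w p x z); exact: (projT2 (cid (ex2 (rcell x z)))).
exists e; split=> [n x y t|p x]; first by rewrite eE prod_cell_diag.
have [||q y|m n d y w z|G [Gc GE]] := @realization_familyQ R KM (spx p) M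
    (fun q y w z => prod_cell x y (z, w)).
- apply: compact_space_locally_compact; exact: spx_compact.
- exact: spx_hausdorff.
- apply: (cont_comp _ (@prod_cell_continuous _ _ x y)).
  by apply: cont_pair; [exact: cont_snd|exact: cont_fst].
- exact: prod_cell_actr.
rewrite (_ : (fun _ => _) = fun zc => G (zc.2, zc.1)).
  by apply: (cont_comp _ Gc); apply: cont_pair; [exact: cont_snd|exact: cont_fst].
apply/funext => -[z c] /=; have [q [y [w ->]]] := rcell_onto c.
by rewrite eE GE.
Qed.

End product_map.

(** * Homotopies *)

Section homotopies.
Context (R : realType).
Local Open Scope ring_scope.

(** Homotopies parametrized by the whole line: they agree with those
    parametrized by the unit interval, and need no bookkeeping of domains. *)
Definition line_homotopic (X Y : topologicalType) (f g : X -> Y) : Prop :=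
  exists H : X * R -> Y,
    [/\ continuous H, forall x, H (x, 0) = f x & forall x, H (x, 1) = g x].

Definition clamp (s : R) : R := Num.max 0 (Num.min 1 s).

Lemma clamp_continuous : continuous clamp.
Proof.
apply: rcont_max; first exact: cont_cst.
by apply: rcont_min; [exact: cont_cst|exact: cont_id].
Qed.

Lemma clamp0 : clamp 0 = 0.
Proof. by rewrite /clamp min_r ?ler01// max_l. Qed.

Lemma clamp1 : clamp 1 = 1.
Proof. by rewrite /clamp min_l// max_r. Qed.

Lemma clamp_ge0 s : 0 <= clamp s.
Proof. by rewrite le_max lexx. Qed.

Lemma clamp_le1 s : clamp s <= 1.
Proof. by rewrite ge_max ler01 ge_min lexx. Qed.

Lemma homotopicP (X Y : topologicalType) (f g : X -> Y) :
  homotopic R f g <-> line_homotopic f g.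
Proof.
split=> [[H [Hc H0 H1]]|[H [Hc H0 H1]]]; last first.
  by exists H; split=> //; exact: continuous_subspaceT.
exists (fun xs => H (xs.1, clamp xs.2)); split=> [|x|x] /=.
- pose D : set (X * R) := [set: X] `*` `[0, 1].
  have inD (xs : X * R) : (xs.1, clamp xs.2) \in D.
    by apply/mem_set; split=> //=; rewrite in_itv /= clamp_ge0 clamp_le1.
  pose k xs : set_type D := exist (fun v => v \in D) _ (inD xs).
  have kc : continuous k.
    apply/continuousP => _ [U oU <-]; rewrite -comp_preimage; move: U oU.
    apply/continuousP; apply: cont_pair; first exact: cont_fst.
    exact: (cont_comp (@cont_snd _ _) clamp_continuous).
  have /subspace_sigL_continuousP HDc := Hc.
  exact: (cont_comp kc HDc).
- by rewrite clamp0.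
- by rewrite clamp1.
Qed.

Lemma line_homotopic_sym (X Y : topologicalType) (f g : X -> Y) :
  line_homotopic f g -> line_homotopic g f.
Proof.
move=> [H [Hc H0 H1]]; exists (fun xs => H (xs.1, 1 - xs.2)); split=> [|x|x] /=.
- apply: (cont_comp _ Hc); apply: cont_pair; first exact: cont_fst.
  by apply: rcontD; [exact: cont_cst|apply: rcontN; exact: cont_snd].
- by rewrite subr0.
- by rewrite subrr.
Qed.

Lemma concat_continuous (X Y : topologicalType) (H K : X * R -> Y) :
  continuous H -> continuous K -> (forall x, H (x, 1) = K (x, 0)) ->
  continuous (fun xs : X * R => if xs.2 <= 2^-1 then H (xs.1, 2 * xs.2)
                                else K (xs.1, 2 * xs.2 - 1)).
Proof.
move=> Hc Kc HK.
have c2 : continuous (fun xs : X * R => 2 * xs.2).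
  by apply: rcontM; [exact: cont_cst|exact: cont_snd].
apply: (@closed_pasting _ _ bool
  (fun b => if b then [set xs : X * R | xs.2 <= 2^-1]
            else [set xs : X * R | 2^-1 <= xs.2])
  (fun b xs => if b then H (xs.1, 2 * xs.2) else K (xs.1, 2 * xs.2 - 1))).
- by case; apply: closed_lef; [exact: cont_snd|exact: cont_cst|exact: cont_cst
    |exact: cont_snd].
- case; first by apply: (cont_comp _ Hc); apply: cont_pair => //; exact: cont_fst.
  apply: (cont_comp _ Kc); apply: cont_pair; first exact: cont_fst.
  by apply: rcontD => //; exact: cont_cst.
- by move=> xs; case: (leP xs.2 2^-1) => [le|/ltW le]; [exists true|exists false].
- case=> -[x s] /= le_s; first by rewrite le_s.
  case: ifPn => // s_le; have -> : s = 2^-1 by apply/le_anti/andP.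
  by rewrite mulfV ?pnatr_eq0// subrr HK.
Qed.

Lemma line_homotopic_trans (X Y : topologicalType) (f g h : X -> Y) :
  line_homotopic f g -> line_homotopic g h -> line_homotopic f h.
Proof.
move=> [H [Hc H0 H1]] [K [Kc K0 K1]].
exists (fun xs => if xs.2 <= 2^-1 then H (xs.1, 2 * xs.2)
                                else K (xs.1, 2 * xs.2 - 1)).
split=> [|x|x] /=.
- by apply: concat_continuous => // x; rewrite H1 K0.
- by rewrite invr_ge0 ler0n mulr0.
- rewrite ifN; last by rewrite -ltNge; lra.
  by rewrite mulr1 (_ : 2 - 1 = 1)// addrK.
Qed.

Lemma line_homotopic_compl (X Y Z : topologicalType) (f g : X -> Y) (h : Y -> Z) :
  continuous h -> line_homotopic f g -> line_homotopic (h \o f) (h \o g).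
Proof.
move=> hc [H [Hc H0 H1]]; exists (h \o H); split=> [|x|x] /=.
- exact: (cont_comp Hc hc).
- by rewrite H0.
- by rewrite H1.
Qed.

Lemma line_homotopic_compr (X Y Z : topologicalType) (f g : Y -> Z) (h : X -> Y) :
  continuous h -> line_homotopic f g -> line_homotopic (f \o h) (g \o h).
Proof.
move=> hc [H [Hc H0 H1]]; exists (fun xs => H (h xs.1, xs.2)); split=> [|x|x] //=.
apply: (cont_comp _ Hc); apply: cont_pair; last exact: cont_snd.
exact: (cont_comp (@cont_fst _ _) hc).
Qed.

Lemma equivalence_of_line_homotopies (X Y : topologicalType) (f : X -> Y) (g : Y -> X) :
  continuous f -> continuous g ->
  line_homotopic (g \o f) id -> line_homotopic (f \o g) id ->
  homotopy_equivalence R f.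
Proof.
by move=> fc gc gf fg; split=> //; exists g; split=> //; exact/homotopicP.
Qed.

Lemma equivalence_comp (X Y Z : topologicalType) (f : X -> Y) (g : Y -> Z) :
  homotopy_equivalence R f -> homotopy_equivalence R g ->
  homotopy_equivalence R (g \o f).
Proof.
move=> [fc [f' [f'c /homotopicP f'f /homotopicP ff']]].
move=> [gc [g' [g'c /homotopicP g'g /homotopicP gg']]].
apply: (@equivalence_of_line_homotopies _ _ _ (f' \o g')).
- exact: (cont_comp fc gc).
- exact: (cont_comp g'c f'c).
- apply: line_homotopic_trans f'f.
  exact: (line_homotopic_compl f'c (line_homotopic_compr fc g'g)).
- apply: line_homotopic_trans gg'.
  exact: (line_homotopic_compl gc (line_homotopic_compr g'c ff')).
Qed.

Lemma equivalence_cancel (X Y Z : topologicalType) (f : X -> Y) (g : Y -> Z) :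
  continuous f -> homotopy_equivalence R g -> homotopy_equivalence R (g \o f) ->
  homotopy_equivalence R f.
Proof.
move=> fc [gc [g' [g'c /homotopicP g'g /homotopicP gg']]].
move=> [gfc [k [kc /homotopicP kgf /homotopicP gfk]]].
apply: (@equivalence_of_line_homotopies _ _ _ (k \o g)) => //.
  exact: (cont_comp gc kc).
have fkgc : continuous (f \o (k \o g)) by exact: (cont_comp (cont_comp gc kc) fc).
apply: line_homotopic_trans (line_homotopic_sym (line_homotopic_compr fkgc g'g)) _.
apply: line_homotopic_trans g'g.
exact: (line_homotopic_compl g'c (line_homotopic_compr gc gfk)).
Qed.

End homotopies.

(** * Simplicial homotopies *)

Section simplicial_homotopy.
Context (R : realType).
Local Open Scope ring_scope.
Local Notation spx n := (set_type (@std_simplex R n)).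

Definition end0 m : simp (std_sset 1) m := delta_const m ord0.
Definition end1 m : simp (std_sset 1) m := delta_const m ord_max.

Lemma end0_act m n (d : delta m n) : sact d (end0 n) = end0 m.
Proof. exact: delta_ext. Qed.

Lemma end1_act m n (d : delta m n) : sact d (end1 n) = end1 m.
Proof. exact: delta_ext. Qed.

Lemma end01 m : end0 m <> end1 m.
Proof. by move=> /(congr1 (fun f : delta m 1 => val (f ord0))). Qed.

(** The second barycentric coordinate identifies the 1-simplex with the unit
    interval. *)
Definition height n (s : simp (std_sset 1) n) (t : spx n) : R :=
  wt (simplex_push s t) ord_max.

Lemma height_continuous n (s : simp (std_sset 1) n) : continuous (height s).
Proof. exact: (cont_comp (@push_continuous R _ _ s) (@wt_continuous R _ _)). Qed.

Lemma height_act m n (d : delta m n) (s : simp (std_sset 1) n) t :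
  height (sact d s) t = height s (simplex_push d t).
Proof. by rewrite /height push_comp. Qed.

Lemma wt_push_const m n (j i : 'I_n.+1) (t : spx m) :
  wt (simplex_push (delta_const m j) t) i = (j == i)%:R.
Proof.
rewrite wt_push /=; case: (j =P i) => ji; last by rewrite big_pred0.
by rewrite -[RHS](wt_sum t).
Qed.

Lemma height_end0 n (t : spx n) : height (end0 n) t = 0.
Proof. by rewrite /height wt_push_const. Qed.

Lemma height_end1 n (t : spx n) : height (end1 n) t = 1.
Proof. by rewrite /height wt_push_const eqxx. Qed.

Definition seg_wt (s : R) (i : 'I_2) : R :=
  if i == ord_max then clamp s else 1 - clamp s.

Lemma seg_wt_ge0 s i : 0 <= seg_wt s i.
Proof.
by rewrite /seg_wt; case: ifP => _; rewrite ?clamp_ge0// subr_ge0 clamp_le1.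
Qed.

Lemma seg_wt_sum s : \sum_i seg_wt s i = 1.
Proof. by rewrite !big_ord_recl big_ord0 /seg_wt /= addr0 subrK. Qed.

Definition seg (s : R) : spx 1 := mkspx (seg_wt_ge0 s) (seg_wt_sum s).

Lemma seg_continuous : continuous seg.
Proof.
apply: continuous_into_spx => i.
rewrite (_ : (fun _ => _) = fun s => seg_wt s i); last first.
  by apply/funext => s; rewrite wt_mkspx.
rewrite /seg_wt; case: (i == ord_max); first exact: clamp_continuous.
by apply: rcontD; [exact: cont_cst|apply: rcontN; exact: clamp_continuous].
Qed.

Lemma seg0 n (t : spx n) : seg 0 = simplex_push (end0 n) t.
Proof.
apply: spx_ext => i; rewrite wt_mkspx [RHS]wt_push_const /seg_wt clamp0 subr0.
by case: i => -[|[|]].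
Qed.

Lemma seg1 n (t : spx n) : seg 1 = simplex_push (end1 n) t.
Proof.
apply: spx_ext => i; rewrite wt_mkspx [RHS]wt_push_const /seg_wt clamp1 subrr.
by case: i => -[|[|]].
Qed.

Lemma std_rcell n (s : simp (std_sset 1) n) (t : spx n) :
  rcell (delta_id 1 : simp (std_sset 1) 1) (simplex_push s t) = rcell s t.
Proof. by rewrite -rcell_act /= delta_1comp. Qed.

Lemma interval_coupling (X : sset) (z : spx 1) (c : realization R X) :
  exists n (s : simp (std_sset 1) n) (x : simp X n) (t : spx n),
    z = simplex_push s t /\ c = rcell x t.
Proof.
have [q [y [w ->]]] := rcell_onto c.
have [a [b [u [<- <-]]]] := spx_coupling z w.
by exists (1 + q)%N, a, (sact b y), u; rewrite rcell_act.
Qed.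

(** Compose with [product_map].  The last clause serves for homotopies relative
    to [A]: on [A], only values of [G] on [A] occur. *)
Lemma cylinder_homotopy (X : sset) (Y : topologicalType)
    (G : realization R (prod_sset (std_sset 1) X) -> Y) : continuous G ->
  exists H : realization R X * R -> Y, [/\ continuous H,
    forall n (x : simp X n) t, H (rcell x t, 0) =
      G (rcell ((end0 n, x) : simp (prod_sset (std_sset 1) X) n) t),
    forall n (x : simp X n) t, H (rcell x t, 1) =
      G (rcell ((end1 n, x) : simp (prod_sset (std_sset 1) X) n) t) &
    forall (A : sset) (i : smap A X) (a : realization R A) s,
      exists n (e : simp (std_sset 1) n) (y : simp A n) t,
        a = rcell y t /\ H (realization_map i a, s) =
        G (rcell ((e, smapf i y) : simp (prod_sset (std_sset 1) X) n) t)].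
Proof.
move=> Gc; have [e [eE ec]] := product_map R (std_sset 1) X.
pose H (cs : realization R X * R) :=
  G (e (rcell (delta_id 1 : simp (std_sset 1) 1) (seg cs.2)) cs.1).
have HE n (x : simp X n) t s (d : simp (std_sset 1) n) :
    seg s = simplex_push d t ->
    H (rcell x t, s) = G (rcell ((d, x) : simp (prod_sset (std_sset 1) X) n) t).
  by move=> sE; rewrite /H /= sE std_rcell eE.
exists H; split=> [|n x t|n x t|A i a s].
- have ec1 := ec 1%N (delta_id 1 : simp (std_sset 1) 1).
  have sc := cont_comp (@cont_snd (realization R X) R) seg_continuous.
  exact: (cont_comp (cont_comp (cont_pair sc (@cont_fst _ _)) ec1) Gc).
- exact/HE/seg0.
- exact/HE/seg1.
- have [n [d [x [t [sE ->]]]]] := interval_coupling (seg s) a.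
  by exists n, d, x, t; split=> //; rewrite realization_mapE; exact: HE.
Qed.

Lemma simplicial_homotopy (X Z : sset) (f g : smap X Z)
    (h : smap (prod_sset (std_sset 1) X) Z) :
  (forall n (x : simp X n),
    smapf h ((end0 n, x) : simp (prod_sset (std_sset 1) X) n) = smapf f x) ->
  (forall n (x : simp X n),
    smapf h ((end1 n, x) : simp (prod_sset (std_sset 1) X) n) = smapf g x) ->
  line_homotopic R (@realization_map R _ _ f) (@realization_map R _ _ g).
Proof.
move=> h0 h1.
have [H [Hc H0 H1 _]] := cylinder_homotopy (@realization_map_continuous R _ _ h).
exists H; split=> // c; have [n [x [t ->]]] := rcell_onto c.
  by rewrite H0 !realization_mapE h0.
by rewrite H1 !realization_mapE h1.
Qed.

End simplicial_homotopy.

(** * Inclusions with the pushout-product extension property *)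

Section extension_property.
Context (R : realType).
Local Open Scope ring_scope.
Local Notation spx n := (set_type (@std_simplex R n)).

Definition pcell (K M : sset) n (k : simp K n) (x : simp M n) (t : spx n) :
  realization R (prod_sset K M) := rcell ((k, x) : simp (prod_sset K M) n) t.

Lemma pcell_act (K M : sset) m n (d : delta m n) (k : simp K n) (x : simp M n) t :
  pcell (sact d k) (sact d x) t = pcell k x (simplex_push d t).
Proof. by rewrite /pcell -rcell_act. Qed.

Lemma pcell_continuous (K M : sset) n (k : simp K n) (x : simp M n) :
  continuous (pcell k x).
Proof. exact: rcell_continuous. Qed.

(** Asking this for all pairs [(K, L)], rather than for a point and the empty set
    only, makes the property stable under the cell attachments of a diagonal.  It
    also includes the extension of homotopies, for the interval and its ends. *)
Definition pushout_extension (A X : sset) (i : smap A X) : Prop :=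
  forall (K : sset) (L : forall n, simp K n -> Prop) (hL : closed_pred L)
    (Y : topologicalType) (G : realization R (prod_sset K A) -> Y)
    (G' : realization R (prod_sset (sub_sset hL) X) -> Y),
  continuous G -> continuous G' ->
  (forall n (k : simp (sub_sset hL) n) (a : simp A n) t,
    G (pcell (proj1_sig k : simp K n) a t) = G' (pcell k (smapf i a) t)) ->
  exists F : realization R (prod_sset K X) -> Y, [/\ continuous F,
    forall n (k : simp K n) (a : simp A n) t,
      F (pcell k (smapf i a) t) = G (pcell k a t) &
    forall n (k : simp (sub_sset hL) n) (x : simp X n) t,
      F (pcell (proj1_sig k : simp K n) x t) = G' (pcell k x t)].

Definition strong_retract (A X : sset) (i : smap A X) : Prop :=
  exists (r : realization R X -> realization R A)
    (H : realization R X * R -> realization R X),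
  [/\ continuous r, continuous H, forall a, r (realization_map i a) = a &
    [/\ forall c, H (c, 0) = c,
        forall c, H (c, 1) = realization_map i (r c) &
        forall a s, H (realization_map i a, s) = realization_map i a]].

Section retract_of_equivalence.
Variables (A X : sset) (i : smap A X).
Hypothesis i_inj : forall n, injective (@smapf _ _ i n).
Local Notation ri := (@realization_map R _ _ i).

(** The homotopy extension property turns a homotopy left inverse of [i] into a
    left inverse. *)
Lemma equivalence_retraction : homotopy_equivalence R ri ->
  exists r : realization R X -> realization R A,
    [/\ continuous r, forall a, r (ri a) = a & line_homotopic R id (ri \o r)].
Proof.
move=> [ic [g [gc /homotopicP [al [alc al0 al1]] /homotopicP ig]]].
pose psi n (x : simp X n) (h : simp (sing R R (realization R A)) n) :=
  exists2 a, x = smapf i a & forall t s, proj1_sig h (t, s) = al (rcell a t, s).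
have [|||H [Hc H0 HA]] := @homotopy_extension R _ X g psi gc.
- move=> n x h h' [a xa ha] [a' xa' ha'].
  have aa' : a = a' by apply: i_inj; rewrite -xa -xa'.
  by apply/sig_ext/funext => -[t s]; rewrite ha ha' aa'.
- move=> m n d x h [a xa ha]; exists (sact d a); first by rewrite smap_act xa.
  by move=> t s /=; rewrite ha rcell_act.
- by move=> n x h t [a -> ha]; rewrite ha al0 /= realization_mapE.
have rc : continuous (fun c => H (c, 1)).
  by apply: (cont_comp _ Hc); apply: cont_pair; [exact: cont_id|exact: cont_cst].
exists (fun c => H (c, 1)); split=> // [a|].
  have [n [x [t ->]]] := rcell_onto a; rewrite realization_mapE.
  have cal : continuous (fun ts : spx n * R => al (rcell x ts.1, ts.2)).
    apply: (cont_comp _ alc); apply: cont_pair; last exact: cont_snd.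
    exact: (cont_comp (@cont_fst _ _) (@rcell_continuous R _ _ x)).
  rewrite (HA n (smapf i x) (exist _ _ cal)) /= ?al1//.
  by exists x.
apply: (line_homotopic_trans (line_homotopic_sym ig)).
apply: (@line_homotopic_compl _ _ _ _ g (fun c => H (c, 1)) ri ic).
by exists H; split.
Qed.

Definition tent (s : R) : R := Num.min (2 * s) (2 - 2 * s).

Lemma tent_continuous : continuous tent.
Proof.
have c2 : continuous (fun s : R => 2 * s).
  by apply: rcontM; [exact: cont_cst|exact: cont_id].
apply: rcont_min => //; apply: rcontD; first exact: cont_cst.
exact: rcontN.
Qed.

Lemma tent0 : tent 0 = 0.
Proof. by rewrite /tent mulr0 subr0 min_l. Qed.

Lemma tent1 : tent 1 = 0.
Proof. by rewrite /tent mulr1 subrr min_r. Qed.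

(** If [b] is a homotopy from the identity to [i r], following [b] and then
    [b] backwards along [i r] is another one, which on [A] runs through a loop
    and then through the inverse loop.  Contracting these loops to their base
    points is a homotopy relative to the ends, and it extends to [X]. *)
Lemma equivalence_strong_retract :
  homotopy_equivalence R ri -> strong_retract i.
Proof.
move=> ie; have ic : continuous ri by case: ie.
have [r [rc ri_id [b [bc b0 b1]]]] := equivalence_retraction ie.
pose H' (cs : realization R X * R) := if cs.2 <= 2^-1 then b (cs.1, 2 * cs.2)
  else b (ri (r cs.1), 1 - (2 * cs.2 - 1)).
have rirc : continuous (ri \o r) by exact: (cont_comp rc ic).
have H'c : continuous H'.
  apply: (@concat_continuous R _ _ b (fun cs => b (ri (r cs.1), 1 - cs.2))) => //.
    apply: (cont_comp _ bc); apply: cont_pair.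
      exact: (cont_comp (@cont_fst _ _) rirc).
    by apply: rcontD; [exact: cont_cst|apply: rcontN; exact: cont_snd].
  by move=> c /=; rewrite subr0 !b1 /= ri_id.
have H'0 c : H' (c, 0) = c by rewrite /H' /= invr_ge0 ler0n mulr0 b0.
have H'1 c : H' (c, 1) = ri (r c).
  rewrite /H' /= ifN; last by rewrite -ltNge; lra.
  by rewrite mulr1 (_ : 1 - (2 - 1) = 0)// ?b0//; lra.
have H'i a s : H' (ri a, s) = b (ri a, tent s).
  rewrite /H' /= ri_id /tent; case: leP => s2; congr (b (_, _)).
    by rewrite min_l//; lra.
  by rewrite min_r; lra.
have [||g0 [g0c g0E]] := @realization_family R (realization R X)
    (prod_sset (std_sset 1) X) (fun n sx t => H' (rcell sx.2 t, height sx.1 t)).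
- move=> n [s x] /=; apply: (cont_comp _ H'c); apply: cont_pair.
    exact: rcell_continuous.
  exact: height_continuous.
- by move=> m n d [s x] t /=; rewrite rcell_act height_act.
pose psi n (sx : simp (prod_sset (std_sset 1) X) n)
    (h : simp (sing R R (realization R X)) n) :=
  [\/ sx.1 = end0 n /\ (forall t u, proj1_sig h (t, u) = rcell sx.2 t),
      sx.1 = end1 n /\ (forall t u, proj1_sig h (t, u) = ri (r (rcell sx.2 t)))
    | exists2 a, sx.2 = smapf i a & forall t u, proj1_sig h (t, u) =
        b (ri (rcell a t), (1 - u) * tent (height sx.1 t))].
have psi_i n (s : simp (std_sset 1) n) (a : simp A n) (t : spx n) u :
    s = end0 n \/ s = end1 n ->
    b (ri (rcell a t), (1 - u) * tent (height s t)) = ri (rcell a t).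
  by case=> ->; rewrite ?height_end0 ?height_end1 ?tent0 ?tent1 mulr0 b0.
have [|||F [Fc F0 Fpsi]] := @homotopy_extension R _ _ g0 psi g0c.
- move=> n [s x] h h' /= ph ph'; apply/sig_ext/funext => -[t u].
  case: ph => [[se hE]|[se hE]|[a xa hE]]; case: ph' => [[se' hE']|[se' hE']|[a' xa' hE']];
    rewrite hE hE' //=.
  + by case: (@end01 n); rewrite -se -se'.
  + by move: xa' => /= ->; rewrite psi_i ?realization_mapE//; left.
  + by case: (@end01 n); rewrite -se -se'.
  + move: xa' => /= ->; rewrite psi_i ?realization_mapE//; last by right.
    by rewrite -realization_mapE ri_id.
  + by move: xa => /= ->; rewrite psi_i ?realization_mapE//; left.
  + move: xa => /= ->; rewrite psi_i ?realization_mapE//; last by right.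
    by rewrite -realization_mapE ri_id.
  + by have -> : a = a' by apply: i_inj; rewrite -xa -xa'.
- move=> m n d [s x] h /= [[/= -> hE]|[/= -> hE]|[a /= -> hE]].
  + constructor 1; split=> [|t u]; first exact: end0_act.
    by rewrite /= hE rcell_act.
  + constructor 2; split=> [|t u]; first exact: end1_act.
    by rewrite /= hE rcell_act.
  + constructor 3; exists (sact d a) => [|t u] /=; first by rewrite smap_act.
    by rewrite hE rcell_act height_act.
- move=> n [s x] h t /= [[/= -> hE]|[/= -> hE]|[a /= -> hE]]; rewrite hE g0E /=.
  + by rewrite height_end0 H'0.
  + by rewrite height_end1 H'1.
  + by rewrite -realization_mapE H'i subr0 mul1r.
have F1c : continuous (fun c => F (c, 1)).
  by apply: (cont_comp _ Fc); apply: cont_pair; [exact: cont_id|exact: cont_cst].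
have [H [Hc H0 H1 HS]] := cylinder_homotopy F1c.
have rcell1c (Z : sset) n (x : simp Z n) : continuous (fun tu : spx n * R => rcell x tu.1).
  exact: (cont_comp (@cont_fst _ _) (@rcell_continuous R _ _ x)).
exists r, H; split=> //; split=> [c|c|a s].
- have [n [x [t ->]]] := rcell_onto c; rewrite H0.
  rewrite (Fpsi _ _ (exist _ _ (rcell1c _ n x)))//=.
  by constructor 1.
- have [n [x [t ->]]] := rcell_onto c; rewrite H1.
  have c1 : continuous (fun tu : spx n * R => ri (r (rcell x tu.1))).
    exact: (cont_comp (rcell1c _ n x) rirc).
  rewrite (Fpsi _ _ (exist _ _ c1))//=.
  by constructor 2.
- have [n [e [y [t [-> ->]]]]] := HS _ i a s; rewrite realization_mapE.
  have ct : continuous (fun tu : spx n * R =>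
      b (ri (rcell y tu.1), (1 - tu.2) * tent (height e tu.1))).
    apply: (cont_comp _ bc); apply: cont_pair; first exact: (cont_comp (rcell1c _ n y) ic).
    apply: rcontM.
      by apply: rcontD; [exact: cont_cst|apply: rcontN; exact: cont_snd].
    have ht := cont_comp (@cont_fst (spx n) R) (@height_continuous R n e).
    exact: (cont_comp ht tent_continuous).
  rewrite (Fpsi _ _ (exist _ _ ct)) /=; last by constructor 3; exists y.
  by rewrite subrr mul0r b0 realization_mapE.
Qed.

(** Extend a homotopy which runs backwards: at its start, [G'] is precomposed
    with the retraction of [X] onto [A], where it is a restriction of [G]. *)
Lemma strong_retract_extension : strong_retract i -> pushout_extension i.
Proof.
move=> [r [H [rc Hc r_i [H0 H1 Hi]]]] K L hL Y G G' Gc G'c GG'.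
have [eA [eAE eAc]] := product_map R K A.
have [eL [eLE eLc]] := product_map R (sub_sset hL) X.
have ic : continuous ri by exact: realization_map_continuous.
have GG'e n (k : simp (sub_sset hL) n) t a :
    G' (eL (rcell k t) (ri a)) = G (eA (rcell (proj1_sig k : simp K n) t) a).
  have [m [l [y [u [kE ->]]]]] := common_cell (rcell k t) a.
  rewrite kE realization_mapE eLE.
  pose inc := @SMap (sub_sset hL) K (fun n k => proj1_sig k)
    (fun m n t x => erefl).
  have -> : rcell (proj1_sig k : simp K n) t = rcell (proj1_sig l : simp K m) u.
    by rewrite -[LHS](realization_mapE inc) kE realization_mapE.
  by rewrite eAE; exact/esym/GG'.
have [||g0 [g0c g0E]] := @realization_family R Y (prod_sset K X)
    (fun n kx t => G (eA (rcell kx.1 t) (r (rcell kx.2 t)))).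
- move=> n [k x] /=.
  have rx := cont_comp (@rcell_continuous R _ _ x) rc.
  exact: (cont_comp (cont_comp (cont_pair (@cont_id _) rx) (eAc n k)) Gc).
- by move=> m n d [k x] t /=; rewrite !rcell_act.
pose psi n (kx : simp (prod_sset K X) n) (h : simp (sing R R Y) n) :=
  (exists2 k : simp (sub_sset hL) n, proj1_sig k = kx.1 &
    forall t s, proj1_sig h (t, s) = G' (eL (rcell k t) (H (rcell kx.2 t, 1 - s))))
  \/ (exists2 a, kx.2 = smapf i a &
    forall t s, proj1_sig h (t, s) = G (pcell kx.1 a t)).
have [|||F [Fc F0 Fpsi]] := @homotopy_extension R _ _ g0 psi g0c.
- move=> n [k x] h h' ph ph'; apply/sig_ext/funext => -[t s].
  have both (l : simp (sub_sset hL) n) a : proj1_sig l = k -> x = smapf i a ->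
      G' (eL (rcell l t) (H (rcell x t, 1 - s))) = G (pcell k a t).
    by move=> <- ->; rewrite -realization_mapE Hi GG'e eAE.
  case: ph => [[l lk hE]|[a xa hE]]; case: ph' => [[l' lk' hE']|[a' xa' hE']];
    rewrite hE hE'.
  + by have -> : l = l' by apply: sig_ext; rewrite lk lk'.
  + exact: both.
  + by rewrite (both l' a).
  + by have -> : a = a' by apply: i_inj; rewrite -xa -xa'.
- move=> m n d [k x] h [[l /= lk hE]|[a /= xa hE]]; [left|right].
    exists (sact d l) => [|t s] /=; first by rewrite lk.
    by rewrite hE !rcell_act.
  exists (sact d a) => [|t s] /=; first by rewrite xa smap_act.
  by rewrite hE pcell_act.
- move=> n [k x] h t [[l /= <- hE]|[a /= -> hE]]; rewrite hE g0E /=.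
    by rewrite subr0 H1 GG'e.
  by rewrite -realization_mapE r_i eAE.
exists (fun c => F (c, 1)); split=> [|n k a t|n k x t].
- by apply: (cont_comp _ Fc); apply: cont_pair; [exact: cont_id|exact: cont_cst].
- have ct : continuous (fun tu : spx n * R => G (pcell k a tu.1)).
    exact: (cont_comp (cont_comp (@cont_fst _ _) (@pcell_continuous _ _ n k a)) Gc).
  rewrite (Fpsi _ _ (exist _ _ ct))//.
  by right; exists a.
- have ct : continuous (fun tu : spx n * R =>
      G' (eL (rcell k tu.1) (H (rcell x tu.1, 1 - tu.2)))).
    apply: (cont_comp _ G'c).
    have s1 : continuous (fun tu : spx n * R => 1 - tu.2).
      by apply: rcontD; [exact: cont_cst|apply: rcontN; exact: cont_snd].
    have x1 := cont_comp (@cont_fst (spx n) R) (@rcell_continuous R _ _ x).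
    exact: (cont_comp (cont_pair (@cont_fst _ _) (cont_comp (cont_pair x1 s1) Hc))
      (eLc n k)).
  rewrite (Fpsi _ _ (exist _ _ ct)) /=; last by left; exists k.
  by rewrite subrr H0 eLE.
Qed.

End retract_of_equivalence.

Lemma void_closed (K : sset) : @closed_pred K (fun _ _ => False).
Proof. by []. Qed.

Lemma ends_closed : @closed_pred (std_sset 1) (fun n s => s = end0 n \/ s = end1 n).
Proof.
move=> m n d s [->|->]; [left; exact: end0_act|right; exact: end1_act].
Qed.

(** A point and the empty set give a retraction; the interval and its ends give a
    homotopy from the identity to it. *)
Lemma pushout_extension_equivalence (A X : sset) (i : smap A X) :
  pushout_extension i -> homotopy_equivalence R (@realization_map R _ _ i).
Proof.
move=> ext; set ri := realization_map i.
have ic : continuous ri by exact: realization_map_continuous.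
pose pt n : simp (std_sset 0) n := delta_const n ord0.
have [r [rc r_i]] : exists r : realization R X -> realization R A,
    continuous r /\ forall a, r (ri a) = a.
  have [||G0 [G0c _]] := @realization_family R (realization R A)
      (prod_sset (sub_sset (@void_closed (std_sset 0))) X)
      (fun n kx t => False_rect _ (proj2_sig kx.1)).
  - by move=> n [[]].
  - by move=> m n d [[]].
  pose pr := @SMap (prod_sset (std_sset 0) A) A (fun n kx => kx.2)
    (fun m n t x => erefl).
  have [|n [k []]|F [Fc FA _]] := ext _ _ (@void_closed (std_sset 0)) _
    (@realization_map R _ _ pr) G0 _ G0c; first exact: realization_map_continuous.
  have pt_act m n (d : delta m n) : pt m = sact d (pt n) by exact: delta_ext.
  pose ptX := @SMap X (prod_sset (std_sset 0) X) (fun n x => (pt n, x))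
    (fun m n t x => congr1 (fun k => (k, sact t x)) (pt_act m n t)).
  exists (F \o @realization_map R _ _ ptX); split=> [|c] /=.
    exact: (cont_comp (@realization_map_continuous R _ _ ptX) Fc).
  have [n [a [t ->]]] := rcell_onto c.
  rewrite /ri (realization_mapE i) (realization_mapE ptX).
  by rewrite [LHS](FA n (pt n) a t) /pcell realization_mapE.
pose G := @realization_map R _ _ (@SMap (prod_sset (std_sset 1) A) X
  (fun n sa => smapf i sa.2) (fun m n d sa => smap_act i d sa.2)).
have Gc : continuous G by exact: realization_map_continuous.
have end0P m n (d : delta m n) (k : simp (sub_sset ends_closed) n) :
    (proj1_sig (sact d k) = end0 m) <-> (proj1_sig k = end0 n).
  split=> /= [dk|->]; last exact: end0_act.
  case: (proj2_sig k) => // ke; move: dk; rewrite ke => /esym.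
  by rewrite [RHS](_ : _ = end1 m); [move/end01|exact: end1_act].
have rirc : continuous (ri \o r) by exact: (cont_comp rc ic).
have [||G' [G'c G'E]] := @realization_family R (realization R X)
    (prod_sset (sub_sset ends_closed) X) (fun n kx t =>
      if `[< proj1_sig kx.1 = end0 n >] then rcell kx.2 t
      else ri (r (rcell kx.2 t))).
- move=> n [k x] /=; case: asboolP => _; first exact: rcell_continuous.
  exact: (cont_comp (@rcell_continuous R _ _ x) rirc).
- move=> m n d [k x] t /=; rewrite rcell_act.
  by rewrite (asbool_equiv_eq (end0P m n d k)).
have [n k a t|F [Fc _ FL]] := ext _ _ ends_closed _ G G' Gc G'c.
  rewrite [RHS]G'E /G /pcell realization_mapE /= -realization_mapE r_i.
  by case: ifP.
have [H [Hc H0 H1 _]] := cylinder_homotopy Fc.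
have rir : line_homotopic R id (ri \o r).
  exists H; split=> // c; have [n [x [t ->]]] := rcell_onto c.
    rewrite H0; have := FL n (exist _ (end0 n) (or_introl erefl)) x t.
    by rewrite [in RHS]/pcell G'E /= asboolT.
  rewrite H1; have := FL n (exist _ (end1 n) (or_intror erefl)) x t.
  rewrite [in RHS]/pcell G'E /= asboolF//.
  by move/esym; exact: end01.
apply: (equivalence_of_line_homotopies ic rc _ (line_homotopic_sym rir)).
by exists (fun cs => cs.1); split=> // [|a]; [exact: cont_fst|rewrite /= r_i].
Qed.

End extension_property.

(** * Bisimplicial sets fibred over a simplicial set *)

Record bisset_over (N : sset) := BissetOver {
  over_tot :> bisset;
  over_proj : forall m n, bsimp over_tot m n -> simp N n;
  over_proj_act : forall m' m n' n (s : delta m' m) (t : delta n' n)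
    (x : bsimp over_tot m n), over_proj (bact s t x) = sact t (over_proj x) }.

Section fibres.
Variables (N : sset).

Section fibre.
Variables (X : bisset_over N) (n : nat) (sg : simp N n).

Definition over_fibre_act m' m (s : delta m' m) (x : {x : bsimp X m n | over_proj x = sg}) :
  {x : bsimp X m' n | over_proj x = sg}.
Proof.
exists (bact s (delta_id n) (proj1_sig x)).
by rewrite over_proj_act sact_id; exact: (proj2_sig x).
Defined.

Lemma over_fibre_act_id m (x : {x : bsimp X m n | over_proj x = sg}) :
  over_fibre_act (delta_id m) x = x.
Proof. by apply: sig_ext; exact: bact_id. Qed.

Lemma over_fibre_act_comp l m k (g : delta m k) (f : delta l m)
    (x : {x : bsimp X k n | over_proj x = sg}) :
  over_fibre_act (delta_comp g f) x = over_fibre_act f (over_fibre_act g x).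
Proof.
apply: sig_ext => /=; rewrite -[X in bact _ X _](delta_comp1 (delta_id n)).
exact: bact_comp.
Qed.

Definition over_fibre : sset := SSet over_fibre_act_id over_fibre_act_comp.

End fibre.

Variables (X X' : bisset_over N) (f : bimap X X').
Hypothesis f_over : forall m n (x : bsimp X m n), over_proj (bimapf f x) = over_proj x.

Definition over_fibre_fun n (sg : simp N n) m (x : simp (over_fibre X sg) m) :
  simp (over_fibre X' sg) m :=
  exist _ (bimapf f (proj1_sig x)) (etrans (f_over (proj1_sig x)) (proj2_sig x)).

Lemma over_fibre_fun_act n (sg : simp N n) m m' (s : delta m m')
    (x : simp (over_fibre X sg) m') : over_fibre_fun (sact s x) = sact s (over_fibre_fun x).
Proof. by apply: sig_ext; exact: bimap_act. Qed.

Definition over_fibre_map n (sg : simp N n) : smap (over_fibre X sg) (over_fibre X' sg) :=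
  SMap (@over_fibre_fun_act n sg).

End fibres.

(** The condition for [X] to be built, in the direction of the base, by attaching
    products of simplices with whole fibres. *)
Definition degeneracies_bijective (N : sset) (X : bisset_over N) : Prop :=
  forall m n' n (t : delta n' n) (sg : simp N n) (y : bsimp X m n'),
  onto t -> over_proj y = sact t sg ->
  exists! x : bsimp X m n, over_proj x = sg /\ bact (delta_id m) t x = y.

Lemma bact_exchange (X : bisset) m m' n k (s : delta m' m) (d : delta k n)
    (e : delta m' k) (x : bsimp X m n) :
  bact (delta_id m') (delta_comp d e) (bact s (delta_id n) x) =
  bact s e (bact (delta_id m) d x).
Proof.
rewrite -!bact_comp; congr (bact _ _ x); first exact: delta_ext.
exact: delta_ext.
Qed.

Section diagonal_extension.
Context (R : realType).
Local Notation spx n := (set_type (@std_simplex R n)).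
Variables (N : sset) (A X : bisset_over N) (i : bimap A X).
Hypothesis i_over : forall m n (a : bsimp A m n), over_proj (bimapf i a) = over_proj a.
Hypotheses (degA : degeneracies_bijective A) (degX : degeneracies_bijective X).
Hypothesis fib_ext : forall n (sg : simp N n),
  pushout_extension R (over_fibre_map i_over sg).

Local Notation dA := (diagonal_sset A).
Local Notation dX := (diagonal_sset X).

Section extend.
Variables (K : sset) (L : forall n, simp K n -> Prop) (hL : closed_pred L).
Variables (Y : topologicalType) (G : realization R (prod_sset K dA) -> Y).
Variable G' : realization R (prod_sset (sub_sset hL) dX) -> Y.
Hypotheses (Gc : continuous G) (G'c : continuous G').
Hypothesis GG' : forall n (k : simp (sub_sset hL) n) (a : simp dA n) t,
  G (pcell (proj1_sig k : simp K n) a t) =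
  G' (pcell k (smapf (diagonal_map i) a) t).

(** An [n]-simplex of [values] over [sg] records the values of a map on the part
    of the diagonal lying over the faces and degeneracies of [sg].  Graphs of
    functions are used so that nothing has to be said about simplices that do
    not lie over [sg]. *)
Definition values_simp (n : nat) : Type :=
  forall m, simp K m -> delta m n -> bsimp X m m -> spx m -> Y -> Prop.

Definition values_act n' n (e : delta n' n) (tau : values_simp n) :
  values_simp n' := fun m k d y t v => tau m k (delta_comp e d) y t v.

Lemma values_ext n (tau tau' : values_simp n) :
  (forall m k d y t v, tau m k d y t v <-> tau' m k d y t v) -> tau = tau'.
Proof.
move=> tt'; do 5 (apply: functional_extensionality_dep => ?).
by apply/funext => v; apply/propext.
Qed.

Lemma values_act_id n (tau : values_simp n) : values_act (delta_id n) tau = tau.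
Proof. by apply: values_ext => *; rewrite /values_act delta_1comp. Qed.

Lemma values_act_comp l m n (g : delta m n) (f : delta l m) (tau : values_simp n) :
  values_act (delta_comp g f) tau = values_act f (values_act g tau).
Proof. by apply: values_ext => *; rewrite /values_act delta_compA. Qed.

Definition values : sset := SSet values_act_id values_act_comp.

(** Over [sg], the relation [tau] is the graph of a compatible family of continuous
    functions, which extends [G] and [G']. *)
Definition valid n (sg : simp N n) (tau : simp values n) : Prop :=
  forall m (k : simp K m) (d : delta m n) (y : bsimp X m m), over_proj y = sact d sg ->
  [/\ exists g : spx m -> Y, continuous g /\ forall t v, tau m k d y t v <-> v = g t,
      forall m' (e : delta m' m) t v,
        tau m' (sact e k) (delta_comp d e) (bact e e y) t v <->
        tau m k d y (simplex_push e t) v,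
      forall a t v, y = bimapf i a -> tau m k d y t v -> v = G (pcell k (a : simp dA m) t) &
      forall (l : simp (sub_sset hL) m) t v, proj1_sig l = k -> tau m k d y t v ->
        v = G' (pcell l (y : simp dX m) t)].

Lemma valid_act n' n (e : delta n' n) (sg : simp N n) (tau : simp values n) :
  valid sg tau -> valid (sact e sg) (sact e tau).
Proof.
move=> vt m k d y yd; have yd' : over_proj y = sact (delta_comp e d) sg.
  by rewrite yd sact_comp.
have [v1 v2 v3 v4] := vt m k _ y yd'.
split=> // m' e' t v.
by rewrite /= /values_act delta_compA; exact: v2.
Qed.

Section fill.
Variables (n : nat) (sg : simp N n) (b : smap (boundary n) values).
Hypothesis b_valid : forall m (d : simp (boundary n) m),
  valid (sact (proj1_sig d : delta m n) sg) (smapf b d).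

Let K2 := prod_sset K (std_sset n).

Lemma L2_closed : @closed_pred K2 (fun m kd => L kd.1 \/ ~ onto (kd.2 : delta m n)).
Proof.
move=> m' m e [k d] /= [lk|nd]; [left; exact: hL|right].
by move=> /onto_comp.
Qed.

Definition fib_cell m (d : delta m n) (x : simp (over_fibre X sg) m) : bsimp X m m :=
  bact (delta_id m) d (proj1_sig x).

Lemma over_proj_fib_cell m (d : delta m n) x : over_proj (@fib_cell m d x) = sact d sg.
Proof. by rewrite over_proj_act (proj2_sig x). Qed.

Lemma fib_cell_act m' m (e : delta m' m) (d : delta m n) x :
  fib_cell (delta_comp d e) (sact e x) = bact e e (fib_cell d x).
Proof. exact: bact_exchange. Qed.

(** The values prescribed before the cell of [sg] is filled: those of [b] on the
    boundary, and those of [G'] over [L]. *)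
Definition fill_spec m (kd : simp (sub_sset L2_closed) m) (x : simp (over_fibre X sg) m)
    (g : spx m -> Y) : Prop :=
  let k := (proj1_sig kd).1 in let d := (proj1_sig kd).2 in
  [/\ continuous g,
      forall (nd : ~ onto (d : delta m n)) t v,
        smapf b (nonto_face nd) m k (delta_id m) (fib_cell d x) t v <-> v = g t &
      forall (l : simp (sub_sset hL) m), proj1_sig l = k ->
        forall t, g t = G' (pcell l (fib_cell d x : simp dX m) t)].

Lemma fib_cell_over m (d : delta m n) x :
  over_proj (fib_cell d x) = sact (delta_id m) (sact d sg).
Proof. by rewrite sact_id over_proj_fib_cell. Qed.

Lemma fill_exists m (kd : simp (sub_sset L2_closed) m) x :
  exists g, fill_spec kd x g.
Proof.
case: kd => -[k d] kdL; rewrite /fill_spec /=.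
have [dS|nd] := pselect (onto (d : delta m n)).
  have lk : L k by case: kdL.
  exists (fun t => G' (pcell (exist _ k lk : simp (sub_sset hL) m)
    (fib_cell d x : simp dX m) t)); split=> // [|l lE t].
    exact: (cont_comp (@pcell_continuous _ _ _ _ _ _) G'c).
  by congr (G' (pcell _ _ t)); apply: sig_ext.
have [[g [gc gE]] _ _ v4] :=
  @b_valid m (nonto_face nd) m k (delta_id m) _ (@fib_cell_over m d x).
exists g; split=> // [nd' t v|l lk t].
  by rewrite (Prop_irrelevance nd' nd).
by apply: (v4 l t) => //; exact/gE.
Qed.

Definition fill_val m (kd : simp (sub_sset L2_closed) m) x : spx m -> Y :=
  projT1 (cid (fill_exists kd x)).

Lemma fill_valP m (kd : simp (sub_sset L2_closed) m) x :
  fill_spec kd x (fill_val kd x).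
Proof. exact: (projT2 (cid (fill_exists kd x))). Qed.

Lemma fill_val_act m' m (e : delta m' m) (kd : simp (sub_sset L2_closed) m) x t :
  fill_val (sact e kd) (sact e x) t = fill_val kd x (simplex_push e t).
Proof.
have [_ f2 f3] := fill_valP kd x; have [_ f2' f3'] := fill_valP (sact e kd) (sact e x).
pose k := (proj1_sig kd).1; pose d : delta m n := (proj1_sig kd).2.
have [dS|nd] := pselect (onto (d : delta m n)).
  have lk : L k by case: (proj2_sig kd).
  pose l : simp (sub_sset hL) m := exist _ k lk.
  rewrite (f3 l erefl) (f3' (sact e l) erefl) fib_cell_act.
  by rewrite -pcell_act.
have nde : ~ onto (delta_comp d e) by move=> /onto_comp.
apply/esym/(f2' nde); rewrite fib_cell_act.
have -> : nonto_face nde = sact e (nonto_face nd) by exact: sig_ext.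
rewrite smap_act /= /values_act.
have [_ v2 _ _] := @b_valid m (nonto_face nd) m k (delta_id m) _ (@fib_cell_over m d x).
have := v2 _ e t (fill_val kd x (simplex_push e t)).
rewrite delta_1comp delta_comp1 => ->.
exact/f2.
Qed.

Definition fib_diag_map : smap (prod_sset K2 (over_fibre A sg)) (prod_sset K dA).
Proof.
exists (fun m kda => (kda.1.1, bact (delta_id m) kda.1.2 (proj1_sig kda.2))).
by move=> m' m e [[k d] a]; congr pair; exact: bact_exchange.
Defined.

(** The extension property of the fibre over [sg], for the product of [K] with a
    simplex and the union of [L] times the simplex and [K] times its boundary. *)
Lemma fill_map : exists F : realization R (prod_sset K2 (over_fibre X sg)) -> Y,
  [/\ continuous F,
      forall m (k : simp K m) (d : delta m n) (a : simp (over_fibre A sg) m) t,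
        F (pcell ((k, d) : simp K2 m) (smapf (over_fibre_map i_over sg) a) t) =
        G (pcell k (bact (delta_id m) d (proj1_sig a) : simp dA m) t) &
      forall m (kd : simp (sub_sset L2_closed) m) (x : simp (over_fibre X sg) m) t,
        F (pcell (proj1_sig kd : simp K2 m) x t) = fill_val kd x t].
Proof.
have [||G2' [G2'c G2'E]] := @realization_family R Y
    (prod_sset (sub_sset L2_closed) (over_fibre X sg))
    (fun m kdx t => fill_val kdx.1 kdx.2 t).
- by move=> m [kd x] /=; have [] := fill_valP kd x.
- by move=> m' m e [kd x] t; exact: fill_val_act.
pose G2 := G \o @realization_map R _ _ fib_diag_map.
have G2c : continuous G2 by exact: (cont_comp (@realization_map_continuous R _ _ _) Gc).
have [m kd a t|F [Fc FA FL]] := fib_ext G2c G2'c.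
  rewrite [RHS]G2'E /G2 /pcell /= realization_mapE.
  have [gc f2 f3] := fill_valP kd (smapf (over_fibre_map i_over sg) a).
  pose k := (proj1_sig kd).1; pose d : delta m n := (proj1_sig kd).2.
  have yE : fib_cell d (over_fibre_fun i_over a) =
      bimapf i (bact (delta_id m) d (proj1_sig a)) by rewrite bimap_act.
  have [dS|nd] := pselect (onto (d : delta m n)).
    have lk : L k by case: (proj2_sig kd).
    rewrite (f3 (exist _ k lk) erefl) yE.
    exact: (@GG' m (exist _ k lk)).
  have [_ _ v3 _] := @b_valid m (nonto_face nd) m k (delta_id m) _
    (@fib_cell_over m d (over_fibre_fun i_over a)).
  by apply/esym/(v3 _ t _ yE); exact/f2.
exists F; split=> // [m k d a t|m kd x t].
  by rewrite FA /G2 /= /pcell realization_mapE.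
by rewrite FL [LHS]G2'E.
Qed.

(** On degeneracies of [sg] the value at [y] is that of [fill_map] at the simplex
    of the fibre of which [y] is the degeneracy; this simplex is unique. *)
Lemma fill : exists tau, valid sg tau /\ forall m (d : simp (boundary n) m),
  sact (proj1_sig d : delta m n) tau = smapf b d.
Proof.
have [F [Fc FA FL]] := fill_map.
pose tau : simp values n := fun m k d y t v =>
  (exists nd : ~ onto d, smapf b (nonto_face nd) m k (delta_id m) y t v) \/
  (onto d /\ exists2 x : simp (over_fibre X sg) m, y = fib_cell d x &
     v = F (pcell ((k, d) : simp K2 m) x t)).
have tau_nonto m (k : simp K m) (d : delta m n) (nd : ~ onto d) y t v :
    tau m k d y t v <-> smapf b (nonto_face nd) m k (delta_id m) y t v.
  split=> [[[nd']|[]//]|]; first by rewrite (Prop_irrelevance nd' nd).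
  by left; exists nd.
have lift m (d : delta m n) y : onto d -> over_proj y = sact d sg ->
    exists x : simp (over_fibre X sg) m, y = fib_cell d x.
  move=> d_onto yd; have [x [[xs xy] _]] := degX d_onto yd.
  by exists (exist _ x xs).
have tauE m (k : simp K m) (d : delta m n) x t v :
    tau m k d (fib_cell d x) t v <-> v = F (pcell ((k, d) : simp K2 m) x t).
  have [dS|nd] := pselect (onto d).
    split=> [[[]//|[_ [x' xx' ->]]]|->]; last by right; split=> //; exists x.
    have [z [_ zu]] := degX dS (over_proj_fib_cell d x).
    congr (F (pcell _ _ t)); apply: sig_ext.
    rewrite -(zu (proj1_sig x')); last by split; [exact: (proj2_sig x')|].
    by rewrite -(zu (proj1_sig x)); last by split; [exact: (proj2_sig x)|].
  rewrite tau_nonto.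
  have kdL : L k \/ ~ onto (d : delta m n) by right.
  have [_ f2 _] := fill_valP (exist _ (k, d) kdL) x.
  by apply: iff_trans (f2 nd t v) _; rewrite -FL; split.
exists tau; split; last first.
  move=> m [e ne]; apply: values_ext => l k d y t v.
  have ned : ~ onto (delta_comp e d) by move=> /onto_comp.
  have bE : smapf b (nonto_face ned) l k (delta_id l) y t v =
      smapf b (exist _ e ne : simp (boundary n) m) l k d y t v.
    have -> : nonto_face ned = sact d (exist _ e ne : simp (boundary n) m).
      exact: sig_ext.
    by rewrite smap_act /= /values_act delta_comp1.
  by rewrite -bE; exact: tau_nonto.
move=> m k d y yd; have [dS|nd] := pselect (onto d); last first.
  have yd' : over_proj y = sact (delta_id m) (sact d sg) by rewrite sact_id.
  have [[g [gc gE]] v2 v3 v4] := @b_valid m (nonto_face nd) m k (delta_id m) _ yd'.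
  split=> [|m' e t v|a t v ya /tau_nonto|l t v lk /tau_nonto].
  - by exists g; split=> // t v; exact: iff_trans (tau_nonto _ _ _ nd _ _ _) (gE t v).
  - have nde : ~ onto (delta_comp d e) by move=> /onto_comp.
    apply: iff_trans (tau_nonto _ _ _ nde _ _ _) _.
    apply: iff_trans _ (iff_sym (tau_nonto _ _ _ nd _ _ _)).
    apply: iff_trans _ (v2 _ e t v).
    have -> : nonto_face nde = sact e (nonto_face nd) by exact: sig_ext.
    by rewrite smap_act /= /values_act delta_1comp delta_comp1.
  - by move=> /(_ nd); exact: v3.
  - by move=> /(_ nd); exact: v4.
have [x yE] := lift _ _ _ dS yd; subst y.
split=> [|m' e t v|a t v ya /tauE ->|l t v lk /tauE ->].
- exists (fun t => F (pcell ((k, d) : simp K2 m) x t)); split=> [|t v]; last exact: tauE.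
  exact: (cont_comp (@pcell_continuous _ _ _ _ _ _) Fc).
- by rewrite -fib_cell_act !tauE -pcell_act.
- have ad : over_proj a = sact d sg by rewrite -i_over -ya.
  have [a' [[a's a'a] _]] := degA dS ad.
  rewrite -a'a -(FA _ _ _ (exist _ a' a's : simp (over_fibre A sg) m)).
  have [z [_ zu]] := degX dS yd.
  congr (F (pcell _ _ t)); apply: sig_ext => /=.
  rewrite -(zu (proj1_sig x)); last by split; [exact: (proj2_sig x)|].
  rewrite -(zu (bimapf i a'))//; split; first by rewrite i_over.
  by rewrite -bimap_act a'a.
- have kdL : L k \/ ~ onto (d : delta m n) by left; rewrite -lk; exact: (proj2_sig l).
  rewrite [LHS](FL _ (exist _ (k, d) kdL)).
  have [_ _ f3] := fill_valP (exist _ (k, d) kdL) x.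
  exact: f3.
Qed.

End fill.

Lemma diagonal_extends : exists F : realization R (prod_sset K dX) -> Y,
  [/\ continuous F,
      forall n (k : simp K n) (a : simp dA n) t,
        F (pcell k (smapf (diagonal_map i) a) t) = G (pcell k a t) &
      forall n (k : simp (sub_sset hL) n) (x : simp dX n) t,
        F (pcell (proj1_sig k : simp K n) x t) = G' (pcell k x t)].
Proof.
have [|s s_valid] := section_principle _ (@fill).
  by move=> m n d sg tau _; exact: valid_act.
pose tau n (y : bsimp X n n) : simp values n := smapf s (over_proj y).
have y_id n (y : bsimp X n n) : over_proj y = sact (delta_id n) (over_proj y).
  by rewrite sact_id.
have tauP n (k : simp K n) (y : bsimp X n n) := s_valid n (over_proj y) n k _ y (y_id n y).
have ex n (k : simp K n) (y : bsimp X n n) : exists g : spx n -> Y, continuous g /\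
    forall t v, tau n y n k (delta_id n) y t v <-> v = g t.
  by have [] := tauP n k y.
pose g n (k : simp K n) y := projT1 (cid (ex n k y)).
have gc n (k : simp K n) y : continuous (g n k y) := (projT2 (cid (ex n k y))).1.
have gE n (k : simp K n) y t v :
    tau n y n k (delta_id n) y t v <-> v = g n k y t :=
  (projT2 (cid (ex n k y))).2 t v.
have [||F [Fc FE]] := @realization_family R Y (prod_sset K dX)
    (fun n ky t => g n ky.1 ky.2 t).
- by move=> n [k y]; exact: gc.
- move=> m n d [k y] t /=; apply/esym/gE.
  have [_ v2 _ _] := tauP n k y.
  have := v2 m d t (g n k y (simplex_push d t)).
  rewrite delta_1comp /tau over_proj_act smap_act /= /values_act delta_comp1 => ->.
  exact/gE.
exists F; split=> // [n k a t|n k x t].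
- rewrite [LHS]FE /=; have [_ _ v3 _] := tauP n k (bimapf i a).
  by apply: (v3 a t) => //; exact/gE.
- rewrite [LHS]FE /=; have [_ _ _ v4] := tauP n (proj1_sig k) x.
  by apply: (v4 k t) => //; exact/gE.
Qed.

End extend.

(** A map on the diagonal is a section over [N] of [values], and [fill] provides
    the fillers for the section principle. *)
Theorem diagonal_pushout_extension : pushout_extension R (diagonal_map i).
Proof.
by move=> K L hL Y G G' Gc G'c GG'; exact: diagonal_extends.
Qed.

End diagonal_extension.

(** * Mapping cylinders *)

Lemma realization_map_comp (R : realType) (X Y Z : sset) (f : smap X Y)
    (g : smap Y Z) (h : smap X Z) :
  (forall n (x : simp X n), smapf h x = smapf g (smapf f x)) ->
  @realization_map R _ _ h = realization_map g \o realization_map f.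
Proof.
move=> hE; apply/funext => c; have [n [x [t ->]]] := rcell_onto c.
by rewrite /= (realization_mapE h) (realization_mapE f) realization_mapE hE.
Qed.

Lemma simplicial_deformation (R : realType) (Z W : sset) (r : smap Z W)
    (j : smap W Z) (h : smap (prod_sset (std_sset 1) Z) Z) :
  (forall n (w : simp W n), smapf r (smapf j w) = w) ->
  (forall n (z : simp Z n),
    smapf h ((end0 n, z) : simp (prod_sset (std_sset 1) Z) n) = z) ->
  (forall n (z : simp Z n), smapf h ((end1 n, z) : simp (prod_sset (std_sset 1) Z) n)
     = smapf j (smapf r z)) ->
  homotopy_equivalence R (@realization_map R _ _ r).
Proof.
move=> rj h0 h1; pose idm (X : sset) := @SMap X X (fun _ x => x) (fun _ _ _ _ => erefl).
pose jr := @SMap Z Z (fun n z => smapf j (smapf r z))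
  (fun m n t z => etrans (congr1 (@smapf _ _ j m) (smap_act r t z))
     (smap_act j t (smapf r z))).
have idE (X : sset) : @realization_map R _ _ (idm X) = id.
  apply/funext => c; have [n [x [t ->]]] := rcell_onto c.
  by rewrite realization_mapE.
have jrE : @realization_map R _ _ jr = realization_map j \o realization_map r.
  exact: realization_map_comp.
have rjE : @realization_map R _ _ r \o @realization_map R _ _ j = id.
  transitivity (@realization_map R _ _ (idm W)); last exact: idE.
  by apply/esym/realization_map_comp => n w; rewrite rj.
apply: (@equivalence_of_line_homotopies _ _ _ _ (realization_map j)).
- exact: realization_map_continuous.
- exact: realization_map_continuous.
- apply: line_homotopic_sym; rewrite -jrE.
  have := @simplicial_homotopy R Z Z (idm Z) jr h h0 h1.
  by rewrite idE.
- rewrite rjE; exists (fun cs => cs.1); split=> //; exact: cont_fst.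
Qed.

Section cylinder.
Variables (N : sset) (X X' : bisset_over N) (f : bimap X X').
Hypothesis f_over : forall m n (x : bsimp X m n), over_proj (bimapf f x) = over_proj x.

(** A simplex of the cylinder with first component [h] lies at the end of the
    target once [h] takes the value 1 at its first vertex, that is everywhere. *)
Definition cyl_simp m n : Type :=
  ({h : delta m 1 | h ord0 = ord0} * bsimp X m n) + bsimp X' m n.

Definition cyl_mk m n (h : delta m 1) (x : bsimp X m n) : cyl_simp m n :=
  if pselect (h ord0 = ord0) is left e then inl (exist _ h e, x)
  else inr (bimapf f x).

Definition cyl_act m' m n' n (s : delta m' m) (t : delta n' n)
    (c : cyl_simp m n) : cyl_simp m' n' :=
  match c with
  | inl (h, x) => cyl_mk (delta_comp (proj1_sig h) s) (bact s t x)
  | inr x' => inr (bact s t x')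
  end.

Lemma cyl_mk_inl m n (h : delta m 1) (e : h ord0 = ord0) (x : bsimp X m n) :
  cyl_mk h x = inl (exist _ h e, x).
Proof.
rewrite /cyl_mk; case: pselect => // e'.
by rewrite (Prop_irrelevance e' e).
Qed.

Lemma cyl_mk_inr m n (h : delta m 1) (x : bsimp X m n) :
  h ord0 <> ord0 -> cyl_mk h x = inr (bimapf f x).
Proof. by rewrite /cyl_mk; case: pselect. Qed.

Lemma delta1_up m m' (h : delta m 1) (s : delta m' m) :
  h ord0 <> ord0 -> delta_comp h s ord0 <> ord0.
Proof.
move=> h0 hs; apply: h0; apply/le_anti/andP; split; last by rewrite leEord.
by rewrite -[leRHS]hs; apply: omorph_le; rewrite leEord.
Qed.

Lemma cyl_mk_act m' m n' n (s : delta m' m) (t : delta n' n) h (x : bsimp X m n) :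
  cyl_act s t (cyl_mk h x) = cyl_mk (delta_comp h s) (bact s t x).
Proof.
have [h0|h0] := pselect (h ord0 = ord0); first by rewrite (cyl_mk_inl h0).
by rewrite !cyl_mk_inr//= ?bimap_act//; exact: delta1_up.
Qed.

Lemma cyl_inlE m n (h : {h : delta m 1 | h ord0 = ord0}) (x : bsimp X m n) :
  inl (h, x) = cyl_mk (proj1_sig h) x :> cyl_simp m n.
Proof. by case: h => h h0; rewrite (cyl_mk_inl h0). Qed.

Lemma cyl_act_id m n (c : cyl_simp m n) :
  cyl_act (delta_id m) (delta_id n) c = c.
Proof.
case: c => [[h x]|x'] /=; last by rewrite bact_id.
by rewrite delta_comp1 bact_id cyl_inlE.
Qed.

Lemma cyl_act_comp m'' m' m n'' n' n
    (s : delta m' m) (s' : delta m'' m') (t : delta n' n) (t' : delta n'' n')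
    (c : cyl_simp m n) :
  cyl_act (delta_comp s s') (delta_comp t t') c = cyl_act s' t' (cyl_act s t c).
Proof.
case: c => [[h x]|x'] /=; last by rewrite bact_comp.
by rewrite cyl_mk_act bact_comp delta_compA.
Qed.

Definition cyl_bisset : bisset := BiSSet cyl_act_id cyl_act_comp.

Definition cyl_pr m n (c : cyl_simp m n) : simp N n :=
  match c with inl (_, x) => over_proj x | inr x' => over_proj x' end.

Lemma cyl_pr_mk m n h (x : bsimp X m n) : cyl_pr (cyl_mk h x) = over_proj x.
Proof. by rewrite /cyl_mk; case: pselect => //= _; rewrite f_over. Qed.

Lemma cyl_pr_act m' m n' n (s : delta m' m) (t : delta n' n) (c : cyl_simp m n) :
  cyl_pr (cyl_act s t c) = sact t (cyl_pr c).
Proof. by case: c => [[h x]|x'] /=; rewrite ?cyl_pr_mk over_proj_act. Qed.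

Definition cyl : bisset_over N := @BissetOver N cyl_bisset cyl_pr cyl_pr_act.

Lemma cyl_in_act m' m n' n (s : delta m' m) (t : delta n' n) (x : bsimp X m n) :
  cyl_mk (end0 m') (bact s t x) = cyl_act s t (cyl_mk (end0 m) x).
Proof. by rewrite cyl_mk_act; congr cyl_mk; exact: delta_ext. Qed.

Definition cyl_in : bimap X cyl :=
  @BiMap X cyl_bisset (fun m n x => cyl_mk (end0 m) x) cyl_in_act.

Definition cyl_end : bimap X' cyl :=
  @BiMap X' cyl_bisset (fun m n x => inr x) (fun _ _ _ _ _ _ _ => erefl).

Definition cyl_out_fun m n (c : cyl_simp m n) : bsimp X' m n :=
  match c with inl (_, x) => bimapf f x | inr x' => x' end.

Lemma cyl_out_mk m n h (x : bsimp X m n) : cyl_out_fun (cyl_mk h x) = bimapf f x.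
Proof. by rewrite /cyl_mk; case: pselect. Qed.

Lemma cyl_out_act m' m n' n (s : delta m' m) (t : delta n' n) (c : cyl_simp m n) :
  cyl_out_fun (cyl_act s t c) = bact s t (cyl_out_fun c).
Proof. by case: c => [[h x]|x'] //=; rewrite cyl_out_mk bimap_act. Qed.

Definition cyl_out : bimap cyl X' := @BiMap cyl_bisset X' _ cyl_out_act.

Lemma cyl_in_over m n (x : bsimp X m n) : over_proj (bimapf cyl_in x) = over_proj x.
Proof. exact: cyl_pr_mk. Qed.

Lemma cyl_out_over m n (c : bsimp cyl m n) : over_proj (bimapf cyl_out c) = over_proj c.
Proof. by case: c => [[h x]|x'] //=; rewrite f_over. Qed.

Lemma cyl_end_over m n (x : bsimp X' m n) : over_proj (bimapf cyl_end x) = over_proj x.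
Proof. by []. Qed.

Lemma cyl_in_inj m n : injective (@bimapf _ _ cyl_in m n).
Proof.
move=> x y /=; have e : end0 m ord0 = ord0 by [].
by rewrite !(cyl_mk_inl e) => -[].
Qed.

Lemma cyl_degeneracies : degeneracies_bijective X -> degeneracies_bijective X' ->
  degeneracies_bijective cyl.
Proof.
move=> dX dX' m n' n t sg [[h y]|y] t_onto ysg.
  have [x [[xs xy] xu]] := dX m n' n t sg y t_onto ysg.
  exists (inl (h, x)); split=> [|[[h' x']|x'] [xs' xy']] //=.
    by split=> //; rewrite delta_comp1 -cyl_inlE xy.
  move: xy' => /=; rewrite delta_comp1 -cyl_inlE => -[hh' tx'].
  by rewrite hh' (xu x').
have [x [[xs xy] xu]] := dX' m n' n t sg y t_onto ysg.
exists (inr x); split=> [|[[h' x']|x'] [xs' xy']] //=.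
- by split=> //=; rewrite xy.
- by move: xy' => /=; rewrite delta_comp1 -cyl_inlE.
- by move: xy' => -[tx']; rewrite (xu x').
Qed.

Lemma dmax_homo m (u h : delta m 1) :
  {homo (fun k => Order.max (u k) (h k)) : i j / (i <= j)%O}.
Proof.
by move=> i j ij; rewrite ge_max !le_max !omorph_le ?orbT.
Qed.

Definition dmax m (u h : delta m 1) : delta m 1 := mkdelta (@dmax_homo m u h).

Definition cyl_htp m n (u : delta m 1) (c : cyl_simp m n) : cyl_simp m n :=
  match c with inl (h, x) => cyl_mk (dmax u (proj1_sig h)) x | inr x' => inr x' end.

Lemma dmax_up m (u h : delta m 1) : h ord0 <> ord0 -> dmax u h ord0 <> ord0.
Proof.
move=> h0 /= uh; apply: h0; apply/le_anti/andP; split; last by rewrite leEord.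
by rewrite -[leRHS]uh le_max lexx orbT.
Qed.

Lemma cyl_htp_mk m n (u h : delta m 1) (x : bsimp X m n) :
  cyl_htp u (cyl_mk h x) = cyl_mk (dmax u h) x.
Proof.
have [h0|h0] := pselect (h ord0 = ord0); first by rewrite (cyl_mk_inl h0).
by rewrite !cyl_mk_inr//; exact: dmax_up.
Qed.

Lemma cyl_htp_act m' m n' n (s : delta m' m) (t : delta n' n) u (c : cyl_simp m n) :
  cyl_htp (delta_comp u s) (cyl_act s t c) = cyl_act s t (cyl_htp u c).
Proof.
case: c => [[h x]|x'] //=; rewrite cyl_htp_mk cyl_mk_act; congr cyl_mk.
exact: delta_ext.
Qed.

Lemma cyl_htp0 m n (c : cyl_simp m n) : cyl_htp (end0 m) c = c.
Proof.
case: c => [[h x]|x'] //=; rewrite cyl_inlE; congr cyl_mk; apply: delta_ext => k /=.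
by apply: max_r; rewrite leEord.
Qed.

Lemma cyl_htp1 m n (c : cyl_simp m n) : cyl_htp (end1 m) c = inr (cyl_out_fun c).
Proof.
case: c => [[h x]|x'] //=; rewrite cyl_mk_inr//= => e1.
have : (ord_max <= (ord0 : 'I_2))%O by rewrite -e1 le_max lexx.
by rewrite leEord.
Qed.

Lemma cyl_pr_htp m n u (c : cyl_simp m n) : cyl_pr (cyl_htp u c) = cyl_pr c.
Proof. by case: c => [[h x]|x'] //=; rewrite cyl_pr_mk. Qed.

Section equivalences.
Context (R : realType).

Lemma cyl_out_diagonal_equivalence :
  homotopy_equivalence R (@realization_map R _ _ (diagonal_map cyl_out)).
Proof.
pose h : smap (prod_sset (std_sset 1) (diagonal_sset cyl)) (diagonal_sset cyl) :=
  @SMap (prod_sset (std_sset 1) (diagonal_sset cyl)) (diagonal_sset cyl)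
    (fun n uc => cyl_htp uc.1 uc.2)
    (fun m n d uc => cyl_htp_act d d uc.1 uc.2).
apply: (@simplicial_deformation R _ _ _ (diagonal_map cyl_end) h) => // n c.
  exact: cyl_htp0.
exact: cyl_htp1.
Qed.

Lemma cyl_out_fibre_equivalence n (sg : simp N n) : homotopy_equivalence R
  (@realization_map R _ _ (over_fibre_map cyl_out_over sg)).
Proof.
pose hf m (uc : simp (prod_sset (std_sset 1) (over_fibre cyl sg)) m) :
    simp (over_fibre cyl sg) m :=
  exist (fun c : bsimp cyl m n => over_proj c = sg) (cyl_htp uc.1 (proj1_sig uc.2))
    (etrans (cyl_pr_htp uc.1 (proj1_sig uc.2)) (proj2_sig uc.2)).
have h_act m m' (d : delta m m') uc : hf m (sact d uc) = sact d (hf m' uc).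
  by apply: sig_ext; exact: cyl_htp_act.
apply: (@simplicial_deformation R _ _ _ (over_fibre_map cyl_end_over sg) (SMap h_act))
  => [m c|m c|m c]; apply: sig_ext => //=.
  exact: cyl_htp0.
exact: cyl_htp1.
Qed.

End equivalences.

End cylinder.

(** Replace [f] by the inclusion of its domain in the mapping cylinder, which is
    an equivalence on each fibre and can be extended along cell by cell. *)
Theorem fibrewise_equivalence_diagonal (R : realType) (N : sset) (X X' : bisset_over N)
    (f : bimap X X')
    (f_over : forall m n (x : bsimp X m n), over_proj (bimapf f x) = over_proj x) :
  degeneracies_bijective X -> degeneracies_bijective X' ->
  (forall n (sg : simp N n),
    homotopy_equivalence R (@realization_map R _ _ (over_fibre_map f_over sg))) ->
  homotopy_equivalence R (@realization_map R _ _ (diagonal_map f)).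
Proof.
move=> dX dX' fe; pose iov := @cyl_in_over N X X' f f_over.
pose oov := @cyl_out_over N X X' f f_over.
have ie n (sg : simp N n) : pushout_extension R (over_fibre_map iov sg).
  have i_inj m : injective (@smapf _ _ (over_fibre_map iov sg) m).
    by move=> x y /(congr1 (@proj1_sig _ _)) /cyl_in_inj xy; exact: sig_ext.
  apply: strong_retract_extension => //; apply: equivalence_strong_retract => //.
  apply: equivalence_cancel (cyl_out_fibre_equivalence f_over R sg) _.
    exact: realization_map_continuous.
  rewrite -(@realization_map_comp R _ _ _ (over_fibre_map iov sg) (over_fibre_map oov sg)
    (over_fibre_map f_over sg))// => m x.
  by apply: sig_ext; rewrite /= cyl_out_mk.
have dC := @cyl_degeneracies N X X' f f_over dX dX'.
have ce := pushout_extension_equivalence (diagonal_pushout_extension dX dC ie).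
rewrite (@realization_map_comp R _ _ _ (diagonal_map (cyl_in f_over))
  (diagonal_map (cyl_out f_over))).
  exact: equivalence_comp ce (cyl_out_diagonal_equivalence f_over R).
by move=> n x /=; rewrite cyl_out_mk.
Qed.

(** * The cleaved nerve *)

Section total_composition.
Variable C : category.
Implicit Types f g h : Ar C.

(** Composition made total, to rewrite without carrying composability proofs. *)
Definition tc g f : Ar C :=
  if pselect (src g = tgt f) is left c then comp g f c else g.

Lemma tcE g f (c : src g = tgt f) : comp g f c = tc g f.
Proof.
rewrite /tc; case: pselect => // c'; exact: comp_congr.
Qed.

Lemma src_tc g f : src g = tgt f -> src (tc g f) = src f.
Proof. by move=> c; rewrite -(tcE c) src_comp. Qed.

Lemma tgt_tc g f : src g = tgt f -> tgt (tc g f) = tgt g.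
Proof. by move=> c; rewrite -(tcE c) tgt_comp. Qed.

Lemma tc_idl x f : x = tgt f -> tc (idm x) f = f.
Proof.
move=> ->; have c : src (idm (tgt f)) = tgt f by rewrite src_idm.
by rewrite -(tcE c) comp_idl.
Qed.

Lemma tc_idr x f : x = src f -> tc f (idm x) = f.
Proof.
move=> ->; have c : src f = tgt (idm (src f)) by rewrite tgt_idm.
by rewrite -(tcE c) comp_idr.
Qed.

Lemma tcA h g f : src h = tgt g -> src g = tgt f ->
  tc h (tc g f) = tc (tc h g) f.
Proof.
move=> hg gf.
have c1 : src h = tgt (comp g f gf) by rewrite tgt_comp.
have c2 : src (comp h g hg) = tgt f by rewrite src_comp.
by have := comp_assoc c1 c2; rewrite (tcE c1) (tcE c2) (tcE gf) (tcE hg).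
Qed.

End total_composition.

Lemma far_tc (C D : category) (F : functor C D) (g f : Ar C) :
  src g = tgt f -> far F (tc g f) = tc (far F g) (far F f).
Proof.
move=> c; have c' : src (far F g) = tgt (far F f) by rewrite src_far tgt_far c.
by rewrite -(tcE c) (far_comp F c c') tcE.
Qed.

Lemma functor_ext_ar (C D : category) (F G : functor C D) :
  (forall a, far F a = far G a) -> F = G.
Proof.
move=> FG; apply: functor_ext => // x.
by rewrite -[x]src_idm -!src_far FG.
Qed.

Lemma idm_inj (C : category) (x y : Ob C) : idm x = idm y -> x = y.
Proof. by move=> /(congr1 (@src C)); rewrite !src_idm. Qed.

Section strong_lifting.
Variables (B : category) (xi : cleaved_fibration B).
Local Notation p := (proj xi).

(** As cartesian arrows compose, the factorization through a cartesian arrow is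
    also available for arrows over a composite. *)
Lemma cartesian_strong (f g : Ar (total xi)) (psi : Ar B) :
  cartesian p f -> src g = src f -> src psi = fob p (tgt f) ->
  far p g = tc psi (far p f) ->
  exists! h, [/\ far p h = psi, src h = tgt f & tc h f = g].
Proof.
move=> fcart gf psif pg; have [_ cart_comp] := proj_fibration xi.
have [pre _] := proj_fibration xi.
have [w [wcart ws pw]] := pre (tgt f) psi psif.
have wfc : cartesian p (tc w f) by rewrite -(tcE ws); exact: cart_comp.
have psif' : src psi = tgt (far p f) by rewrite tgt_far.
have [||v [[pv [vs vE]] vu]] := wfc g.
- by rewrite src_tc.
- by rewrite far_tc// pw.
have vw : src v = tgt w by rewrite vs tgt_tc.
exists (tc v w); split=> [|h [ph hs hf]].
  split; last by rewrite -tcA// -vE tcE.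
  - by rewrite far_tc// pv tc_idl ?pw// tgt_tc// -tgt_far// pw.
  - by rewrite src_tc.
have [||v' [[pv' [vs' vE']] _]] := wcart h; [by rewrite hs ws|by rewrite pw|].
rewrite -vE' tcE; congr tc; apply: vu; split.
  by rewrite pv' tgt_tc.
have c : src v' = tgt (tc w f) by rewrite tgt_tc.
by exists c; rewrite tcE tcA// -(tcE vs') vE'.
Qed.

Lemma cleavage_lift (e : Ob (total xi)) (phi : Ar B) : src phi = fob p e ->
  exists a, [/\ cleavage xi a, src a = e & far p a = phi].
Proof.
have [_ lift _] := cleavageP xi; move=> /(lift e)[a [aP _]].
by exists a.
Qed.

Lemma cleavage_unique (a a' : Ar (total xi)) :
  cleavage xi a -> cleavage xi a' -> src a = src a' -> far p a = far p a' -> a = a'.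
Proof.
have [_ lift _] := cleavageP xi; move=> Sa Sa' aa' paa'.
have [|z [_ zu]] := lift (src a) (far p a); first by rewrite src_far.
by rewrite -(zu a)// -(zu a')// aa' paa'.
Qed.

End strong_lifting.

Lemma ord_ar_ext n (a b : Ar (ord_cat n)) : src a = src b -> tgt a = tgt b -> a = b.
Proof.
case: a b => -[i j] ij [[k l] kl] /= ik jl; apply: val_inj => /=.
by rewrite ik jl.
Qed.

Definition ar0 n (j : 'I_n.+1) : Ar (ord_cat n) :=
  exist (fun a : 'I_n.+1 * 'I_n.+1 => (a.1 <= a.2)%O) (ord0, j) (leq0n j).

Section bottom_row.
Variables (B : category) (xi : cleaved_fibration B) (m n : nat).
Local Notation p := (proj xi).
Local Notation E := (total xi).
Local Notation box_cat := (prod_cat (ord_cat m) (ord_cat n)).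

Definition bottom (a : Ar (ord_cat m)) : Ar box_cat :=
  (a, idm ((ord0 : 'I_n.+1) : Ob (ord_cat n))).

Lemma cliv_proj (x : cliv (box m n) xi) (a : Ar box_cat) :
  far p (far (cliv_total x) a) = far (cliv_base x) a.2.
Proof. by case: (clivP x) => -[/(congr1 (@far _ _)) /(congr1 (@^~ a))]. Qed.

Definition column (x : cliv (box m n) xi) (i : 'I_m.+1) (j : 'I_n.+1) : Ar E :=
  far (cliv_total x) ((idm (i : Ob (ord_cat m)), ar0 j) : Ar box_cat).

Lemma column_cleavage x i j : cleavage xi (column x i j).
Proof. by have [_ cl] := clivP x; apply: cl; exists i. Qed.

Lemma column_comp (x : cliv (box m n) xi) (a : Ar box_cat) :
  tc (far (cliv_total x) a) (column x (src a).1 (src a).2) =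
  tc (column x (tgt a).1 (tgt a).2)
     (far (cliv_total x) (bottom a.1)).
Proof.
rewrite /column -!far_tc//; congr (far _ _).
by apply: box_ar_ext; rewrite ?src_tc ?tgt_tc//=.
Qed.

(** The column arrows belong to the cleavage, so they are determined by their
    sources, and all values are induced on their targets by the bottom row. *)
Lemma bottom_inj (x y : cliv (box m n) xi) :
  cliv_base x = cliv_base y ->
  (forall a, far (cliv_total x) (bottom a) =
             far (cliv_total y) (bottom a)) -> x = y.
Proof.
move=> bxy txy; apply: cliv_ext => //; apply: functor_ext_ar => a.
have col i j : column x i j = column y i j.
  apply: (@cleavage_unique _ xi); try exact: column_cleavage.
    rewrite /column !src_far.
    have e0 := congr1 (@src E) (txy (idm (i : Ob (ord_cat m)))).
    by move: e0; rewrite !src_far.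
  by rewrite /column !cliv_proj bxy.
have cart : cartesian p (column x (src a).1 (src a).2).
  by have [cl _ _] := cleavageP xi; exact/cl/column_cleavage.
have [|||h [_ hu]] := cartesian_strong (g := tc (far (cliv_total x) a)
  (column x (src a).1 (src a).2)) (psi := far (cliv_base x) a.2) cart.
- by rewrite src_tc// src_far tgt_far.
- by rewrite -tgt_far /column cliv_proj src_far tgt_far.
- by rewrite far_tc ?cliv_proj// src_far tgt_far.
rewrite -(hu (far (cliv_total x) a)); last first.
  by split=> //; [exact: cliv_proj|rewrite src_far tgt_far].
apply: hu; split; first by rewrite cliv_proj bxy.
  by rewrite col src_far tgt_far.
by rewrite [RHS]column_comp txy !col [LHS]column_comp.
Qed.

Section bottom_ext.
Hypothesis closed_xi : split_cleaved xi.
Variables (sg : functor (ord_cat n) B) (c : functor (ord_cat m) E).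
Hypothesis c_vert : forall a, far p (far c a) = idm (fob sg (ord0 : 'I_n.+1)).

Lemma vert_ob (i : 'I_m.+1) : fob p (fob c i) = fob sg (ord0 : 'I_n.+1).
Proof. by apply: idm_inj; rewrite -far_idm -far_idm c_vert. Qed.

Lemma col_lift_subproof (i : 'I_m.+1) (j : 'I_n.+1) :
  src (far sg (ar0 j)) = fob p (fob c i).
Proof. by rewrite vert_ob src_far. Qed.

Definition col_lift (i : 'I_m.+1) (j : 'I_n.+1) : Ar E :=
  projT1 (cid (cleavage_lift (col_lift_subproof i j))).

Lemma col_liftP i j : [/\ cleavage xi (col_lift i j),
  src (col_lift i j) = fob c i & far p (col_lift i j) = far sg (ar0 j)].
Proof. exact: (projT2 (cid (cleavage_lift (col_lift_subproof i j)))). Qed.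

Lemma col_lift_cart i j : cartesian p (col_lift i j).
Proof. by have [cl _ _] := cleavageP xi; have [S _ _] := col_liftP i j; exact: cl. Qed.

Lemma col_tgt i j : fob p (tgt (col_lift i j)) = fob sg j.
Proof. by have [_ _ pT] := col_liftP i j; rewrite -tgt_far pT tgt_far. Qed.

Lemma col_comp (i : 'I_m.+1) (f : Ar (ord_cat m)) j : tgt f = i ->
  src (col_lift i j) = tgt (far c f).
Proof. by move=> fi; have [_ -> _] := col_liftP i j; rewrite tgt_far fi. Qed.

Lemma ar0_comp (b : Ar (ord_cat n)) : tc b (ar0 (src b)) = ar0 (tgt b).
Proof. by apply: ord_ar_ext; rewrite ?src_tc ?tgt_tc. Qed.

(** The value on a rectangle is the arrow induced on cleaved pushforwards. *)
Lemma ext_subproof (a : Ar box_cat) : exists! h,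
  [/\ far p h = far sg a.2, src h = tgt (col_lift (src a).1 (src a).2) &
      tc h (col_lift (src a).1 (src a).2) =
      tc (col_lift (tgt a).1 (tgt a).2) (far c a.1)].
Proof.
have [S sT pT] := col_liftP (src a).1 (src a).2.
have [S' sT' pT'] := col_liftP (tgt a).1 (tgt a).2.
have ct : src (col_lift (tgt a).1 (tgt a).2) = tgt (far c a.1) by exact: col_comp.
apply: cartesian_strong; first exact: col_lift_cart.
- by rewrite src_tc// sT src_far.
- by rewrite col_tgt src_far.
- rewrite far_tc// pT' c_vert tc_idr ?src_far// pT -far_tc//.
  by rewrite ar0_comp.
Qed.

Definition ext_far (a : Ar box_cat) : Ar E := projT1 (cid (ext_subproof a)).

Lemma ext_farP (a : Ar box_cat) : [/\ far p (ext_far a) = far sg a.2,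
  src (ext_far a) = tgt (col_lift (src a).1 (src a).2) &
  tc (ext_far a) (col_lift (src a).1 (src a).2) =
  tc (col_lift (tgt a).1 (tgt a).2) (far c a.1)].
Proof. by case: (projT2 (cid (ext_subproof a))). Qed.

Lemma ext_far_unique (a : Ar box_cat) h : far p h = far sg a.2 ->
  src h = tgt (col_lift (src a).1 (src a).2) ->
  tc h (col_lift (src a).1 (src a).2) =
  tc (col_lift (tgt a).1 (tgt a).2) (far c a.1) -> ext_far a = h.
Proof.
by move=> h1 h2 h3; case: (projT2 (cid (ext_subproof a))) => _; apply; split.
Qed.

Definition ext_fob (x : Ob box_cat) : Ob E := tgt (col_lift x.1 x.2).

Lemma ext_src (a : Ar box_cat) : src (ext_far a) = ext_fob (src a).
Proof. by have [_ -> _] := ext_farP a. Qed.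

Lemma ext_tgt (a : Ar box_cat) : tgt (ext_far a) = ext_fob (tgt a).
Proof.
have [_ sM M] := ext_farP a; rewrite -(tgt_tc sM) M tgt_tc//.
exact: col_comp.
Qed.

Lemma ext_idm (x : Ob box_cat) : ext_far (idm x) = idm (ext_fob x).
Proof.
apply: ext_far_unique; rewrite /= ?src_idm ?tgt_idm//.
  by rewrite far_idm /ext_fob col_tgt far_idm.
rewrite tc_idl// far_idm tc_idr//.
by have [_ -> _] := col_liftP x.1 x.2.
Qed.

Lemma ext_comp (g f : Ar box_cat) (e : src g = tgt f)
    (e' : src (ext_far g) = tgt (ext_far f)) :
  ext_far (comp g f e) = comp (ext_far g) (ext_far f) e'.
Proof.
have e1 : (comp g f e).1 = tc g.1 f.1 := tcE (congr1 fst e).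
have e2 : (comp g f e).2 = tc g.2 f.2 := tcE (congr1 snd e).
rewrite [RHS]tcE; have [pg sg' Mg] := ext_farP g; have [pf sf Mf] := ext_farP f.
apply: ext_far_unique; rewrite ?src_comp ?tgt_comp.
- by rewrite far_tc// pg pf e2 far_tc//; exact: (congr1 snd e).
- by rewrite src_tc.
- have cf : src (ext_far f) = tgt (col_lift (src f).1 (src f).2) by [].
  rewrite -tcA// Mf tcA; last first.
  + exact: col_comp.
  + by rewrite e' ext_tgt.
  rewrite -e Mg -tcA; last first.
  + by rewrite !src_far !tgt_far; congr fob; exact: (congr1 fst e).
  + exact: col_comp.
  congr tc; rewrite e1 far_tc//; exact: (congr1 fst e).
Qed.

Definition ext_total : functor box_cat E :=
  @Functor box_cat E ext_fob ext_far ext_src ext_tgt ext_idm ext_comp.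

(** Here the cleavage has to be closed: pushing forward in two steps agrees with
    pushing forward in one. *)
Lemma ext_cleavage (a : Ar box_cat) : box_cleavage a -> cleavage xi (ext_far a).
Proof.
move=> [i ai].
have [S sT pT] := col_liftP (src a).1 (src a).2.
have [S' sT' pT'] := col_liftP (tgt a).1 (tgt a).2.
have aij : (src a).1 = i /\ (tgt a).1 = i by rewrite /= ai.
have [w [Sw sw pw]] : exists w, [/\ cleavage xi w,
    src w = tgt (col_lift (src a).1 (src a).2) & far p w = far sg a.2].
  by apply: cleavage_lift; rewrite col_tgt src_far.
rewrite (ext_far_unique pw)//.
rewrite ai far_idm tc_idr; last by rewrite sT' aij.2.
apply: (@cleavage_unique _ xi) => //.
- by rewrite -(tcE sw); exact: closed_xi.
- by rewrite src_tc// sT sT' aij.1 aij.2.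
- by rewrite far_tc// pw pT pT' -far_tc// ar0_comp.
Qed.

Lemma ext_cleaved : @is_cleaved_map _ _ (box m n) xi ext_total sg.
Proof.
split; last exact: ext_cleavage.
split; last first.
  move=> a /box_cartesianP /ext_cleavage Sa.
  by have [cl _ _] := cleavageP xi; exact: cl.
by apply: functor_ext_ar => a /=; have [-> _ _] := ext_farP a.
Qed.

Lemma col_lift0 i : col_lift i ord0 = idm (fob c i).
Proof.
have [S sT pT] := col_liftP i ord0; have [_ _ nrm] := cleavageP xi.
apply: (@cleavage_unique _ xi) => //; first by rewrite sT src_idm.
rewrite pT far_idm vert_ob -far_idm; congr far.
exact: ord_ar_ext.
Qed.

Lemma bottom_ext : exists x : cliv (box m n) xi, cliv_base x = sg /\
  forall a, far (cliv_total x) (bottom a) = far c a.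
Proof.
exists (Cliv ext_cleaved); split=> // a; apply: ext_far_unique => /=.
- by rewrite c_vert far_idm.
- by rewrite col_lift0 tgt_idm src_far.
- by rewrite !col_lift0 tc_idr ?src_far// tc_idl// tgt_far.
Qed.

End bottom_ext.

End bottom_row.

Lemma bijective_equivalence (R : realType) (X Y : sset) (u : smap X Y) :
  (forall n, injective (@smapf _ _ u n)) ->
  (forall n (y : simp Y n), exists x, smapf u x = y) ->
  homotopy_equivalence R (@realization_map R _ _ u).
Proof.
move=> u_inj u_onto; pose v n y := projT1 (cid (u_onto n y)).
have vK n (y : simp Y n) : smapf u (v n y) = y := projT2 (cid (u_onto n y)).
have v_act m n (t : delta m n) (y : simp Y n) : v m (sact t y) = sact t (v n y).
  by apply: u_inj; rewrite smap_act !vK.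
apply: (@simplicial_deformation R _ _ u (SMap v_act)
  (@SMap (prod_sset (std_sset 1) X) X (fun n sx => sx.2) (fun _ _ _ _ => erefl))) => //.
by move=> n x; apply: u_inj; rewrite vK.
Qed.

Section nerve_fibres.
Variable B : category.

Definition nerve_over (xi : cleaved_fibration B) : bisset_over (nerve B) :=
  @BissetOver (nerve B) (cleaved_nerve xi) (fun m n x => cliv_base x)
    (fun _ _ _ _ _ _ _ => erefl).

Definition bottom_fob m n (i : 'I_m.+1) : Ob (prod_cat (ord_cat m) (ord_cat n)) :=
  (i, ord0 : 'I_n.+1).

Lemma bottom_comp m n (g f : Ar (ord_cat m)) (e : src g = tgt f)
    (e' : src (bottom n g) = tgt (bottom n f)) :
  bottom n (comp g f e) = comp (bottom n g) (bottom n f) e'.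
Proof. by apply: box_ar_ext; rewrite ?src_comp ?tgt_comp. Qed.

Definition bottom_functor m n :
    functor (ord_cat m) (prod_cat (ord_cat m) (ord_cat n)) :=
  @Functor (ord_cat m) (prod_cat (ord_cat m) (ord_cat n)) (@bottom_fob m n)
    (@bottom m n) (fun _ => erefl) (fun _ => erefl) (fun _ => erefl) (@bottom_comp m n).

Definition bottom_chain (xi : cleaved_fibration B) m n (x : cliv (box m n) xi) :
  functor (ord_cat m) (total xi) := functor_comp (cliv_total x) (bottom_functor m n).

Lemma bottom_chain_vert (xi : cleaved_fibration B) m n (x : cliv (box m n) xi) a :
  far (proj xi) (far (bottom_chain x) a) = idm (fob (cliv_base x) (ord0 : 'I_n.+1)).
Proof. by rewrite /= cliv_proj /= far_idm. Qed.

Lemma bottom_box_map m' m n' n (s : delta m' m) (t : delta n' n) a :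
  t ord0 = ord0 ->
  far (functor_prod (ord_functor s) (ord_functor t)) (@bottom m' n' a) =
  @bottom m n (far (ord_functor s) a).
Proof. by move=> t0; apply: box_ar_ext => /=; rewrite t0. Qed.

Lemma nerve_degeneracies (xi : cleaved_fibration B) :
  split_cleaved xi -> degeneracies_bijective (nerve_over xi).
Proof.
move=> split_xi m n' n t sg y t_onto ysg.
have t0 := onto_ord0 t_onto.
have vert a : far (proj xi) (far (bottom_chain y) a) = idm (fob sg (ord0 : 'I_n.+1)).
  by rewrite bottom_chain_vert [cliv_base y]ysg /= t0.
have row (x : cliv (box m n) xi) a :
    far (cliv_total (cliv_comp x (box_map (delta_id m) t))) (@bottom m n' a) =
    far (cliv_total x) (@bottom m n a).
  apply: etrans (congr1 _ (bottom_box_map (delta_id m) a t0)) _.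
  congr (far _ (bottom _ _)); exact: ord_ar_ext.
have [x [xs xE]] := bottom_ext split_xi vert.
exists x; split=> [|x' [xs' xy']].
  split=> //; apply: bottom_inj => [|a]; last by rewrite row xE.
  by rewrite [RHS]ysg /= xs.
apply: bottom_inj => [|a]; first by rewrite xs -xs'.
by rewrite xE -(row x') [cliv_comp _ _]xy'.
Qed.

Section to_fibre.
Variables (xi : cleaved_fibration B) (n : nat) (sg : simp (nerve B) n).
Local Notation b := (fob sg (ord0 : 'I_n.+1)).
Local Notation F := (fiber (proj xi) b).

Section lift_to_fibre.
Variables (m : nat) (c : functor (ord_cat m) (total xi)).
Hypothesis c_vert : forall a, far (proj xi) (far c a) = idm b.

Lemma lift_fob_subproof i : fob (proj xi) (fob c i) = b.
Proof. by apply: idm_inj; rewrite -far_idm -far_idm c_vert. Qed.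

Definition lift_fob (i : Ob (ord_cat m)) : Ob F :=
  exist _ (fob c i) (lift_fob_subproof i).

Definition lift_far (a : Ar (ord_cat m)) : Ar F := exist _ (far c a) (c_vert a).

Definition lift_to_fibre : functor (ord_cat m) F.
Proof.
apply: (@Functor (ord_cat m) F lift_fob lift_far).
- by move=> a; apply: sig_ext; exact: src_far.
- by move=> a; apply: sig_ext; exact: tgt_far.
- by move=> x; apply: sig_ext; exact: far_idm.
- by move=> g f e e'; apply: sig_ext; exact: far_comp.
Defined.

End lift_to_fibre.

Lemma fibre_vert m (x : simp (over_fibre (nerve_over xi) sg) m) a :
  far (proj xi) (far (bottom_chain (proj1_sig x)) a) = idm b.
Proof. by rewrite bottom_chain_vert [cliv_base _](proj2_sig x). Qed.

Definition to_fibre_fun m (x : simp (over_fibre (nerve_over xi) sg) m) :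
  simp (nerve F) m := lift_to_fibre (fibre_vert x).

Lemma to_fibre_act m m' (s : delta m m') (x : simp (over_fibre (nerve_over xi) sg) m') :
  to_fibre_fun (sact s x) = sact s (to_fibre_fun x).
Proof.
apply: functor_ext_ar => a; apply: sig_ext.
exact: (congr1 (far (cliv_total (proj1_sig x)))
  (bottom_box_map s a (erefl : delta_id n ord0 = ord0))).
Qed.

Definition to_fibre : smap (over_fibre (nerve_over xi) sg) (nerve F) :=
  SMap to_fibre_act.

Lemma to_fibre_equivalence (R : realType) : split_cleaved xi ->
  homotopy_equivalence R (@realization_map R _ _ to_fibre).
Proof.
move=> split_xi; apply: bijective_equivalence => [m x y xy|m c].
  apply/sig_ext/bottom_inj => [|a].
    by rewrite [LHS](proj2_sig x) [RHS](proj2_sig y).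
  by have := congr1 (fun c : functor (ord_cat m) F => proj1_sig (far c a)) xy.
pose c' := functor_comp (@Functor F (total xi) (fun e => proj1_sig e)
  (fun a => proj1_sig a) (fun _ => erefl) (fun _ => erefl) (fun _ => erefl)
  (fun g f e e' => comp_congr _ _ erefl erefl)) c.
have vert a : far (proj xi) (far c' a) = idm b by exact: (proj2_sig (far c a)).
have [x [xs xE]] := bottom_ext split_xi vert.
exists (exist _ x xs); apply: functor_ext_ar => a; apply: sig_ext.
exact: xE.
Qed.

End to_fibre.

End nerve_fibres.

(** The fibre of the cleaved nerve over [sg] is identified with the nerve of the
    fiber over the first vertex of [sg]. *)
Theorem mainTheorem2 (R : realType) (B : category)
    (xi xi' : cleaved_fibration B)
    (closed_xi : split_cleaved xi) (closed_xi' : split_cleaved xi')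
    (f : functor (total xi) (total xi'))
    (hf : is_cleaved_map f (functor_id B))
    (hfib : forall b : Ob B, weak_equivalence R (fiber_functor hf b)) :
  bisset_weak_equivalence R (cleaved_nerve_map (Cliv hf)).
Proof.
pose F : bimap (nerve_over xi) (nerve_over xi') := cleaved_nerve_map (Cliv hf).
have F_over m n (x : bsimp (nerve_over xi) m n) : over_proj (bimapf F x) = over_proj x.
  exact: functor_ext.
apply: (fibrewise_equivalence_diagonal (f := F) (f_over := F_over)).
- exact: nerve_degeneracies.
- exact: nerve_degeneracies.
move=> n sg.
apply: equivalence_cancel (to_fibre_equivalence sg R closed_xi') _.
  exact: realization_map_continuous.
have sqE : @realization_map R _ _ (to_fibre xi' sg) \o
    @realization_map R _ _ (over_fibre_map F_over sg) =
    @realization_map R _ _ (nerve_map (fiber_functor hf (fob sg (ord0 : 'I_n.+1)))) \o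
    @realization_map R _ _ (to_fibre xi sg).
  apply/funext => c; have [m [x [t ->]]] := rcell_onto c.
  rewrite /= (realization_mapE (over_fibre_map _ _)) (realization_mapE (to_fibre xi sg)).
  rewrite !realization_mapE; congr rcell.
  by apply: functor_ext_ar => a; exact: sig_ext.
rewrite sqE; apply: equivalence_comp; last exact: hfib.
exact: to_fibre_equivalence.
Qed.
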